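(* Let $r\in\mathbb{N}=\{1,2,3,\dots\}$, $t_r=\frac{2^{r+1}}{2^{r+1}-1}\pi$, $J_r=[2^{r+1}\pi,\,2^{r+1}t_r]$, and let $\epsilon$ satisfy $0<\epsilon<\frac{2^r-1}{2^{r+1}-1}\pi$. Put $$S_1=\Bigl[\tfrac{t_r}{2}+\tfrac{\epsilon}{2^{r+1}},\ \tfrac{t_r}{2}+\epsilon\Bigr],\quad S_2=[t_r+2\epsilon,\ 2\pi],\quad S_3=[2^{r+1}t_r,\ 2^{r+1}t_r+2\epsilon],$$ and define recursively $$E_0=S_1+2^{r+1}\pi,\quad F_0=2^{-(r+2)}E_0,\qquad E_n=F_{n-1}+2^{r+1}\pi,\quad F_n=2^{-(n+r+2)}E_n\quad(n\ge1),$$ $$K_{r,\epsilon}=\Bigl(J_r\setminus\bigcup_{n=0}^\infty E_n\Bigr)\cup\Bigl(\bigcup_{n=0}^\infty F_n\Bigr)\cup(S_1\cup S_2\cup S_3).$$ Let $\psi_{r,\epsilon}\in L^2(\mathbb{R})$ be the function with $\hat\psi_{r,\epsilon}=\chi_{K_{r,\epsilon}}$. Then $\psi_{r,\epsilon}$ is an $H^2$-wavelet, and $\hat\psi_{r,\epsilon}$ does not vanish (almost everywhere) in any neighbourhood of $0$; in particular, $\hat\psi_{r,\epsilon}$ is discontinuous at the origin.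
   Context: The Fourier transform is $\hat f(\xi)=\int_{\mathbb{R}} f(x)e^{-i\xi x}\,dx$ (extended to $L^2(\mathbb{R})$ as usual). The Hardy space is $H^2(\mathbb{R})=\{f\in L^2(\mathbb{R}):\hat f(\xi)=0\text{ for a.e. }\xi\le 0\}$. A function $\psi\in H^2(\mathbb{R})$ is an $H^2$-wavelet if $\{\psi_{j,k}=2^{j/2}\psi(2^j\cdot-k):j,k\in\mathbb{Z}\}$ is an orthonormal basis of $H^2(\mathbb{R})$. For a set $S\subset\mathbb{R}$ and reals $c,a$, $cS+a=\{cs+a:s\in S\}$, and $\chi_S$ is the characteristic function of $S$. *)

(* Defs.v *)
From HB Require Import structures.
From mathcomp Require Import all_boot all_order all_algebra.
From mathcomp Require Import complex.
From mathcomp Require Import all_classical all_reals all_analysis.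

Set Implicit Arguments.
Unset Strict Implicit.
Unset Printing Implicit Defensive.
Import Order.TTheory GRing.Theory Num.Theory.
Import numFieldNormedType.Exports.
Local Open Scope classical_set_scope.
Local Open Scope complex_scope.
Local Open Scope ring_scope.

(* Elements of L^1(R) and L^2(R) are represented by Borel measurable functions
   R -> R[i]; equality in these spaces is equality almost everywhere. *)

Section ComplexLp.
Context {R : realType}.
Implicit Types f g : R -> R[i].

Definition cnorm (p : \bar R) f : \bar R :=
  'N[@lebesgue_measure R]_p[EFin \o (fun x => ComplexField.Normc.normc (f x))].

Definition inLp (p : \bar R) f : Prop :=
  [/\ measurable_fun [set: R] (fun x => complex.Re (f x)),
      measurable_fun [set: R] (fun x => complex.Im (f x)) &
      (cnorm p f < +oo)%E].

Definition cintegral f : R[i] :=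
  (\int[@lebesgue_measure R]_x complex.Re (f x))
    +i* (\int[@lebesgue_measure R]_x complex.Im (f x)).

Definition inner f g : R[i] := cintegral (fun x => f x * (g x)^*).

(* e^{it} *)
Definition cis (t : R) : R[i] := cos t +i* sin t.

(* The integral defining the Fourier transform, meaningful for f in L^1. *)
Definition fourier f (xi : R) : R[i] :=
  cintegral (fun x => f x * cis (- (xi * x))).

(* [is_fourierL2 f g]: g represents the Fourier transform of f in L^2(R), i.e.
   the image of f under the L^2-continuous extension of [fourier] from
   L^1 `&` L^2. *)
Definition is_fourierL2 f g : Prop :=
  [/\ inLp 2%:E f, inLp 2%:E g &
   exists u : nat -> R -> R[i],
    [/\ forall n, inLp 1%:E (u n) /\ inLp 2%:E (u n),
        cnorm 2%:E (fun x => u n x - f x) @[n --> \oo] --> 0%E &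
        cnorm 2%:E (fun xi => fourier (u n) xi - g xi) @[n --> \oo] --> 0%E]].

(* H^2(R). As g is determined by f up to a null set, the choice of g does not
   matter. *)
Definition hardy2 : set (R -> R[i]) :=
  [set f | exists2 g, is_fourierL2 f g &
     {ae @lebesgue_measure R, forall xi, xi <= 0 -> g xi = 0}].

(* Orthonormal basis of the subspace H of L^2(R): an orthonormal family in H
   whose finite linear combinations are dense in H. *)
Definition orthonormal_basis (I : eqType) (H : set (R -> R[i]))
    (e : I -> R -> R[i]) : Prop :=
  [/\ forall i, H (e i),
      forall i j, inner (e i) (e j) = (i == j)%:R &
      forall f, H f -> forall delta : R, 0 < delta ->
        exists (s : seq I) (c : I -> R[i]),
          (cnorm 2%:E (fun x => (f x - \sum_(i <- s) c i * e i x)%R)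
             < delta%:E)%E].

Definition wavelet_system (psi : R -> R[i]) (jk : int * int) (x : R) : R[i] :=
  (2 `^ (jk.1%:~R / 2))%:C * psi (2 ^ jk.1 * x - jk.2%:~R).

Definition H2_wavelet (psi : R -> R[i]) : Prop :=
  hardy2 psi /\ orthonormal_basis hardy2 (wavelet_system psi).

Definition char_fun (S : set R) (x : R) : R[i] := (\1_S x)%:C.

End ComplexLp.

Section WaveletSet.
Context {R : realType}.
Variables (r : nat) (eps : R).

(* c S + a *)
Definition affine (c a : R) (S : set R) : set R := [set c * s + a | s in S].

Definition t_ : R := 2 ^+ r.+1 / (2 ^+ r.+1 - 1) * pi.

Definition J_ : set R := `[2 ^+ r.+1 * pi, 2 ^+ r.+1 * t_].

Definition S1 : set R := `[t_ / 2 + eps / 2 ^+ r.+1, t_ / 2 + eps].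
Definition S2 : set R := `[t_ + 2 * eps, 2 * pi].
Definition S3 : set R := `[2 ^+ r.+1 * t_, 2 ^+ r.+1 * t_ + 2 * eps].

Fixpoint E_ (n : nat) : set R :=
  affine 1 (2 ^+ r.+1 * pi)
    (if n is m.+1 then affine (2 ^- (m + r + 2)) 0 (E_ m) else S1).

Definition F_ (n : nat) : set R := affine (2 ^- (n + r + 2)) 0 (E_ n).

Definition K_ : set R :=
  (J_ `\` \bigcup_n E_ n) `|` \bigcup_n F_ n `|` (S1 `|` S2 `|` S3).

End WaveletSet.

(* Main.v *)
Require Import Defs.
From HB Require Import structures.
From mathcomp Require Import all_boot all_order all_algebra.
From mathcomp Require Import complex.
From mathcomp Require Import all_classical all_reals all_analysis.
From mathcomp Require Import measurable_realfun.
From mathcomp Require Import zify ring lra.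

Set Implicit Arguments.
Unset Strict Implicit.
Unset Printing Implicit Defensive.
Import Order.TTheory GRing.Theory Num.Theory.
Import numFieldNormedType.Exports.
Local Open Scope classical_set_scope.
Local Open Scope ring_scope.

(** Up to the factor [2 * pi] the Fourier transform is an isometry, so that the
    wavelet property can be read on the transform side, where the wavelet with
    indices [j] and [k] becomes, up to a constant, [char_fun K] times an
    exponential, both dilated by [2 ^ j].  The set [K = K_ r eps] tiles in two
    ways, up to null sets.

    - Translations by multiples of [2 * pi] of [K] tile the line
      ([K_translation]): on [0, 2 * pi] the low part of [K] consists of the sets
      [S1], [F_0], [F_1], ... and [S2], while the high part is the translate, by
      [N * pi] with [N = 2 ^+ r.+1], of the complement: [E_n] is removed from [J_]
      exactly because the translated copy of [F_(n-1)] (of [S1] when [n] is [0])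
      is already present.  Hence the exponentials form an orthogonal basis of
      L^2(K) ([ip_K_expi], [fproj_K_dense]).
    - Dilations of [K] by powers of [2] tile the positive half-line ([K_dyadic]):
      scaled into [pi, 2 * pi], the sets [J_], [S3], [S1], [S2] become consecutive
      intervals with endpoints [pi], [t], [t + 2 * eps / N], [t + 2 * eps] and
      [2 * pi], and each [E_n] removed from [J_] is put back as its dilate [F_n].
      Hence L^2 of the half-line is the orthogonal sum of the spaces L^2(2^j K).

    Together these give [H2_wavelet_tiles], which holds for any set with the two
    tiling properties.  Since [F_n] has positive measure and lies in
    ]0, t / 2 ^+ n.+1], the transform equals [1] on sets of positive measure
    arbitrarily close to the origin, and it vanishes on the negative half-line;
    this gives the last two claims.

    The analytic input is proved from measure theory.  The trigonometric system is
    complete ([fser_cL2]): Chernoff's telescoping argument gives pointwise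
    convergence of the Fourier series of the indicator of a half-line, Bessel and
    Fatou turn it into mean square convergence, and a Dynkin class argument
    followed by approximation with simple functions reaches all of L^2.
    Plancherel's formula ([sqnorm_fourier]) follows: for [u] supported in
    [0, 2 * pi] the values of its transform at [x + k], for integers [k], are the
    Fourier coefficients of a modulation of [u], so that Parseval's identity
    integrated over [x] in [0, 1] is Plancherel's formula.  Scaling and truncation
    remove the support condition, and the multiplication formula produces a
    function with transform [char_fun K] ([fourierL2_exists]). *)

(** * Complex-valued functions: integral, inner product, mean square norm *)

(** The squared modulus, kept in the real field, where [lra] and [nra] apply. *)
Definition sqn {R : realType} (z : R[i]) : R :=
  complex.Re z ^+ 2 + complex.Im z ^+ 2.

Definition energy {R : realType} (D : set R) (f : R -> R[i]) : \bar R :=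
  (\int[@lebesgue_measure R]_(x in D) (sqn (f x))%:E)%E.

(** The squared norm of L^2(D).  It and [cint] are locked: conversion would
    otherwise unfold the Lebesgue integral. *)
HB.lock Definition sqnorm {R : realType} (D : set R) (f : R -> R[i]) : R :=
  fine (energy D f).

HB.lock Definition cint {R : realType} (D : set R) (f : R -> R[i]) : R[i] :=
  Complex (\int[@lebesgue_measure R]_(x in D) complex.Re (f x))
          (\int[@lebesgue_measure R]_(x in D) complex.Im (f x)).

Section ComplexIntegral.
Context {R : realType}.
Local Notation mu := (@lebesgue_measure R).
Local Notation Re := complex.Re.
Local Notation Im := complex.Im.
Implicit Types (f g h : R -> R[i]) (z w : R[i]) (D : set R).

Lemma ReD z w : Re (z + w) = Re z + Re w. Proof. by case: z w => [? ?] [? ?]. Qed.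
Lemma ImD z w : Im (z + w) = Im z + Im w. Proof. by case: z w => [? ?] [? ?]. Qed.
Lemma ReN z : Re (- z) = - Re z. Proof. by case: z. Qed.
Lemma ImN z : Im (- z) = - Im z. Proof. by case: z. Qed.
Lemma ReM z w : Re (z * w) = Re z * Re w - Im z * Im w.
Proof. by case: z w => [? ?] [? ?]. Qed.
Lemma ImM z w : Im (z * w) = Re z * Im w + Im z * Re w.
Proof. by case: z w => [? ?] [? ?]. Qed.
Lemma Re_conjc z : Re (conjc z) = Re z. Proof. by case: z. Qed.
Lemma Im_conjc z : Im (conjc z) = - Im z. Proof. by case: z. Qed.
Lemma ReC (x : R) : Re (real_complex R x) = x. Proof. by []. Qed.
Lemma ImC (x : R) : Im (real_complex R x) = 0. Proof. by []. Qed.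
Lemma Re0 : Re (0 : R[i]) = 0. Proof. by []. Qed.
Lemma Im0 : Im (0 : R[i]) = 0. Proof. by []. Qed.
Definition ReImE :=
  (ReD, ImD, ReN, ImN, ReM, ImM, Re_conjc, Im_conjc).

Lemma complexP z w : Re z = Re w -> Im z = Im w -> z = w.
Proof. by case: z w => [? ?] [? ?] /= -> ->. Qed.

Lemma sqn_ge0 z : 0 <= sqn z. Proof. by rewrite addr_ge0 ?sqr_ge0. Qed.
Lemma sqnM z w : sqn (z * w) = sqn z * sqn w.
Proof. by rewrite /sqn !ReImE; ring. Qed.
Lemma sqn_conjc z : sqn (conjc z) = sqn z.
Proof. by rewrite /sqn !ReImE sqrrN. Qed.
Lemma sqnN z : sqn (- z) = sqn z.
Proof. by rewrite /sqn !ReImE !sqrrN. Qed.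
Lemma sqn0 : sqn (0 : R[i]) = 0. Proof. by rewrite /sqn Re0 Im0 expr0n addr0. Qed.
Lemma sqn1 : sqn (1 : R[i]) = 1. Proof. by rewrite /sqn /= expr0n expr1n addr0. Qed.
Lemma sqnC (x : R) : sqn (real_complex R x) = x ^+ 2.
Proof. by rewrite /sqn ReC ImC expr0n addr0. Qed.
Lemma sqn_cis t : sqn (cis t) = 1 :> R.
Proof. by rewrite /sqn /= cos2Dsin2. Qed.
Lemma sqn_eq0 z : sqn z = 0 -> z = 0.
Proof.
move=> /eqP; rewrite /sqn paddr_eq0 ?sqr_ge0// !sqrf_eq0 => /andP[/eqP a /eqP b].
exact: complexP.
Qed.
Lemma mulc_conjc z : z * conjc z = real_complex R (sqn z).
Proof. by apply: complexP; rewrite !ReImE /sqn ?ReC ?ImC; ring. Qed.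
Lemma sqnD_le z w : sqn (z + w) <= 2 * sqn z + 2 * sqn w.
Proof.
rewrite -subr_ge0 (_ : _ - _ = sqn (z - w)) ?sqn_ge0//.
by rewrite /sqn !ReImE; ring.
Qed.

Lemma cisD (s t : R) : cis (s + t) = cis s * cis t.
Proof. by apply: complexP; rewrite !ReImE /= ?cosD ?sinD; ring. Qed.
Lemma cis0 : cis (0 : R) = 1. Proof. by rewrite /cis cos0 sin0. Qed.
Lemma conjc_cis (t : R) : conjc (cis t) = cis (- t).
Proof. by rewrite /cis cosN sinN. Qed.

(** Measurability by components, as in [inLp]. *)
Definition cmeas f : Prop :=
  measurable_fun setT (fun x => Re (f x)) /\
  measurable_fun setT (fun x => Im (f x)).

Lemma cmeasD f g : cmeas f -> cmeas g -> cmeas (fun x => f x + g x).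
Proof.
move=> [f1 f2] [g1 g2]; split;
  by under eq_fun do rewrite !ReImE; apply: measurable_funD.
Qed.
Lemma cmeasN f : cmeas f -> cmeas (fun x => - f x).
Proof.
move=> [f1 f2]; split;
  by under eq_fun do rewrite !ReImE; apply: measurable_funN.
Qed.
Lemma cmeasB f g : cmeas f -> cmeas g -> cmeas (fun x => f x - g x).
Proof. by move=> mf mg; apply: cmeasD => //; apply: cmeasN. Qed.
Lemma cmeasM f g : cmeas f -> cmeas g -> cmeas (fun x => f x * g x).
Proof.
move=> [f1 f2] [g1 g2]; split; under eq_fun do rewrite !ReImE.
- by apply: measurable_funB; apply: measurable_funM.
- by apply: measurable_funD; apply: measurable_funM.
Qed.
Lemma cmeas_cst z : cmeas (fun=> z).
Proof. by split; apply: measurable_cst. Qed.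
Lemma cmeas_conjc f : cmeas f -> cmeas (fun x => conjc (f x)).
Proof.
move=> [f1 f2]; split; under eq_fun do rewrite !ReImE; first by [].
exact: measurable_funN.
Qed.
Lemma cmeasZ z f : cmeas f -> cmeas (fun x => z * f x).
Proof. by move=> mf; apply: cmeasM => //; apply: cmeas_cst. Qed.
Lemma cmeasC (u : R -> R) : measurable_fun setT u ->
  cmeas (fun x => real_complex R (u x)).
Proof. by move=> mu_; split => //=; apply: measurable_cst. Qed.
Lemma cmeas_comp f (u : R -> R) : measurable_fun setT u -> cmeas f ->
  cmeas (fun x => f (u x)).
Proof.
move=> mu_ [f1 f2]; split.
- exact: (measurableT_comp f1 mu_).
- exact: (measurableT_comp f2 mu_).
Qed.
Lemma cmeas_cis (u : R -> R) : measurable_fun setT u ->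
  cmeas (fun x => cis (u x)).
Proof.
move=> mu_; split => /=.
- apply: measurableT_comp mu_; apply: continuous_measurable_fun.
  exact: continuous_cos.
- apply: measurableT_comp mu_; apply: continuous_measurable_fun.
  exact: continuous_sin.
Qed.
Lemma cmeas_char (A : set R) : measurable A -> cmeas (char_fun A).
Proof. by move=> mA; apply: cmeasC; apply: measurable_indic. Qed.
Lemma measurable_sqn f D : cmeas f -> measurable_fun D (fun x => sqn (f x)).
Proof.
move=> [f1 f2]; apply: measurable_funD; apply: measurable_funX;
  exact: measurable_funTS.
Qed.
Lemma measurable_sqnE f D : cmeas f ->
  measurable_fun D (fun x => (sqn (f x))%:E).
Proof. by move=> mf; apply/measurable_EFinP; apply: measurable_sqn. Qed.

Definition cL1 D f : Prop :=
  [/\ cmeas f, mu.-integrable D (fun x => (Re (f x))%:E) &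
      mu.-integrable D (fun x => (Im (f x))%:E)].

Definition cL2 D f : Prop := cmeas f /\ (energy D f < +oo)%E.

Lemma Re_cint D f : Re (cint D f) = \int[mu]_(x in D) Re (f x).
Proof. by rewrite unlock. Qed.
Lemma Im_cint D f : Im (cint D f) = \int[mu]_(x in D) Im (f x).
Proof. by rewrite unlock. Qed.

Lemma cintT f : cint setT f = cintegral f.
Proof. by rewrite unlock. Qed.

Lemma energy_ge0 D f : (0 <= energy D f)%E.
Proof. by apply: integral_ge0 => x _; rewrite lee_fin sqn_ge0. Qed.

Lemma sqnorm_ge0 D f : 0 <= sqnorm D f.
Proof. by rewrite unlock; exact/fine_ge0/energy_ge0. Qed.

Lemma energyE D f : cL2 D f -> energy D f = (sqnorm D f)%:E.
Proof.
by move=> [_ h]; rewrite unlock fineK// ge0_fin_numE// energy_ge0.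
Qed.

Variable D : set R.
Hypothesis mD : measurable D.

Lemma cL1D f g : cL1 D f -> cL1 D g -> cL1 D (fun x => f x + g x).
Proof.
move=> [mf f1 f2] [mg g1 g2]; split; first exact: cmeasD.
- by under eq_fun do rewrite !ReImE EFinD; apply: integrableD.
- by under eq_fun do rewrite !ReImE EFinD; apply: integrableD.
Qed.

Lemma integrable_scale (k : R) (u : R -> R) :
  mu.-integrable D (fun x => (u x)%:E) ->
  mu.-integrable D (fun x => (k * u x)%:E).
Proof. exact: integrableZl. Qed.

Lemma cL1Z z f : cL1 D f -> cL1 D (fun x => z * f x).
Proof.
move=> [mf f1 f2]; split; first exact: cmeasZ.
- under eq_fun do rewrite !ReImE EFinB.
  by apply: integrableB => //; apply: integrable_scale.
- under eq_fun do rewrite !ReImE EFinD.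
  by apply: integrableD => //; apply: integrable_scale.
Qed.

Lemma cintD f g : cL1 D f -> cL1 D g ->
  cint D (fun x => f x + g x) = cint D f + cint D g.
Proof.
move=> [mf f1 f2] [mg g1 g2]; apply: complexP.
- rewrite ReD !Re_cint -RintegralD//.
  by apply: eq_Rintegral => x _; rewrite ReD.
- rewrite ImD !Im_cint -RintegralD//.
  by apply: eq_Rintegral => x _; rewrite ImD.
Qed.

Lemma cintZ z f : cL1 D f -> cint D (fun x => z * f x) = z * cint D f.
Proof.
move=> [mf f1 f2]; apply: complexP.
- rewrite ReM !(Re_cint, Im_cint) -!RintegralZl// -RintegralB//;
    try exact: integrable_scale.
  by apply: eq_Rintegral => x _; rewrite ReM.
- rewrite ImM !(Re_cint, Im_cint) -!RintegralZl// -RintegralD//;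
    try exact: integrable_scale.
  by apply: eq_Rintegral => x _; rewrite ImM.
Qed.

Lemma cint_conjc f : cL1 D f ->
  cint D (fun x => conjc (f x)) = conjc (cint D f).
Proof.
move=> [mf f1 f2]; apply: complexP.
- by rewrite Re_conjc !Re_cint; apply: eq_Rintegral => x _; rewrite Re_conjc.
- rewrite Im_conjc !Im_cint -mulN1r -RintegralZl//.
  by apply: eq_Rintegral => x _; rewrite Im_conjc mulN1r.
Qed.

Lemma cL10 : cL1 D (fun=> 0).
Proof.
split; first exact: cmeas_cst.
- exact: integrable0.
- exact: integrable0.
Qed.

Lemma cint0 : cint D (fun=> 0) = 0.
Proof.
by apply: complexP; rewrite ?Re_cint ?Im_cint Rintegral_cst// mul0r.
Qed.

Lemma cint_sum (I : Type) (s : seq I) (F : I -> R -> R[i]) :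
  (forall i, cL1 D (F i)) ->
  cL1 D (fun x => \sum_(i <- s) F i x) /\
  cint D (fun x => \sum_(i <- s) F i x) = \sum_(i <- s) cint D (F i).
Proof.
move=> LF; elim: s => [|i s [IH1 IH2]].
  split; first by under eq_fun do rewrite big_nil; apply: cL10.
  by rewrite big_nil; under eq_fun do rewrite big_nil; rewrite cint0.
under eq_fun do rewrite big_cons.
by split; [apply: cL1D|rewrite cintD// IH2 big_cons].
Qed.


Lemma cL2_integrable f : cL2 D f -> mu.-integrable D (fun x => (sqn (f x))%:E).
Proof.
move=> [mf h]; apply/integrableP; split; first exact: measurable_sqnE.
by under eq_integral do rewrite gee0_abs ?lee_fin ?sqn_ge0//.
Qed.

Lemma cL2_le f (F : R -> R) : cmeas f ->
  mu.-integrable D (fun x => (F x)%:E) ->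
  (forall x, D x -> sqn (f x) <= F x) -> cL2 D f.
Proof.
move=> mf iF le; split=> //.
apply: (@le_lt_trans _ _ (\int[mu]_(x in D) (F x)%:E)%E).
  apply: ge0_le_integral => //.
  - by move=> x _; rewrite lee_fin sqn_ge0.
  - exact: measurable_sqnE.
  - by case/integrableP: iF.
exact: integrable_lty.
Qed.

Lemma cL2D f g : cL2 D f -> cL2 D g -> cL2 D (fun x => f x + g x).
Proof.
move=> Lf Lg; apply: (@cL2_le _ (fun x => 2 * sqn (f x) + 2 * sqn (g x))).
- exact: cmeasD Lf.1 Lg.1.
- under eq_fun do rewrite EFinD !EFinM.
  by apply: integrableD => //; apply: integrableZl => //; apply: cL2_integrable.
- by move=> x _; exact: sqnD_le.
Qed.

Lemma cL2M f h (M : R) : cmeas h -> (forall x, D x -> sqn (h x) <= M) ->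
  cL2 D f -> cL2 D (fun x => h x * f x).
Proof.
move=> mh hM Lf; apply: (@cL2_le _ (fun x => M * sqn (f x))).
- exact: cmeasM mh Lf.1.
- under eq_fun do rewrite EFinM.
  by apply: integrableZl => //; apply: cL2_integrable.
- by move=> x Dx; rewrite sqnM ler_wpM2r ?sqn_ge0 ?hM.
Qed.

Lemma cL2Z z f : cL2 D f -> cL2 D (fun x => z * f x).
Proof. exact/cL2M/(fun _ _ => lexx _)/cmeas_cst. Qed.

Lemma cL2N f : cL2 D f -> cL2 D (fun x => - f x).
Proof. by move=> /(cL2Z (-1)); under eq_fun do rewrite mulN1r. Qed.

Lemma cL2B f g : cL2 D f -> cL2 D g -> cL2 D (fun x => f x - g x).
Proof. by move=> Lf Lg; apply: cL2D => //; apply: cL2N. Qed.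

Lemma cL20 : cL2 D (fun=> 0).
Proof.
split; first exact: cmeas_cst.
by rewrite /energy; under eq_integral do rewrite sqn0; rewrite integral0.
Qed.

Lemma cL2_sum (I : Type) (s : seq I) (F : I -> R -> R[i]) :
  (forall i, cL2 D (F i)) -> cL2 D (fun x => \sum_(i <- s) F i x).
Proof.
move=> LF; elim: s => [|i s IH].
  by under eq_fun do rewrite big_nil; apply: cL20.
by under eq_fun do rewrite big_cons; apply: cL2D.
Qed.

Lemma cL2_conjc f : cL2 D f -> cL2 D (fun x => conjc (f x)).
Proof.
move=> Lf; apply: (@cL2_le _ (fun x => sqn (f x))).
- exact/cmeas_conjc/Lf.1.
- exact: cL2_integrable.
- by move=> x _; rewrite sqn_conjc.
Qed.

Lemma cL1_le f (F : R -> R) : cmeas f ->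
  mu.-integrable D (fun x => (F x)%:E) ->
  (forall x, D x -> `|Re (f x)| <= F x /\ `|Im (f x)| <= F x) -> cL1 D f.
Proof.
move=> mf iF le; split=> //.
- apply: le_integrable iF => //.
  + by apply/measurable_EFinP; apply: measurable_funTS; exact: mf.1.
  + move=> x Dx; rewrite /= lee_fin (le_trans (le _ Dx).1)// ler_norm//.
- apply: le_integrable iF => //.
  + by apply/measurable_EFinP; apply: measurable_funTS; exact: mf.2.
  + move=> x Dx; rewrite /= lee_fin (le_trans (le _ Dx).2)// ler_norm//.
Qed.

Lemma normr_ReIm_mul z w :
  `|Re (z * w)| <= sqn z + sqn w /\ `|Im (z * w)| <= sqn z + sqn w.
Proof.
case: z w => [a b] [c d]; rewrite /sqn /= !ler_norml.
have := (sqr_ge0 (a + c), sqr_ge0 (a - c), sqr_ge0 (b + d), sqr_ge0 (b - d)).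
have := (sqr_ge0 (a + d), sqr_ge0 (a - d), sqr_ge0 (b + c), sqr_ge0 (b - c)).
move=> [[[h1 h2] h3] h4] [[[h5 h6] h7] h8].
by split; apply/andP; split; nra.
Qed.

(** Cauchy-Schwarz in its crude form: products are dominated by the sum of the
    squared moduli. *)
Lemma cL1M f g : cL2 D f -> cL2 D g -> cL1 D (fun x => f x * g x).
Proof.
move=> Lf Lg; apply: (@cL1_le _ (fun x => sqn (f x) + sqn (g x))).
- exact: cmeasM Lf.1 Lg.1.
- under eq_fun do rewrite EFinD.
  by apply: integrableD => //; apply: cL2_integrable.
- by move=> x _; exact: normr_ReIm_mul.
Qed.

Definition ip f g : R[i] := cint D (fun x => f x * conjc (g x)).

Lemma ipDl f g h : cL2 D f -> cL2 D g -> cL2 D h ->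
  ip (fun x => f x + g x) h = ip f h + ip g h.
Proof.
move=> Lf Lg Lh; rewrite /ip -cintD; first by under eq_fun do rewrite mulrDl.
- exact/cL1M/cL2_conjc.
- exact/cL1M/cL2_conjc.
Qed.

Lemma ipZl z f h : cL2 D f -> cL2 D h ->
  ip (fun x => z * f x) h = z * ip f h.
Proof.
move=> Lf Lh; rewrite /ip -cintZ; first by under eq_fun do rewrite -mulrA.
exact/cL1M/cL2_conjc.
Qed.

Lemma ip_conj f g : cL2 D f -> cL2 D g -> ip f g = conjc (ip g f).
Proof.
move=> Lf Lg; rewrite /ip -cint_conjc; last exact/cL1M/cL2_conjc.
by congr cint; apply/funext => x; apply: complexP; rewrite !ReImE; ring.
Qed.

Lemma conjcD z w : conjc (z + w) = conjc z + conjc w.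
Proof. by apply: complexP; rewrite !ReImE; ring. Qed.
Lemma conjcM z w : conjc (z * w) = conjc z * conjc w.
Proof. by apply: complexP; rewrite !ReImE; ring. Qed.
Lemma conjcK z : conjc (conjc z) = z.
Proof. by apply: complexP; rewrite !ReImE ?opprK. Qed.

Lemma ipDr f g h : cL2 D f -> cL2 D g -> cL2 D h ->
  ip h (fun x => f x + g x) = ip h f + ip h g.
Proof.
move=> Lf Lg Lh; rewrite ip_conj ?ipDl ?conjcD -?ip_conj//; exact: cL2D.
Qed.

Lemma ipZr z f h : cL2 D f -> cL2 D h ->
  ip h (fun x => z * f x) = conjc z * ip h f.
Proof.
move=> Lf Lh; rewrite ip_conj ?ipZl ?conjcM -?ip_conj//; exact: cL2Z.
Qed.

Lemma ip_suml (I : Type) (s : seq I) (F : I -> R -> R[i]) h :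
  (forall i, cL2 D (F i)) -> cL2 D h ->
  ip (fun x => \sum_(i <- s) F i x) h = \sum_(i <- s) ip (F i) h.
Proof.
move=> LF Lh; rewrite /ip; under eq_fun do rewrite mulr_suml.
by case: (cint_sum s (fun i => cL1M (LF i) (cL2_conjc Lh))).
Qed.

Lemma ip_sqnorm f : cL2 D f -> ip f f = real_complex R (sqnorm D f).
Proof.
move=> Lf; apply: complexP; rewrite /ip.
- rewrite Re_cint ReC unlock; congr fine; apply: eq_integral => x _.
  by rewrite mulc_conjc.
- rewrite Im_cint -[RHS](mul0r (fine (mu D))) -Rintegral_cst//.
  by apply: eq_Rintegral => x _; rewrite mulc_conjc.
Qed.

Lemma sqnormE f : cL2 D f -> sqnorm D f = Re (ip f f).
Proof. by move=> Lf; rewrite ip_sqnorm. Qed.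

Lemma sqnormDE f g : cL2 D f -> cL2 D g ->
  sqnorm D (fun x => f x + g x) = sqnorm D f + sqnorm D g + 2 * Re (ip f g).
Proof.
move=> Lf Lg; have LD := cL2D Lf Lg.
rewrite !sqnormE// ipDl// !ipDr// (ip_conj Lg Lf) !ReImE; ring.
Qed.

Lemma sqnormZ z f : cL2 D f -> sqnorm D (fun x => z * f x) = sqn z * sqnorm D f.
Proof.
move=> Lf; have LZ := cL2Z z Lf.
by rewrite sqnormE// ipZl// ipZr// ip_sqnorm// mulrA mulc_conjc ReM !ReC !ImC mul0r subr0.
Qed.

Lemma sqnormN f : cL2 D f -> sqnorm D (fun x => - f x) = sqnorm D f.
Proof.
move=> Lf; have := sqnormZ (-1) Lf; under eq_fun do rewrite mulN1r.
by rewrite sqnN sqn1 mul1r.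
Qed.

Lemma sqnormBE f g : cL2 D f -> cL2 D g ->
  sqnorm D (fun x => f x - g x) = sqnorm D f + sqnorm D g - 2 * Re (ip f g).
Proof.
move=> Lf Lg; rewrite sqnormDE ?sqnormN//; last exact: cL2N.
have := ipZr (-1) Lg Lf; under eq_fun do rewrite mulN1r.
move=> ->; rewrite (_ : conjc (-1) = real_complex R (-1)).
  by rewrite ReM ReC ImC; ring.
by apply: complexP; rewrite !ReImE /= ?oppr0.
Qed.

(** The weight [d] makes the error term controllable: a small [d] gives continuity
    of the norm ([sqnorm_cvg]), and [d = 1] the crude bound [sqnormD_le2].  It comes
    from expanding the nonnegative squared norm of [f - g / d]. *)
Lemma sqnormD_le f g (d : R) : 0 < d -> cL2 D f -> cL2 D g ->
  sqnorm D (fun x => f x + g x) <=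
  (1 + d) * sqnorm D f + (1 + d^-1) * sqnorm D g.
Proof.
move=> d0 Lf Lg; rewrite sqnormDE//.
have := sqnorm_ge0 D (fun x => f x - real_complex R d^-1 * g x).
have LZ := cL2Z (real_complex R d^-1) Lg.
rewrite sqnormBE// sqnormZ// ipZr// ReM Re_conjc Im_conjc ReC ImC sqnC => h.
have : 0 <= d * (sqnorm D f + d^-1 ^+ 2 * sqnorm D g - 2 * (d^-1 * Re (ip f g))).
  by apply: mulr_ge0; [exact: ltW|move: h; rewrite oppr0 mul0r subr0].
rewrite (_ : d * _ = d * sqnorm D f + d^-1 * sqnorm D g - 2 * Re (ip f g)).
  lra.
by field; rewrite gt_eqF.
Qed.

End ComplexIntegral.

(** * Affine changes of variable *)

Section AffineChange.
Context {R : realType}.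
Local Notation mu := (@lebesgue_measure R).
Local Notation Re := complex.Re.
Local Notation Im := complex.Im.

Definition affmap (a b : R) (x : measurableTypeR R) : measurableTypeR R :=
  a * x + b.

Lemma measurable_affmap a b : measurable_fun setT (affmap a b).
Proof.
apply: (@measurable_funD _ _ _ _ (fun x => a * x) (fun=> b)) => //.
exact: mulrl_measurable.
Qed.

HB.instance Definition _ a b :=
  isMeasurableFun.Build _ _ _ _ (affmap a b) (measurable_affmap a b).

(** Uniqueness of Lebesgue measure: rescaled by [a], the image measure gives an
    interval its length. *)
Lemma lebesgue_measure_affmap (a b : R) (a0 : 0 < a) (A : set R) :
  measurable A ->
  pushforward mu (affmap a b) A = ((a^-1)%:E * mu A)%E.
Proof.
move=> mA; pose k : {nonneg R} := NngNum (ltW a0).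
pose nu_ : {measure set (measurableTypeR R) -> \bar R} :=
  mscale k (pushforward mu (affmap a b)).
pose nu := nu_ (measurable_affmap a b).
have -> : mu A = nu A.
  apply: (@lebesgue_measure_unique R nu) => //= _ [[c d]] _ <-.
  rewrite /mscale /= /pushforward.
  have -> : affmap a b @^-1` `]c, d] = `](c - b) / a, (d - b) / a]%classic.
    apply/seteqP; split => x /=; rewrite /affmap !in_itv /=;
      by rewrite ltr_pdivrMr// ler_pdivlMr// ltrBlDr lerBrDr (mulrC x).
  rewrite !lebesgue_measure_itv /= !lte_fin.
  rewrite ltr_pM2r ?invr_gt0// ltrD2r; case: ifPn => // cd; last by rewrite mule0.
  by rewrite -!EFinD -EFinM; congr EFin; field; rewrite gt_eqF.
rewrite /mscale /= muleA -EFinM mulVf ?gt_eqF// mul1e//.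
Qed.

Lemma ge0_integral_affmap (a b : R) (a0 : 0 < a) (F : R -> \bar R) :
  measurable_fun setT F -> (forall x, (0 <= F x)%E) ->
  (\int[mu]_x F (affmap a b x) = (a^-1)%:E * \int[mu]_x F x)%E.
Proof.
move=> mF F0; have a0' : 0 <= a^-1 by rewrite invr_ge0 ltW.
pose k : {nonneg R} := NngNum a0'.
rewrite -(ge0_integral_mscale mu measurableT k)//.
rewrite -[LHS](@ge0_integral_pushforward _ _ _ _ _ (affmap a b)
  (measurable_affmap a b) mu setT F)//.
by apply: eq_measure_integral => //= A mA _; exact: lebesgue_measure_affmap.
Qed.

Lemma integral_affmap (a b : R) (a0 : 0 < a) (F : R -> \bar R) :
  mu.-integrable setT F ->
  mu.-integrable setT (fun x => F (affmap a b x)) /\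
  (\int[mu]_x F (affmap a b x) = (a^-1)%:E * \int[mu]_x F x)%E.
Proof.
move=> iF; have mF := measurable_int _ iF.
have mFa : measurable_fun setT (fun x => F (affmap a b x)).
  exact: (measurableT_comp mF (measurable_affmap a b)).
split.
  apply/integrableP; split => //.
  rewrite (@ge0_integral_affmap _ _ a0 (fun x => `|F x|%E))//.
    by rewrite lte_mul_pinfty// ?lee_fin ?invr_ge0 ?ltW//; case/integrableP: iF.
  exact: measurableT_comp.
rewrite integralE [in RHS]integralE.
have -> : (fun x => F (affmap a b x))^\+%E = (fun x => F^\+%E (affmap a b x)).
  by apply/funext => x; rewrite !funeposE.
have -> : (fun x => F (affmap a b x))^\-%E = (fun x => F^\-%E (affmap a b x)).
  by apply/funext => x; rewrite !funenegE.
rewrite !ge0_integral_affmap//; last 2 first.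
- exact: measurable_funeneg.
- exact: measurable_funepos.
by rewrite [RHS]muleBr// fin_num_adde_defr// integrable_pos_fin_num.
Qed.

Lemma cmeas_affmap a b (f : R -> R[i]) : cmeas f -> cmeas (fun x => f (a * x + b)).
Proof. exact: (cmeas_comp (measurable_affmap a b)). Qed.

Lemma energy_affmap (a b : R) (a0 : 0 < a) (f : R -> R[i]) : cmeas f ->
  energy setT (fun x => f (a * x + b)) = ((a^-1)%:E * energy setT f)%E.
Proof.
move=> mf; apply: (ge0_integral_affmap b a0 (F := fun x => (sqn (f x))%:E)).
  exact: measurable_sqnE.
by move=> x; rewrite lee_fin sqn_ge0.
Qed.

Lemma cL2_affmap (a b : R) (a0 : 0 < a) (f : R -> R[i]) : cL2 setT f ->
  cL2 setT (fun x => f (a * x + b)).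
Proof.
move=> [mf Lf]; split; first exact: cmeas_affmap.
by rewrite energy_affmap// lte_mul_pinfty// ?lee_fin ?invr_ge0 ?ltW.
Qed.

Lemma sqnorm_affmap (a b : R) (a0 : 0 < a) (f : R -> R[i]) : cL2 setT f ->
  sqnorm setT (fun x => f (a * x + b)) = a^-1 * sqnorm setT f.
Proof.
by move=> Lf; rewrite unlock energy_affmap ?(energyE Lf) ?unlock//; exact: Lf.1.
Qed.

Lemma cL1_affmap (a b : R) (a0 : 0 < a) (f : R -> R[i]) : cL1 setT f ->
  cL1 setT (fun x => f (a * x + b)) /\
  cint setT (fun x => f (a * x + b)) = real_complex R a^-1 * cint setT f.
Proof.
move=> [mf f1 f2]; have [i1 e1] := integral_affmap b a0 f1.
have [i2 e2] := integral_affmap b a0 f2.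
split; first by split => //; exact: cmeas_affmap.
have fin1 := integrable_fin_num measurableT f1.
have fin2 := integrable_fin_num measurableT f2.
apply: complexP.
- rewrite ReM ReC ImC mul0r subr0 !Re_cint /Rintegral.
  by rewrite -[X in fine X = _]/(\int[mu]_x (Re (f (affmap a b x)))%:E)%E e1 fineM.
- rewrite ImM ReC ImC mul0r addr0 !Im_cint /Rintegral.
  by rewrite -[X in fine X = _]/(\int[mu]_x (Im (f (affmap a b x)))%:E)%E e2 fineM.
Qed.

End AffineChange.

(** * Almost everywhere statements and restriction to a set *)

Section AlmostEverywhere.
Context {R : realType}.
Local Notation mu := (@lebesgue_measure R).
Implicit Types P Q : R -> Prop.

Lemma ae_sub P Q : (forall x, P x -> Q x) ->
  {ae mu, forall x, P x} -> {ae mu, forall x, Q x}.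
Proof. exact: (@filterS _ _ (@ae_filter_ringOfSetsType _ _ _ mu)). Qed.

Lemma ae_and P Q : {ae mu, forall x, P x} -> {ae mu, forall x, Q x} ->
  {ae mu, forall x, P x /\ Q x}.
Proof. exact: (@filterI _ _ (@ae_filter_ringOfSetsType _ _ _ mu)). Qed.

Lemma ae_all P : (forall x, P x) -> {ae mu, forall x, P x}.
Proof. by move=> h; apply: (@filterE _ _ (@ae_filter_ringOfSetsType _ _ _ mu)). Qed.

Lemma ae_countable (Z : set R) P : countable Z -> (forall x, ~ Z x -> P x) ->
  {ae mu, forall x, P x}.
Proof.
move=> cZ ZP; apply: (@ae_sub (fun x => ~ Z x)) => //.
exists Z; split.
- exact: countable_measurable.
- exact: countable_lebesgue_measure0.
- by move=> x /= /contrapT.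
Qed.

End AlmostEverywhere.

Section Restriction.
Context {R : realType}.
Local Notation mu := (@lebesgue_measure R).
Local Notation Re := complex.Re.
Local Notation Im := complex.Im.
Implicit Types (f g : R -> R[i]) (A D : set R).

Lemma char_funE A x : char_fun A x = if x \in A then 1 else 0 :> R[i].
Proof. by rewrite /char_fun indicE; case: (x \in A). Qed.

Lemma energy_char A f : energy setT (fun x => char_fun A x * f x) = energy A f.
Proof.
rewrite /energy [RHS]integral_mkcond; apply: eq_integral => x _.
by rewrite sqnM patchE char_funE; case: ifP; rewrite ?sqn1 ?mul1r// sqn0 mul0r.
Qed.

Lemma cint_char A f : cint setT (fun x => char_fun A x * f x) = cint A f.
Proof.
apply: complexP; rewrite ?Re_cint ?Im_cint [RHS]Rintegral_mkcond;
  apply: eq_Rintegral => x _; rewrite ?ReM ?ImM patchE char_funE.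
- by case: ifP => _; rewrite /= ?mul0r ?mul1r ?subr0.
- by case: ifP => _; rewrite /= ?mul0r ?mul1r ?addr0.
Qed.

Lemma cL2_char A f : measurable A -> cmeas f ->
  cL2 setT (fun x => char_fun A x * f x) <-> cL2 A f.
Proof.
move=> mA mf; rewrite /cL2 energy_char; split=> -[_ ?]; split => //.
by apply: cmeasM => //; apply: cmeas_char.
Qed.

Lemma sqnorm_char A f : sqnorm setT (fun x => char_fun A x * f x) = sqnorm A f.
Proof. by rewrite unlock energy_char. Qed.

Lemma energy_subset A D f : measurable A -> measurable D -> cmeas f ->
  A `<=` D -> (energy A f <= energy D f)%E.
Proof.
move=> mA mD mf AD; apply: ge0_subset_integral => //; first exact: measurable_sqnE.
by move=> x _; rewrite lee_fin sqn_ge0.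
Qed.

Lemma cL2_subset A D f : measurable A -> measurable D -> A `<=` D ->
  cL2 D f -> cL2 A f.
Proof.
move=> mA mD AD [mf Lf]; split => //.
exact: le_lt_trans (energy_subset mA mD mf AD) Lf.
Qed.

Lemma ae_eq_energy D f g : measurable D -> cmeas f -> cmeas g ->
  {ae mu, forall x, D x -> f x = g x} -> energy D f = energy D g.
Proof.
move=> mD mf mg fg; apply: ae_eq_integral => //; try exact: measurable_sqnE.
by apply: ae_sub fg => x h Dx; rewrite h.
Qed.

Lemma ae_eq_cint D f g : measurable D -> cmeas f -> cmeas g ->
  {ae mu, forall x, D x -> f x = g x} -> cint D f = cint D g.
Proof.
move=> mD [f1 f2] [g1 g2] fg; apply: complexP; rewrite ?Re_cint ?Im_cint;
  congr fine; apply: ae_eq_integral => //;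
  try (by apply/measurable_EFinP; apply: measurable_funTS);
  by apply: ae_sub fg => x h Dx; rewrite h.
Qed.

Lemma energy0_ae D f : measurable D -> cmeas f -> energy D f = 0%E ->
  {ae mu, forall x, D x -> f x = 0}.
Proof.
move=> mD mf e0.
have : (\int[mu]_(x in D) `|(sqn (f x))%:E| = 0)%E.
  by under eq_integral do rewrite gee0_abs ?lee_fin ?sqn_ge0//.
move/(ae_eq_integral_abs mu mD (measurable_sqnE (D := D) mf)).
by apply: ae_sub => x h Dx; apply: sqn_eq0; have [] := h Dx.
Qed.

End Restriction.

(** * Convergence in mean square *)

Section Limits.
Context {R : realType}.
Local Notation mu := (@lebesgue_measure R).
Local Notation Re := complex.Re.
Variables (D : set R) (mD : measurable D).
Implicit Types (f g : R -> R[i]).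

Lemma Re_ip_le f g (d : R) : 0 < d -> cL2 D f -> cL2 D g ->
  `|2 * Re (ip D f g)| <= d * sqnorm D f + d^-1 * sqnorm D g.
Proof.
move=> d0 Lf Lg; rewrite ler_norml; apply/andP; split.
- have := sqnormD_le mD d0 Lf Lg; rewrite sqnormDE//.
  have := sqnormD_le mD d0 Lf (cL2N mD Lg); rewrite sqnormN// sqnormBE//.
  lra.
- have := sqnormD_le mD d0 Lf Lg; rewrite sqnormDE//; lra.
Qed.

(** Expand the squared norm of [f + (u n - f)] and bound the cross term by
    [Re_ip_le] with a weight so small that its share of [sqnorm D f] is at most a
    third of the tolerance. *)
Lemma sqnorm_cvg (u : nat -> R -> R[i]) f : (forall n, cL2 D (u n)) -> cL2 D f ->
  sqnorm D (fun x => u n x - f x) @[n --> \oo] --> (0 : R) ->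
  sqnorm D (u n) @[n --> \oo] --> sqnorm D f.
Proof.
move=> Lu Lf h; apply/cvgrPdist_le => e e0.
pose d := e / 3 / (1 + sqnorm D f).
have q0 : 0 < 1 + sqnorm D f by rewrite ltr_pwDl// sqnorm_ge0.
have d0 : 0 < d by rewrite /d !divr_gt0.
have dq : d * sqnorm D f <= e / 3.
  rewrite /d mulrAC ler_pdivrMr// ler_wpM2l//; lra.
have m0 : 0 < Num.min (e / 3) (d * (e / 3)).
  have e30 : 0 < e / 3 by rewrite divr_gt0.
  by rewrite lt_min e30 mulr_gt0.
move/cvgrPdist_le : h => /(_ _ m0); apply: filterS => n.
rewrite sub0r normrN ger0_norm ?sqnorm_ge0// le_min => /andP[h1 h2].
have Lw := cL2B mD (Lu n) Lf.
have := sqnormDE mD Lf Lw; under eq_fun do rewrite addrC subrK.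
move=> ->; have := Re_ip_le d0 Lf Lw.
have h3 : d^-1 * sqnorm D (fun x => u n x - f x) <= e / 3.
  by rewrite ler_pdivrMl.
have h6 := sqnorm_ge0 D (fun x => u n x - f x).
rewrite !ler_norml => /andP[h4 h5]; apply/andP; split; lra.
Qed.

End Limits.

Section MoreL2.
Context {R : realType}.
Local Notation mu := (@lebesgue_measure R).
Implicit Types (f g : R -> R[i]) (A D : set R).

Lemma eq_cint D f g : (forall x, D x -> f x = g x) -> cint D f = cint D g.
Proof.
move=> fg; apply: complexP; rewrite ?Re_cint ?Im_cint; apply: eq_Rintegral => x;
  by rewrite inE => /fg ->.
Qed.

Lemma eq_energy D f g : (forall x, D x -> f x = g x) -> energy D f = energy D g.
Proof. by move=> fg; apply: eq_integral => x; rewrite inE => /fg ->. Qed.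

Lemma eq_sqnorm D f g : (forall x, D x -> f x = g x) -> sqnorm D f = sqnorm D g.
Proof. by move=> fg; rewrite unlock (eq_energy fg). Qed.

Lemma integrable_cst_fin D (M : R) : measurable D -> (mu D < +oo)%E ->
  mu.-integrable D (fun=> M%:E).
Proof.
move=> mD fD; apply/integrableP; split; first exact: measurable_cst.
by rewrite integral_cst//= lte_mul_pinfty.
Qed.

Lemma cL2_bounded D f (M : R) : measurable D -> (mu D < +oo)%E -> cmeas f ->
  (forall x, D x -> sqn (f x) <= M) -> cL2 D f.
Proof.
move=> mD fD mf fM; apply: (cL2_le mD mf (F := fun=> M)) => //.
exact: integrable_cst_fin.
Qed.

(** Mean square form of dominated convergence; the dominating function bounds the
    squared modulus of the difference. *)
Lemma sqnorm_dominated D (u : nat -> R -> R[i]) f (G : R -> R) :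
  measurable D -> (forall n, cmeas (u n)) -> cmeas f ->
  mu.-integrable D (fun x => (G x)%:E) ->
  (forall n x, D x -> sqn (u n x - f x) <= G x) ->
  (forall x, D x -> sqn (u n x - f x) @[n --> \oo] --> (0 : R)) ->
  sqnorm D (fun x => u n x - f x) @[n --> \oo] --> (0 : R).
Proof.
move=> mD mu_ mf iG le cv.
have : (\int[mu]_(x in D) (sqn (u n x - f x))%:E)%E @[n --> \oo] -->
    (\int[mu]_(x in D) (cst 0%E x))%E.
  apply: (@dominated_cvg _ _ _ mu D mD (fun n x => (sqn (u n x - f x))%:E) (cst 0%E)
    (fun x => (G x)%:E)) => //.
  - by move=> n; apply: measurable_sqnE; exact: cmeasB.
  - by move=> x Dx; apply: cvg_EFin; [exact: nearW|exact: cv].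
  - by move=> n x Dx; rewrite gee0_abs ?lee_fin ?sqn_ge0// le.
by rewrite integral0 unlock => /fine_cvg.
Qed.

Lemma sqn_le2 (z w : R[i]) : sqn (z - w) <= 2 * sqn z + 2 * sqn w.
Proof. by have := sqnD_le z (- w); rewrite sqnN. Qed.

End MoreL2.

(** * The trigonometric system on a period *)

Section Trig.
Context {R : realType}.
Local Notation mu := (@lebesgue_measure R).
Local Notation Re := complex.Re.
Local Notation Im := complex.Im.
Implicit Types (f g h : R -> R[i]) (k l m : int) (s : seq int).

Definition period : set R := `[0, 2 * pi].
Local Notation I := period.

Lemma measurable_period : measurable I. Proof. exact: measurable_itv. Qed.
Hint Resolve measurable_period : core.

Lemma twopi_gt0 : 0 < 2 * pi :> R. Proof. by rewrite mulr_gt0// pi_gt0. Qed.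

Lemma lebesgue_period : mu I = (2 * pi)%:E.
Proof. by rewrite /period lebesgue_measure_itv /= lte_fin twopi_gt0 -EFinD subr0. Qed.

Lemma fin_period : (mu I < +oo)%E. Proof. by rewrite lebesgue_period ltry. Qed.

Definition expi (k : int) (x : R) : R[i] := cis (k%:~R * x).

Lemma sqn_expi k x : sqn (expi k x) = 1. Proof. exact: sqn_cis. Qed.

Lemma cmeas_expi k : cmeas (expi k).
Proof. by apply: cmeas_cis; apply: mulrl_measurable. Qed.

Lemma cL2_expi k : cL2 I (expi k).
Proof.
apply: (cL2_bounded (M := 1)) => //; first exact: fin_period.
- exact: cmeas_expi.
- by move=> x _; rewrite sqn_expi.
Qed.
Hint Resolve cL2_expi : core.

Lemma cis_int2pi k : cis (k%:~R * (2 * pi)) = 1 :> R[i].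
Proof.
have nat2pi n : cis (n%:R * (2 * pi)) = 1 :> R[i].
  elim: n => [|n IH]; first by rewrite mul0r cis0.
  rewrite -natr1 mulrDl cisD IH !mul1r.
  by rewrite mulr_natl /cis cos2pi sin2pi.
case: k => n; first exact: nat2pi.
rewrite NegzE mulrNz mulNr -conjc_cis.
by rewrite (nat2pi n.+1); apply: complexP; rewrite !ReImE /= ?oppr0.
Qed.

Lemma expiD k l x : expi k x * expi l x = expi (k + l) x.
Proof. by rewrite /expi -cisD intrD mulrDl. Qed.

Lemma conjc_expi k x : conjc (expi k x) = expi (- k) x.
Proof. by rewrite /expi conjc_cis mulrNz mulNr. Qed.

(** For a nonzero frequency the components have the explicit primitives [sin] and
    [- cos], scaled by [k], which take equal values at both ends of the period. *)
Lemma cint_expi k : cint I (expi k) = if k == 0 then real_complex R (2 * pi) else 0.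
Proof.
have pi2 := twopi_gt0.
case: eqP => [->|/eqP k0].
  have -> : expi 0 = fun=> 1.
    by apply/funext => x; rewrite /expi mul0r cis0.
  apply: complexP; rewrite ?Re_cint ?Im_cint Rintegral_cst//.
  - by rewrite -[X in _ * fine X = _]/(mu I) lebesgue_period /= mul1r.
  - by rewrite /= mul0r.
have kR : k%:~R != 0 :> R by rewrite intr_eq0.
have dS (x : R) : is_derive x 1 (fun x => k%:~R^-1 * sin (k%:~R * x)) (cos (k%:~R * x)).
  have -> : (fun x : R => k%:~R^-1 * sin (k%:~R * x)) = k%:~R^-1 \*: (sin \o *%R k%:~R).
    by apply/funext.
  apply: is_derive_eq.
  by rewrite /GRing.scale /= ?mulr1; field.
have dC (x : R) : is_derive x 1 (fun x => - (k%:~R^-1 * cos (k%:~R * x))) (sin (k%:~R * x)).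
  have -> : (fun x : R => - (k%:~R^-1 * cos (k%:~R * x))) = - (k%:~R^-1 \*: (cos \o *%R k%:~R)).
    by apply/funext.
  apply: is_derive_eq.
  by rewrite /GRing.scale /= ?mulr1; field.
have cis2 := cis_int2pi k; rewrite /cis in cis2.
have cA (F f : R -> R) : (forall x : R, is_derive x 1 F (f x)) -> continuous f ->
    F (2 * pi) = F 0 -> \int[mu]_(x in I) f x = 0.
  move=> dF cf F0; rewrite /Rintegral (@continuous_FTC2 _ f F)//.
  - by rewrite F0 subee.
  - exact: continuous_subspaceT.
  - have cF : continuous F.
      move=> x; apply/differentiable_continuous/derivable1_diffP.
      by have [] := dF x.
    split; first by move=> x _; have [] := dF x.
    + exact/cvg_at_right_filter/cF.
    + exact/cvg_at_left_filter/cF.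
  - by move=> x _; rewrite derive1E; apply: derive_val.
apply: complexP; rewrite ?Re_cint ?Im_cint /=.
- apply: (cA _ _ dS).
  + move=> x; apply: continuous_comp; last exact: continuous_cos.
    exact: mulrl_continuous.
  + by case: cis2 => _ ->; rewrite !mulr0 sin0 mulr0.
- apply: (cA _ _ dC).
  + move=> x; apply: continuous_comp; last exact: continuous_sin.
    exact: mulrl_continuous.
  + by case: cis2 => -> _; rewrite !mulr0 cos0.
Qed.

Lemma ip_expi k l : ip I (expi k) (expi l) = if k == l then real_complex R (2 * pi) else 0.
Proof.
rewrite /ip; under eq_fun do rewrite conjc_expi expiD.
by rewrite cint_expi subr_eq0.
Qed.

End Trig.

(** The integers from [- n] to [n], the frequencies of a symmetric partial sum of a
    Fourier series. *)
HB.lock Definition sym (n : nat) : seq int :=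
  [seq (i%:Z - n%:Z)%R | i <- iota 0 n.*2.+1].

Section Parseval.
Context {R : realType}.
Local Notation mu := (@lebesgue_measure R).
Local Notation Re := complex.Re.
Local Notation Im := complex.Im.
Local Notation I := (@period R).
Implicit Types (f g h : R -> R[i]) (k l m : int) (s : seq int).
#[local] Hint Resolve measurable_period cL2_expi : core.

Local Notation c2pi := (real_complex R (2 * pi)).

Definition fcoef f k : R[i] := real_complex R (2 * pi)^-1 * ip I f (expi k).

Lemma c2piV : c2pi * real_complex R (2 * pi)^-1 = 1.
Proof. by rewrite -rmorphM /= mulfV// gt_eqF// twopi_gt0. Qed.

Lemma ip_fcoef f k : ip I f (expi k) = c2pi * fcoef f k.
Proof. by rewrite /fcoef mulrA c2piV mul1r. Qed.

Lemma fcoefD f g k : cL2 I f -> cL2 I g ->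
  fcoef (fun x => f x + g x) k = fcoef f k + fcoef g k.
Proof. by move=> Lf Lg; rewrite /fcoef ipDl// mulrDr. Qed.

Lemma fcoefZ z f k : cL2 I f -> fcoef (fun x => z * f x) k = z * fcoef f k.
Proof. by move=> Lf; rewrite /fcoef ipZl// mulrCA. Qed.

Lemma eq_fcoef f g k : (forall x, I x -> f x = g x) -> fcoef f k = fcoef g k.
Proof.
move=> fg; rewrite /fcoef /ip; congr (_ * _).
by apply: eq_cint => x Ix; rewrite fg.
Qed.

Definition fproj s f (x : R) : R[i] := \sum_(k <- s) fcoef f k * expi k x.

Lemma cL2_fproj s f : cL2 I (fproj s f).
Proof. by apply: cL2_sum => // k; apply: cL2Z. Qed.
#[local] Hint Resolve cL2_fproj : core.

Lemma ip_fproj s f g : cL2 I f -> cL2 I g ->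
  ip I (fproj s f) g = c2pi * \sum_(k <- s) fcoef f k * conjc (fcoef g k).
Proof.
move=> Lf Lg; rewrite /fproj ip_suml//; last by move=> k; apply: cL2Z.
rewrite mulr_sumr; apply: eq_bigr => k _; rewrite ipZl// ip_conj// ip_fcoef.
rewrite conjcM; have -> : conjc c2pi = c2pi :> R[i].
  by apply: complexP; rewrite ?Re_conjc ?Im_conjc ?ImC ?oppr0.
by rewrite mulrCA.
Qed.

Lemma fcoef_fproj s f k : uniq s -> k \in s -> fcoef (fproj s f) k = fcoef f k.
Proof.
move=> us ks; rewrite /fcoef {1}/fproj ip_suml//; last by move=> l; apply: cL2Z.
rewrite (bigD1_seq k)//= big1 ?addr0; last first.
  by move=> l lk; rewrite ipZl// ip_expi (negbTE lk) mulr0.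
rewrite ipZl// ip_expi eqxx mulrCA [_ * c2pi]mulrC c2piV mulr1//.
Qed.

Definition fsum s f : R := \sum_(k <- s) sqn (fcoef f k).

Lemma fsum_ge0 s f : 0 <= fsum s f.
Proof. by apply: sumr_ge0 => k _; exact: sqn_ge0. Qed.

Lemma sqnorm_fproj s f : uniq s -> cL2 I f ->
  sqnorm I (fproj s f) = 2 * pi * fsum s f.
Proof.
move=> us Lf; rewrite sqnormE// ip_fproj// ReM ReC ImC mul0r subr0.
rewrite (eq_big_seq (fun k => real_complex R (sqn (fcoef f k)))).
  by rewrite -rmorph_sum.
by move=> k ks; rewrite fcoef_fproj// mulc_conjc.
Qed.

Lemma sqnorm_fprojB s f : uniq s -> cL2 I f ->
  sqnorm I (fun x => f x - fproj s f x) = sqnorm I f - 2 * pi * fsum s f.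
Proof.
move=> us Lf; rewrite sqnormBE// sqnorm_fproj//.
rewrite ip_conj// Re_conjc ip_fproj// ReM ReC ImC mul0r subr0.
rewrite (eq_bigr (fun k => real_complex R (sqn (fcoef f k)))).
  by rewrite -rmorph_sum ReC -/(fsum s f); ring.
by move=> k _; rewrite mulc_conjc.
Qed.

Lemma bessel s f : uniq s -> cL2 I f -> 2 * pi * fsum s f <= sqnorm I f.
Proof.
move=> us Lf; rewrite -subr_ge0 -sqnorm_fprojB//; exact: sqnorm_ge0.
Qed.

(** The Riemann-Lebesgue lemma for L^2: by Bessel the squared coefficients along
    an injective sequence of frequencies are summable. *)
Lemma fcoef_cvg0 f (j : nat -> int) : injective j -> cL2 I f ->
  sqn (fcoef f (j n)) @[n --> \oo] --> (0 : R).
Proof.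
move=> ij Lf; apply: cvg_series_cvg_0.
apply: nondecreasing_is_cvgn.
  apply/nondecreasing_seqP => n; rewrite /series /= big_nat_recr//= lerDl.
  exact: sqn_ge0.
exists (sqnorm I f / (2 * pi)) => _ [n _ <-].
rewrite ler_pdivlMr ?twopi_gt0// mulrC; apply: le_trans (bessel (s := map j (iota 0 n)) _ Lf).
  by rewrite ler_pM2l ?twopi_gt0// /fsum big_map /series /= /index_iota subn0.
by rewrite map_inj_uniq ?iota_uniq.
Qed.

Lemma symE n : sym n = [seq (i%:Z - n%:Z)%R | i <- index_iota 0 n.*2.+1].
Proof. by rewrite unlock /index_iota subn0. Qed.

Lemma sym_uniq n : uniq (sym n).
Proof. by rewrite symE map_inj_uniq ?iota_uniq// => a b /addIr []. Qed.
#[local] Hint Resolve sym_uniq : core.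

Lemma mem_sym n k : (k \in sym n) = (`|k| <= n%:Z).
Proof.
rewrite symE; apply/mapP/idP => [[m]|].
  rewrite mem_index_iota => /andP[_ mn] ->; rewrite ler_norml; apply/andP; split; lia.
rewrite ler_norml => /andP[h1 h2].
exists (absz (k + n%:Z)); last by rewrite gez0_abs ?addrK//; lia.
rewrite mem_index_iota; lia.
Qed.

(** The squared mean square error of the [n]-th symmetric partial sum. *)
Definition ferr n f : R := sqnorm I (fun x => f x - fproj (sym n) f x).

Lemma ferrE n f : cL2 I f -> ferr n f = sqnorm I f - 2 * pi * fsum (sym n) f.
Proof. by move=> Lf; rewrite /ferr sqnorm_fprojB. Qed.

Lemma ferr_ge0 n f : 0 <= ferr n f. Proof. exact: sqnorm_ge0. Qed.

Lemma ferr_le n f : cL2 I f -> ferr n f <= sqnorm I f.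
Proof. by move=> Lf; rewrite ferrE// gerBl mulr_ge0// ?fsum_ge0// ltW// twopi_gt0. Qed.

Lemma fprojD s f g x : cL2 I f -> cL2 I g ->
  fproj s (fun x => f x + g x) x = fproj s f x + fproj s g x.
Proof.
move=> Lf Lg; rewrite /fproj -big_split; apply: eq_bigr => k _ /=.
by rewrite fcoefD// mulrDl.
Qed.

Lemma fprojZ s z f x : cL2 I f -> fproj s (fun x => z * f x) x = z * fproj s f x.
Proof.
move=> Lf; rewrite /fproj mulr_sumr; apply: eq_bigr => k _ /=.
by rewrite fcoefZ// mulrA.
Qed.

Lemma sqnormD_le2 (D : set R) f g : measurable D -> cL2 D f -> cL2 D g ->
  sqnorm D (fun x => f x + g x) <= 2 * sqnorm D f + 2 * sqnorm D g.
Proof.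
move=> mD Lf Lg; have := sqnormD_le mD (@ltr01 R) Lf Lg.
by rewrite invr1 -(natrD R 1 1).
Qed.

Lemma ferrD n f g : cL2 I f -> cL2 I g ->
  ferr n (fun x => f x + g x) <= 2 * ferr n f + 2 * ferr n g.
Proof.
move=> Lf Lg; rewrite {1}/ferr.
under [X in sqnorm _ X]eq_fun do rewrite fprojD// opprD addrACA.
by apply: sqnormD_le2 => //; apply: cL2B.
Qed.

Lemma ferrZ n z f : cL2 I f -> ferr n (fun x => z * f x) = sqn z * ferr n f.
Proof.
move=> Lf; rewrite {1}/ferr.
under [X in sqnorm _ X]eq_fun do rewrite fprojZ// -mulrBr.
by rewrite sqnormZ//; apply: cL2B.
Qed.

(** The Fourier series of [f] converges to [f] in mean square. *)
Definition fser f : Prop := cL2 I f /\ ferr n f @[n --> \oo] --> (0 : R).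

Lemma cvg0_le (u v : nat -> R) : (forall n, 0 <= u n <= v n) ->
  v n @[n --> \oo] --> (0 : R) -> u n @[n --> \oo] --> (0 : R).
Proof.
move=> uv v0; apply: (squeeze_cvgr _ (cvg_cst 0) v0).
exact: nearW.
Qed.

Lemma fserD f g : fser f -> fser g -> fser (fun x => f x + g x).
Proof.
move=> [Lf Pf] [Lg Pg]; split; first exact: cL2D.
apply: (@cvg0_le _ (fun n => 2 * ferr n f + 2 * ferr n g)).
  by move=> n; rewrite ferr_ge0 ferrD.
have := cvgD (cvgM (cvg_cst (2 : R)) Pf) (cvgM (cvg_cst (2 : R)) Pg).
by rewrite mulr0 addr0; apply.
Qed.

Lemma fserZ z f : fser f -> fser (fun x => z * f x).
Proof.
move=> [Lf Pf]; split; first exact: cL2Z.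
rewrite [X in X @ _](_ : _ = (fun n => sqn z * ferr n f)); last first.
  by apply/funext => n; rewrite ferrZ.
have := cvgM (cvg_cst (sqn z)) Pf.
by rewrite mulr0; apply.
Qed.

Lemma fserB f g : fser f -> fser g -> fser (fun x => f x - g x).
Proof.
move=> Pf Pg; have PN : fser (fun x => - g x).
  have -> : (fun x => - g x) = (fun x => (-1) * g x).
    by apply/funext => x; rewrite mulN1r.
  exact: fserZ.
exact: (fserD Pf PN).
Qed.

Lemma fser_eq f g : cmeas g -> (forall x, I x -> f x = g x) -> fser f -> fser g.
Proof.
move=> mg fg [[mf Lf] Pf]; have Lg : cL2 I g by split; rewrite // -(eq_energy fg).
suff E : ferr ^~ g = ferr ^~ f by rewrite /fser E; exact: (conj Lg Pf).
apply/funext => n; rewrite !ferrE// -(eq_sqnorm fg); congr (_ - _ * _).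
by apply: eq_bigr => k _; rewrite (eq_fcoef k fg).
Qed.

(** Since the error of a partial sum never exceeds the norm of the function
    ([ferr_le]), functions that are the mean square sum of their Fourier series form
    a closed set. *)
Lemma fser_lim f (u : nat -> R -> R[i]) : cL2 I f -> (forall n, fser (u n)) ->
  sqnorm I (fun x => u n x - f x) @[n --> \oo] --> (0 : R) -> fser f.
Proof.
move=> Lf Pu uf; split => //; apply/cvgr0Pnorm_le => e e0.
have e4 : 0 < e / 4 by rewrite divr_gt0.
move/cvgr0_norm_le : uf => /(_ _ e4) [N _ /(_ N (leqnn N))].
rewrite /= ger0_norm ?sqnorm_ge0// => h1.
have [LN PN] := Pu N.
move/cvgr0_norm_le : PN => /(_ _ e4); apply: filterS => n.
rewrite (ger0_norm (ferr_ge0 n f)) (ger0_norm (ferr_ge0 n (u N))) => h2.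
have Ld : cL2 I (fun x => f x - u N x) by apply: cL2B.
have := ferrD n LN Ld; under eq_fun do rewrite addrC subrK.
move=> /le_trans; apply; have := ferr_le n Ld.
have -> : sqnorm I (fun x => f x - u N x) = sqnorm I (fun x => u N x - f x).
  by rewrite -sqnormN//; under eq_fun do rewrite opprB.
lra.
Qed.

End Parseval.

(** * Completeness of the trigonometric system *)

Section Completeness.
Context {R : realType}.
Local Notation mu := (@lebesgue_measure R).
Local Notation Re := complex.Re.
Local Notation Im := complex.Im.
Local Notation I := (@period R).
Implicit Types (f g h : R -> R[i]) (k l m : int).
#[local] Hint Resolve measurable_period cL2_expi cL2_fproj sym_uniq : core.

Lemma sqn_cvg (z : nat -> R[i]) w : sqn (z n - w) @[n --> \oo] --> (0 : R) ->
  sqn (z n) @[n --> \oo] --> sqn w.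
Proof.
move=> h.
have cv (p : nat -> R) (c : R) : (forall n, (p n - c) ^+ 2 <= sqn (z n - w)) ->
    p n @[n --> \oo] --> c.
  move=> le; apply/cvgrPdist_le => e e0.
  have e2 : 0 < e ^+ 2 by rewrite exprn_gt0.
  move/cvgr0_norm_le : h => /(_ _ e2); apply: filterS => n.
  rewrite ger0_norm ?sqn_ge0// => h1.
  have := le_trans (le n) h1.
  rewrite ler_norml !expr2 => h2; apply/andP; split; nra.
have c1 : Re (z n) @[n --> \oo] --> Re w.
  by apply: cv => n; rewrite /sqn !ReImE lerDl sqr_ge0.
have c2 : Im (z n) @[n --> \oo] --> Im w.
  by apply: cv => n; rewrite /sqn !ReImE lerDr sqr_ge0.
by rewrite /sqn; apply: cvgD; rewrite expr2; under eq_cvg do rewrite expr2;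
  apply: cvgM.
Qed.

(** Chernoff's argument.  If [f - f x0] is divisible by [expi 1 - expi 1 x0] with a
    square integrable quotient [h], then the coefficients of [f] are differences of
    consecutive coefficients of [h], the partial sums at [x0] telescope, and the two
    boundary terms tend to [0] by the Riemann-Lebesgue lemma. *)
Lemma fproj_cvg_pt f h (x0 : R) : cL2 I f -> cL2 I h ->
  (forall x, I x -> f x = f x0 + (expi 1 x - expi 1 x0) * h x) ->
  sqn (fproj (sym n) f x0 - f x0) @[n --> \oo] --> (0 : R).
Proof.
move=> Lf Lh fE.
have cE k : fcoef f k = (if k == 0 then f x0 else 0) +
    (fcoef h (k - 1) - expi 1 x0 * fcoef h k).
  have L0 : cL2 I (fun x => f x0 * expi 0 x) by apply: cL2Z.
  have L1 : cL2 I (fun x => expi 1 x * h x).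
    apply: (@cL2M _ _ measurable_period _ _ 1) => //; first exact: cmeas_expi.
    by move=> x _; rewrite sqn_expi.
  have L2 : cL2 I (fun x => (- expi 1 x0) * h x) by apply: cL2Z.
  transitivity (fcoef (fun x => f x0 * expi 0 x + (expi 1 x * h x + (- expi 1 x0) * h x)) k).
    rewrite /fcoef /ip; congr (_ * _); apply: eq_cint => x Ix; rewrite (fE x Ix).
    by rewrite /(expi 0) mul0r cis0; ring.
  rewrite fcoefD// ?fcoefD// ?fcoefZ//; last exact: cL2D.
  congr (_ + (_ + _)); last by rewrite mulNr.
  - rewrite /fcoef ip_expi eq_sym; case: eqP => _; last by rewrite !mulr0.
    by rewrite [X in f x0 * X]mulrC c2piV mulr1.
  - rewrite /fcoef /ip; congr (_ * _); apply: eq_cint => x Ix.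
    rewrite mulrAC !conjc_expi expiD mulrC; congr (_ * expi _ _).
    by rewrite opprB.
(* Boundary terms of the telescoping sum; the index i stands for the frequency i - n. *)
pose T n i := fcoef h (i%:Z - n%:Z - 1) * expi (i%:Z - n%:Z) x0.
have E n : fproj (sym n) f x0 - f x0 = T n 0%N - T n n.*2.+1.
  rewrite /fproj symE big_map.
  rewrite (eq_bigr (fun i => (if i == n then f x0 else 0) - (T n i.+1 - T n i))); last first.
    move=> i _; rewrite cE mulrDl; congr (_ + _).
      rewrite subr_eq0 eqz_nat; case: eqP => [->|_]; last by rewrite mul0r.
      by rewrite subrr /expi mul0r cis0 mulr1.
    rewrite /T opprB mulrBl; congr (_ - _).
    have -> : i.+1%:Z - n%:Z - 1 = i%:Z - n%:Z by lia.
    rewrite mulrAC expiD mulrC; congr (_ * expi _ _); lia.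
  rewrite big_split sumrN.
  have nin : n \in index_iota 0 n.*2.+1 by rewrite mem_index_iota; lia.
  rewrite telescope_sumr// opprB (bigD1_seq n nin (iota_uniq _ _)) eqxx /=.
  rewrite big1 ?addr0; last by move=> i /negbTE ->.
  by rewrite addrAC subrr add0r.
have c1 := fcoef_cvg0 (j := fun n : nat => 0%:Z - n%:Z - 1) _ Lh.
have c2 := fcoef_cvg0 (j := fun n : nat => n.*2.+1%:Z - n%:Z - 1) _ Lh.
apply: (@cvg0_le _ _ (fun n => 2 * sqn (fcoef h (0%:Z - n%:Z - 1)) +
                             2 * sqn (fcoef h (n.*2.+1%:Z - n%:Z - 1)))).
  move=> n; rewrite sqn_ge0/= E (le_trans (sqn_le2 _ _))//.
  by rewrite /T !sqnM !sqn_expi !mulr1.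
have := cvgD (cvgM (cvg_cst (2 : R)) (c1 _)) (cvgM (cvg_cst (2 : R)) (c2 _)).
rewrite mulr0 addr0; apply; move=> a b; lia.
Qed.

Lemma cos_le_away (d y : R) : 0 < d <= pi -> d <= y <= 2 * pi - d -> cos y <= cos d.
Proof.
move=> /andP[d0 dpi] /andP[dy yd].
have mono (y' : R) : d <= y' <= pi -> cos y' <= cos d.
  move=> /andP[h1 h2]; rewrite leNgt; apply/negP.
  have din : d \in `[0, pi] by rewrite in_itv /= (ltW d0).
  have yin : y' \in `[0, pi] by rewrite in_itv /= (le_trans (ltW d0) h1).
  by rewrite ltr_cos// ltNge h1.
have [ypi|/ltW piy] := leP y pi; first by apply: mono; rewrite dy.
rewrite -cosN -(cosD2pi (- y)); apply: mono; rewrite -mulr_natl; apply/andP; split; lra.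
Qed.

Lemma sqn_expiB (x y : R) : sqn (expi 1 x - expi 1 y) = 2 - 2 * cos (x - y).
Proof.
rewrite /sqn /expi !ReImE /= !mul1r cosB.
have := cos2Dsin2 x; have := cos2Dsin2 y; lra.
Qed.

Lemma measurable_invr (u : R -> R) : (forall x, 0 <= u x) -> measurable_fun setT u ->
  measurable_fun setT (fun x => (u x)^-1).
Proof.
move=> u0 mu_; have -> : (fun x => (u x)^-1) = (fun x => u x `^ (-1)).
  by apply/funext => x; rewrite powR_inv1.
apply: (measurableT_comp (f := fun y : R => y `^ (-1))) mu_.
exact: measurable_powR.
Qed.

Lemma cL2_charI (A : set R) (D : set R) : measurable A -> measurable D ->
  (mu D < +oo)%E -> cL2 D (char_fun A).
Proof.
move=> mA mD fD; apply: (cL2_bounded (M := 1)) => //; first exact: cmeas_char.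
by move=> x _; rewrite char_funE; case: ifP; rewrite ?sqn1 ?sqn0.
Qed.

(** The quotient in Chernoff's argument is bounded: near [x0] the numerator vanishes,
    as the indicator is constant there, and elsewhere in the period the denominator
    is bounded away from [0]. *)
Lemma ray_cvg_pt (a x0 : R) : 0 < x0 < 2 * pi -> x0 != a ->
  sqn (fproj (sym n) (char_fun `]a, +oo[) x0 - char_fun `]a, +oo[ x0)
    @[n --> \oo] --> (0 : R).
Proof.
move=> /andP[x00 x02] xa; set f := char_fun _.
have Lf : cL2 I f by apply: cL2_charI => //; exact: fin_period.
pose q x := sqn (expi 1 x - expi 1 x0).
pose h x := real_complex R (q x)^-1 * ((f x - f x0) * conjc (expi 1 x - expi 1 x0)).
pose d := Num.min `|x0 - a| (Num.min x0 (2 * pi - x0)).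
have d0 : 0 < d by rewrite !lt_min normr_gt0 subr_eq0 xa x00 subr_gt0 x02.
have [da [dx dy]] : d <= `|x0 - a| /\ d <= x0 /\ d <= 2 * pi - x0.
  by rewrite !ge_min !lexx !orbT.
have dpi : d <= pi by lra.
pose c := 2 - 2 * cos d.
have c0 : 0 < c.
  suff : cos d < 1 by rewrite /c; lra.
  by rewrite -cos0 ltr_cos ?in_itv /= ?lexx ?pi_ge0 ?dpi ?(ltW d0).
(* If f x differs from f x0, then a separates x from x0, so that x - x0 is at
     least d in absolute value; it is at most 2 pi - d, as x0 is at distance at
     least d from both ends of the period. *)
have away x : I x -> f x != f x0 -> c <= q x.
  rewrite /period /= in_itv /= => /andP[x1 x2] fx.
  rewrite /q sqn_expiB /c; suff : cos (x - x0) <= cos d by lra.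
  rewrite -cos_norm; apply: cos_le_away; first by rewrite d0.
  apply/andP; split; last by rewrite ler_norml; apply/andP; split; lra.
  apply: le_trans da _; move: fx; rewrite /f !char_funE.
  rewrite !mem_setE !in_itv /= !andbT; have [ax|xa'] := ltP a x.
  - have [//|ax0'] := ltP a x0 => /=; first by rewrite eqxx.
    by move=> _; rewrite ler0_norm ?ger0_norm; lra.
  - have [ax0'|//] := ltP a x0 => /=; last by rewrite eqxx.
    by move=> _; rewrite ger0_norm ?ler0_norm; lra.
have mf : cmeas f by case: Lf.
have me : cmeas (fun x => expi 1 x - expi 1 x0).
  by apply: cmeasB; [exact: cmeas_expi|exact: cmeas_cst].
apply: (fproj_cvg_pt (h := h)) => //.
- apply: (cL2_bounded (M := c^-1)) => //; first exact: fin_period.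
  + apply: cmeasM; last apply: cmeasM.
    * apply: cmeasC; apply: measurable_invr; first by move=> x; exact: sqn_ge0.
      exact: measurable_sqn.
    * by apply: cmeasB => //; exact: cmeas_cst.
    * exact: cmeas_conjc.
  + move=> x Ix; rewrite /h !sqnM sqnC sqn_conjc -/(q x).
    have [->|fx] := eqVneq (f x) (f x0).
      by rewrite subrr sqn0 mul0r mulr0 invr_ge0 ltW.
    have cq := away _ Ix fx; have q0 : 0 < q x by exact: lt_le_trans cq.
    have -> : sqn (f x - f x0) = 1.
      move: fx; rewrite /f !char_funE; do 2 case: ifP => _; rewrite ?eqxx// => _.
        by rewrite subr0 sqn1.
      by rewrite sub0r sqnN sqn1.
    by rewrite mul1r expr2 -mulrA mulVf ?gt_eqF// mulr1 lef_pV2.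
- move=> x Ix; have [fx|fx] := eqVneq (f x) (f x0).
    by rewrite /h fx subrr mul0r !mulr0 addr0.
  have q0 : 0 < q x by exact: lt_le_trans (away _ Ix fx).
  rewrite /h mulrCA [X in _ + X](_ : _ = (real_complex R (q x)^-1 *
    ((expi 1 x - expi 1 x0) * conjc (expi 1 x - expi 1 x0))) * (f x - f x0)); last by ring.
  rewrite mulc_conjc -/(q x) -rmorphM /= mulVf ?gt_eqF// rmorph1 mul1r.
  by rewrite addrC subrK.
Qed.

End Completeness.

Section Density.
Context {R : realType}.
Local Notation mu := (@lebesgue_measure R).
Local Notation Re := complex.Re.
Local Notation Im := complex.Im.
Local Notation I := (@period R).
Implicit Types (f g h : R -> R[i]) (k l m : int).
#[local] Hint Resolve measurable_period cL2_expi cL2_fproj sym_uniq : core.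

Lemma fsum_sym_nd f : nondecreasing_seq (fun n => fsum (sym n) f).
Proof.
apply/nondecreasing_seqP => n.
have /(perm_big _) : perm_eq (sym n.+1) (n.+1%:Z :: - n.+1%:Z :: sym n).
  apply: uniq_perm; first exact: sym_uniq.
    rewrite 2!cons_uniq sym_uniq andbT in_cons !mem_sym; lia.
  by move=> k; rewrite mem_sym 2!in_cons mem_sym; lia.
rewrite /fsum => ->; rewrite [leRHS]big_cons [X in _ <= _ + X]big_cons addrA lerDr addr_ge0 ?sqn_ge0//.
Qed.

(** Pointwise convergence and Fatou bound the norm of [f] by the limit of the norms of
    its partial sums.  Bessel gives the opposite inequality, and equality says that
    the error tends to [0]. *)
Lemma fser_ray (a : R) : fser (char_fun `]a, +oo[).
Proof.
set f := char_fun _.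
have Lf : cL2 I f by apply: cL2_charI => //; exact: fin_period.
have mf : cmeas f by case: Lf.
pose D : set R := `]0, 2 * pi[ `\ a.
have mD : measurable D.
  by apply: measurableD => //; exact: measurable_set1.
have DI : D `<=` I.
  by move=> x [/= ]; rewrite /period /= !in_itv /= => /andP[h1 h2] _; rewrite !ltW.
have eDI : energy I f = energy D f.
  rewrite -(energy_char I f) -(energy_char D f); apply: ae_eq_energy => //.
  - by apply: cmeasM => //; apply: cmeas_char.
  - by apply: cmeasM => //; apply: cmeas_char.
  apply: (@ae_countable _ [set 0; 2 * pi; a]).
    by apply: finite_set_countable; rewrite !finite_setU; do !split; exact: finite_set1.
  move=> x nx _; congr (_ * _); rewrite !char_funE; congr (if _ then _ else _).
  apply/idP/idP; rewrite !inE; last exact: DI.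
  rewrite /D /period /= !in_itv /= => /andP[x0 x1].
  have [[n0 n1] na] : (x <> 0 /\ x <> 2 * pi) /\ x <> a.
    by split; [split|] => e; apply: nx; [left; left|left; right|right].
  split=> //; rewrite !lt_neqAle x0 x1 !andbT; apply/andP; split; apply/eqP => //.
  exact: nesym.
pose S n := fproj (sym n) f.
have mS n : cmeas (S n) by case: (cL2_fproj (sym n) f).
have LS n : cL2 I (S n) by exact: cL2_fproj.
have [l cl] : exists l : R, fsum (sym n) f @[n --> \oo] --> l.
  apply/cvg_ex; apply: nondecreasing_is_cvgn; first exact: fsum_sym_nd.
  exists (sqnorm I f / (2 * pi)) => _ [n _ <-].
  by rewrite ler_pdivlMr ?twopi_gt0// mulrC bessel.
have cl2 : 2 * pi * fsum (sym n) f @[n --> \oo] --> 2 * pi * l.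
  exact: (cvgM (cvg_cst (2 * pi : R)) cl).
have le1 : (energy I f <= (2 * pi * l)%:E)%E.
  rewrite eDI.
  have -> : energy D f = (\int[mu]_(x in D) limn_einf (fun n => (sqn (S n x))%:E))%E.
    apply: eq_integral => x; rewrite inE => -[/=]; rewrite in_itv /= => x02 xa.
    have /cvg_limn_einf_sup[-> _] // : (sqn (S n x))%:E @[n --> \oo] --> (sqn (f x))%:E.
    apply: cvg_EFin; first exact: nearW.
    by apply: sqn_cvg; apply: ray_cvg_pt => //; apply/eqP.
  apply: le_trans (fatou _ _ _ _) _ => //.
  - by move=> n; exact: measurable_sqnE.
  - by move=> n x _; rewrite lee_fin sqn_ge0.
  have cE : (2 * pi * fsum (sym n) f)%:E @[n --> \oo] --> (2 * pi * l)%:E.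
    by apply: cvg_EFin; [exact: nearW|exact: cl2].
  have [<- _] := cvg_limn_einf_sup cE.
  rewrite !limn_einf_lim; apply: lee_lim; [exact: is_cvg_einfs|exact: is_cvg_einfs|].
  apply: nearW => n; apply: le_ereal_inf_tmp => _ [m /= nm <-].
  apply: le_trans (_ : (\int[mu]_(x in D) (sqn (S m x))%:E <= _)%E).
    by apply: ereal_inf_lbound; exists m.
  rewrite -sqnorm_fproj// -energyE//; exact: energy_subset.
split=> //; rewrite [X in X @ _](_ : _ = (fun n => sqnorm I f - 2 * pi * fsum (sym n) f)); last first.
  by apply/funext => n; rewrite ferrE.
have le2 : sqnorm I f <= 2 * pi * l by rewrite -lee_fin -energyE.
have le3 : 2 * pi * l <= sqnorm I f.
  apply: (ler_cvg_to cl2 (cvg_cst (sqnorm I f))).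
  by apply: nearW => n; exact: bessel.
have -> : (0 : R) = sqnorm I f - 2 * pi * l by lra.
exact: (cvgB (cvg_cst (sqnorm I f)) cl2).
Qed.

Lemma fser_sum (T : Type) (s : seq T) (F : T -> R -> R[i]) :
  (forall i, fser (F i)) -> fser (fun x => \sum_(i <- s) F i x).
Proof.
move=> PF; elim: s => [|i s IH].
  under eq_fun do rewrite big_nil.
  have := fserZ 0 (fser_ray 0); under eq_fun do rewrite mul0r; exact.
by under eq_fun do rewrite big_cons; apply: fserD.
Qed.

Lemma fser_dominated f (u : nat -> R -> R[i]) (G : R -> R) : cL2 I f ->
  (forall n, fser (u n)) -> mu.-integrable I (fun x => (G x)%:E) ->
  (forall n x, I x -> sqn (u n x - f x) <= G x) ->
  (forall x, I x -> sqn (u n x - f x) @[n --> \oo] --> (0 : R)) -> fser f.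
Proof.
move=> Lf Pu iG uG cu; apply: (fser_lim Lf Pu).
apply: sqnorm_dominated iG uG cu => //; last by case: Lf.
by move=> n; case: (Pu n) => -[].
Qed.

(** A Dynkin class argument from half-lines, which are stable under intersection and
    generate the Borel sets. *)
Lemma fser_char (A : set R) : measurable A -> fser (char_fun A).
Proof.
move=> mA.
pose G : set (set R) := @RGenOInfty.G R.
have PT : fser (fun _ : R => (1 : R[i])).
  apply: (fser_eq _ _ (fser_ray (-1))); first exact: cmeas_cst.
  move=> x; rewrite /period /= in_itv /= => /andP[x0 _].
  by rewrite char_funE mem_set//= in_itv /= andbT; lra.
have sGA : <<s G >> A.
  by have := RGenOInfty.measurableE R; rewrite /measurable /= => <-; exact: mA.
apply: (@dynkin_induction _ _ G (fun A => fser (char_fun A))) sGA.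
- exact: RGenOInfty.measurableE.
- move=> _ _ [x ->] [y ->]; exists (Num.max x y).
  by apply/seteqP; split=> z /=; rewrite !in_itv /= !andbT gt_max => /andP.
- apply: (fser_eq _ _ PT); first exact: cmeas_char.
  by move=> x _; rewrite char_funE in_setT.
- by move=> _ [x ->]; exact: fser_ray.
- move=> S mS PS; apply: (fser_eq _ _ (fserB PT PS)); first exact/cmeas_char/measurableC.
  move=> x _; rewrite !char_funE in_setC; case: (x \in S) => /=; rewrite ?subrr ?subr0//.
- move=> F mF tF PF.
  have mU n : measurable (\bigcup_(i < n) F i) by apply: bigcup_measurable.
  have PU n : fser (char_fun (\bigcup_(i < n) F i)).
    elim: n => [|n IH].
      apply: (fser_eq _ _ (fserZ 0 PT)); first exact: cmeas_char.
      move=> x _; rewrite mul0r bigcup_mkord big_ord0 char_funE in_set0//.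
    apply: (fser_eq _ _ (fserD IH (PF n))); first exact: cmeas_char.
    move=> x _; rewrite !bigcup_mkord big_ord_recr /= !char_funE in_setU.
    rewrite -!bigcup_mkord; case: (boolP (x \in F n)) => [xn|_]; last by rewrite orbF addr0.
    rewrite orbT; case: ifPn => [|_]; last by rewrite add0r.
    rewrite inE => -[i /= ilt Fi]; rewrite inE in xn.
    have e : i = n by apply: (tF i n Logic.I Logic.I); exists x.
    by move: ilt; rewrite e ltnn.
  have mUT : measurable (\bigcup_i F i) by exact: bigcup_measurable.
  apply: (@fser_dominated _ (fun n => char_fun (\bigcup_(i < n) F i)) (fun=> 4)) => //.
  + by apply: cL2_charI => //; exact: fin_period.
  + by apply: integrable_cst_fin => //; exact: fin_period.
  + move=> n x _; apply: le_trans (sqn_le2 _ _) _.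
    have h B : sqn (char_fun B x) <= 1 :> R.
      by rewrite char_funE; case: ifP => _; rewrite ?sqn1 ?sqn0.
    have := h (\bigcup_(i < n) F i); have := h (\bigcup_i F i); lra.
  + move=> x _; apply: cvg_near_cst.
    have [[i _ Fi]|nx] := pselect ((\bigcup_i F i) x).
      exists i.+1 => // n /= ni; apply/eqP; rewrite !char_funE !mem_set ?subrr ?sqn0//.
        by exists i.
      by exists i.
    near=> n; rewrite !char_funE !memNset ?subrr ?sqn0//.
    by move=> [i _ Fi]; apply: nx; exists i.
Unshelve. all: by end_near. Qed.

Import HBNNSimple.

Lemma fser_nnreal (u : R -> R) : measurable_fun setT u -> (forall x, 0 <= u x) ->
  cL2 I (fun x => real_complex R (u x)) -> fser (fun x => real_complex R (u x)).
Proof.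
move=> mu_ u0 Lu.
have mE : measurable_fun [set: R] (fun x => (u x)%:E) by apply/measurable_EFinP.
have u0E x : (0 <= (u x)%:E)%E by rewrite lee_fin.
pose g := nnsfun_approx measurableT mE.
have cg x : g n x @[n --> \oo] --> u x.
  have /fine_cvgP[_ cv] := cvg_nnsfun_approx measurableT mE
    (fun y _ => u0E y) (Logic.I : setT x).
  exact: cv.
have gle n x : g n x <= u x.
  have ndx : nondecreasing_seq (g ^~ x).
    by move=> a b ab; move/lefP : (nd_nnsfun_approx measurableT mE ab) => /(_ x).
  rewrite -(cvg_lim _ (cg x))//; apply: nondecreasing_cvgn_le => //.
  by apply/cvg_ex; exists (u x).
apply: (@fser_dominated _ (fun n x => real_complex R (g n x)) (fun x => u x ^+ 2)) => //.
- move=> n.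
  have -> : (fun x => real_complex R (g n x)) = (fun x =>
      \sum_(y <- finmap.enum_fset (fset_set (range (g n))))
        real_complex R y * char_fun (g n @^-1` [set y]) x).
    apply/funext => x; rewrite {1}(fimfunE (g n)) fsbig_finite//= rmorph_sum.
    by apply: eq_bigr => y _; rewrite rmorphM.
  apply: fser_sum => y; apply: fserZ; apply: fser_char.
  by rewrite -[X in measurable X]setTI; apply: measurable_funP.
- by have := cL2_integrable Lu; under eq_fun do rewrite sqnC.
- move=> n x _; rewrite -rmorphB sqnC; have := gle n x.
  have : 0 <= g n x by [].
  nra.
- move=> x _.
  have h : (g n x - u x) @[n --> \oo] --> (0 : R).
    by have := cvgB (cg x) (cvg_cst (u x)); rewrite subrr; apply.
  have := cvgM h h; rewrite mulr0 => cB.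
  rewrite [X in X @ _](_ : _ = (fun n => (g n x - u x) * (g n x - u x))); first exact: cB.
  by apply/funext => n; rewrite -rmorphB sqnC.
Qed.

Lemma fser_real (u : R -> R) : measurable_fun setT u ->
  cL2 I (fun x => real_complex R (u x)) -> fser (fun x => real_complex R (u x)).
Proof.
move=> mu_ Lu.
have iu : mu.-integrable I (fun x => (u x ^+ 2)%:E).
  by have := cL2_integrable Lu; under eq_fun do rewrite sqnC.
have P1 : fser (fun x => real_complex R (Num.max (u x) 0)).
  apply: fser_nnreal.
  - by apply: measurable_maxr => //; exact: measurable_cst.
  - by move=> x; rewrite le_max lexx orbT.
  - apply: cL2_le iu _ => //.
      by apply: cmeasC; apply: measurable_maxr => //; exact: measurable_cst.
    by move=> x _; rewrite sqnC; case: (leP (u x) 0) => h; nra.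
have P2 : fser (fun x => real_complex R (Num.max (- u x) 0)).
  apply: fser_nnreal.
  - by apply: measurable_maxr; [exact: measurable_funN|exact: measurable_cst].
  - by move=> x; rewrite le_max lexx orbT.
  - apply: cL2_le iu _ => //.
      by apply: cmeasC; apply: measurable_maxr; [exact: measurable_funN|exact: measurable_cst].
    by move=> x _; rewrite sqnC; case: (leP (- u x) 0) => h; nra.
apply: (fser_eq _ _ (fserB P1 P2)); first exact: cmeasC.
move=> x _; rewrite -rmorphB; congr (real_complex R _).
by case: (leP (u x) 0); case: (leP (- u x) 0); lra.
Qed.

(** Completeness of the trigonometric system: real and imaginary parts, then positive
    and negative parts, are increasing limits of simple functions. *)
Theorem fser_cL2 f : cL2 I f -> fser f.
Proof.
move=> Lf; have [[mf1 mf2] _] := Lf; have iF := cL2_integrable Lf.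
have P1 : fser (fun x => real_complex R (Re (f x))).
  apply: fser_real => //; apply: cL2_le iF _ => //.
  by move=> x _; rewrite sqnC lerDl sqr_ge0.
have P2 : fser (fun x => real_complex R (Im (f x))).
  apply: fser_real => //; apply: cL2_le iF _ => //.
  by move=> x _; rewrite sqnC lerDr sqr_ge0.
apply: (fser_eq _ _ (fserD P1 (fserZ (Complex 0 1) P2))) => //.
by move=> x _; apply: complexP; rewrite !ReImE !ReC !ImC /= ?mul0r ?mulr0;
  ring.
Qed.

Theorem parseval f : cL2 I f ->
  2 * pi * fsum (sym n) f @[n --> \oo] --> sqnorm I f.
Proof.
move=> Lf; have [_ h] := fser_cL2 Lf.
rewrite [X in X @ _](_ : _ = (fun n => sqnorm I f - ferr n f)).
  by have := cvgB (cvg_cst (sqnorm I f)) h; rewrite subr0; apply.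
by apply/funext => n; rewrite ferrE//; ring.
Qed.

End Density.

(** * The Fourier integral *)

Section Fourier.
Context {R : realType}.
Local Notation mu := (@lebesgue_measure R).
Local Notation Re := complex.Re.
Local Notation Im := complex.Im.
Implicit Types (f g h u : R -> R[i]) (D : set R).
#[local] Hint Resolve measurable_period cL2_expi : core.

Lemma fourierE f xi : fourier f xi = cint setT (fun x => f x * cis (- (xi * x))).
Proof. by rewrite cintT. Qed.

Lemma cmeas_cisM (xi : R) : cmeas (fun x => cis (- (xi * x))).
Proof.
apply: cmeas_cis; apply: measurable_funN; exact: mulrl_measurable.
Qed.

Lemma normr_ReIm_cisM (z : R[i]) (t : R) :
  `|Re (z * cis t)| <= `|Re z| + `|Im z| /\ `|Im (z * cis t)| <= `|Re z| + `|Im z|.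
Proof.
have c1 := cos_max t; have s1 := sin_max t.
have aux (a b c d : R) : `|c| <= 1 -> `|d| <= 1 -> `|a * c + b * d| <= `|a| + `|b|.
  move=> hc hd; apply: le_trans (ler_normD _ _) _; rewrite !normrM.
  by apply: lerD; rewrite ler_piMr.
rewrite !ReImE /=; split; last exact: aux.
by rewrite -mulrN; apply: aux; rewrite ?normrN.
Qed.

Lemma integrable_normReIm D f : measurable D -> cL1 D f ->
  mu.-integrable D (fun x => (`|Re (f x)| + `|Im (f x)|)%:E).
Proof.
move=> mD [_ f1 f2]; under eq_fun do rewrite EFinD.
by apply: integrableD => //; [exact: integrable_norm f1|exact: integrable_norm f2].
Qed.

Lemma cL1_cisM D f xi : measurable D -> cL1 D f -> cL1 D (fun x => f x * cis (- (xi * x))).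
Proof.
move=> mD Lf; apply: (cL1_le mD _ (integrable_normReIm mD Lf)).
  by apply: cmeasM; [case: Lf|exact: cmeas_cisM].
by move=> x _; exact: normr_ReIm_cisM.
Qed.

Lemma fourierD f g xi : cL1 setT f -> cL1 setT g ->
  fourier (fun x => f x + g x) xi = fourier f xi + fourier g xi.
Proof.
move=> Lf Lg; rewrite !fourierE -cintD//; try exact: cL1_cisM.
by under eq_fun do rewrite mulrDl.
Qed.

Lemma fourierZ z f xi : cL1 setT f ->
  fourier (fun x => z * f x) xi = z * fourier f xi.
Proof.
move=> Lf; rewrite !fourierE -cintZ//; last exact: cL1_cisM.
by under eq_fun do rewrite -mulrA.
Qed.

Lemma fourierB f g xi : cL1 setT f -> cL1 setT g ->
  fourier (fun x => f x - g x) xi = fourier f xi - fourier g xi.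
Proof.
move=> Lf Lg.
have -> : (fun x => f x - g x) = (fun x => f x + (-1) * g x).
  by apply/funext => x; rewrite mulN1r.
by rewrite fourierD ?fourierZ ?mulN1r//; exact: cL1Z.
Qed.

Lemma cL1B D f g : measurable D -> cL1 D f -> cL1 D g -> cL1 D (fun x => f x - g x).
Proof.
move=> mD Lf Lg.
have -> : (fun x => f x - g x) = (fun x => f x + (-1) * g x).
  by apply/funext => x; rewrite mulN1r.
by apply: cL1D => //; exact: cL1Z.
Qed.

Lemma continuous_fourier f : cL1 setT f ->
  continuous (fun xi => Re (fourier f xi)) /\ continuous (fun xi => Im (fourier f xi)).
Proof.
move=> Lf; have iF := integrable_normReIm measurableT Lf.
have aux (p : R -> R -> R) : (forall xi, mu.-integrable setT (EFin \o p xi)) ->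
    (forall y, continuous (p ^~ y)) ->
    (forall xi y, `|p xi y| <= `|Re (f y)| + `|Im (f y)|) ->
    continuous (fun xi => \int[mu]_y p xi y).
  move=> ip_ cp pb a.
  apply: (@continuity_under_integral _ _ _ mu p setT measurableT (a - 1) (a + 1) _ _
     (fun y => `|Re (f y)| + `|Im (f y)|) iF).
  - by move=> x _; exact: ip_.
  - by apply: ae_all => y _ x _; exact: cp.
  - by move=> x _; apply: ae_all => y _; exact: pb.
  - by rewrite inE /= in_itv /=; lra.
have cc (y xi : R) : {for xi, continuous (fun xi : R => - (xi * y))}.
  by apply: continuousN; exact: mulrr_continuous.
split.
- rewrite (_ : (fun xi => _) = (fun xi => \int[mu]_y Re (f y * cis (- (xi * y))))); last first.
    by apply/funext => xi; rewrite fourierE Re_cint.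
  apply: aux.
  + by move=> xi; case: (cL1_cisM xi measurableT Lf).
  + move=> y xi; rewrite (_ : (fun _ => _) = (fun xi : R =>
      Re (f y) * cos (- (xi * y)) - Im (f y) * sin (- (xi * y)))); last first.
      by apply/funext => z; rewrite ReM.
    apply: cvgB; apply: cvgM; (try exact: cvg_cst);
      apply: continuous_comp; (try exact: cc); [exact: continuous_cos|exact: continuous_sin].
  + by move=> xi y; case: (normr_ReIm_cisM (f y) (- (xi * y))).
- rewrite (_ : (fun xi => _) = (fun xi => \int[mu]_y Im (f y * cis (- (xi * y))))); last first.
    by apply/funext => xi; rewrite fourierE Im_cint.
  apply: aux.
  + by move=> xi; case: (cL1_cisM xi measurableT Lf).
  + move=> y xi; rewrite (_ : (fun _ => _) = (fun xi : R =>
      Re (f y) * sin (- (xi * y)) + Im (f y) * cos (- (xi * y)))); last first.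
      by apply/funext => z; rewrite ImM.
    apply: cvgD; apply: cvgM; (try exact: cvg_cst);
      apply: continuous_comp; (try exact: cc); [exact: continuous_sin|exact: continuous_cos].
  + by move=> xi y; case: (normr_ReIm_cisM (f y) (- (xi * y))).
Qed.

Lemma cmeas_fourier f : cL1 setT f -> cmeas (fourier f).
Proof. by move=> /continuous_fourier[c1 c2]; split; exact: continuous_measurable_fun. Qed.

Lemma fourier_affine f (a b xi : R) : 0 < a -> cL1 setT f ->
  fourier (fun x => f (a * x + b)) xi =
  real_complex R a^-1 * (cis (a^-1 * xi * b) * fourier f (a^-1 * xi)).
Proof.
move=> a0 Lf; rewrite !fourierE.
have L1 := cL1_cisM (a^-1 * xi) measurableT Lf.
rewrite -cintZ//.
have [_ <-] := cL1_affmap b a0 (cL1Z measurableT (cis (a^-1 * xi * b)) L1).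
congr cint; apply/funext => x; rewrite mulrCA -cisD; congr (_ * cis _).
by field; rewrite gt_eqF.
Qed.

Lemma cL1_char D f : measurable D -> (mu D < +oo)%E -> cmeas f -> cL2 D f ->
  cL1 setT (fun x => char_fun D x * f x).
Proof.
move=> mD fD mf Lf.
have Lc : cL2 setT (fun x => char_fun D x * f x) by apply/cL2_char.
have L1 : cL2 setT (char_fun D : R -> R[i]).
  have -> : char_fun D = (fun x => char_fun D x * 1) :> (R -> R[i]).
    by apply/funext => x; rewrite mulr1.
  apply/cL2_char => //; apply: (cL2_bounded (M := 1)) => //.
  by move=> x _; rewrite sqn1.
have := cL1M measurableT L1 Lc; under eq_fun do rewrite mulrA.
congr (cL1 _ _); apply/funext => x; rewrite char_funE.
by case: ifP => _; rewrite ?mulr1// mul0r mul0r.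
Qed.

Lemma ge0_integral_shift (G : R -> \bar R) (c d t : R) : measurable_fun setT G ->
  (forall x, (0 <= G x)%E) ->
  (\int[mu]_(x in `[(c + t)%R, (d + t)%R[) G x = \int[mu]_(x in `[c, d[) G (x + t)%R)%E.
Proof.
move=> mG G0; rewrite integral_mkcond [RHS]integral_mkcond.
have := @ge0_integral_affmap _ 1 t ltr01 (G \_ `[c + t, d + t[).
rewrite invr1 mul1e => <-.
- apply: eq_integral => x _; rewrite /affmap mul1r !patchE !mem_setE !in_itv /=.
  by rewrite lerD2r ltrD2r.
- apply/measurable_restrict => //=; exact: measurable_funTS.
- by move=> x; rewrite patchE; case: ifP.
Qed.

(** Periodization over unit intervals, on a finite range of translates. *)
Lemma ge0_integral_unit_split (G : R -> \bar R) (c : R) (n : nat) :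
  measurable_fun setT G -> (forall x, (0 <= G x)%E) ->
  (\int[mu]_(x in `[c, (c + n%:R)%R[) G x =
   \int[mu]_(x in `[0%R, 1%R[) \sum_(0 <= i < n) G (x + (c + i%:R))%R)%E.
Proof.
move=> mG G0.
have mGs (t : R) : measurable_fun setT (fun x : R => G (x + t)%R).
  apply: measurableT_comp mG _.
  exact: measurable_funD.
have msum n' (D : set R) : measurable_fun D (fun x : R => \sum_(0 <= i < n') G (x + (c + i%:R))%R)%E.
  apply: emeasurable_sum => i; exact: measurable_funTS.
elim: n => [|n IH].
  rewrite addr0 set_itvco0 integral_set0.
  by under eq_integral do rewrite big_nil; rewrite integral0.
have -> : `[c, c + n.+1%:R[%classic = `[c, c + n%:R[%classic `|` `[c + n%:R, c + n.+1%:R[%classic.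
  apply/seteqP; split=> x /=; rewrite !in_itv /= -natr1 => h.
    by have [?|?] := ltP x (c + n%:R); [left|right]; move: h; lra.
  have n0 : 0 <= n%:R :> R by [].
  by case: h; lra.
rewrite ge0_integral_setU//=; last 2 first.
- exact: measurable_funTS.
- apply/disj_setPS => x /= []; rewrite !in_itv /=; lra.
rewrite IH; under [RHS]eq_integral do rewrite big_nat_recr//=.
have sum0 (x : R) : (0 <= \sum_(0 <= i < n) G (x + (c + i%:R))%R)%E.
  exact: sume_ge0.
rewrite [RHS]ge0_integralD//=; try exact: msum; try exact: measurable_funTS.
rewrite -(ge0_integral_shift 0 1 (c + n%:R) mG G0) add0r.
  by have -> : 1 + (c + n%:R) = c + n.+1%:R by rewrite -natr1; lra.
exact: (measurable_funTS (mGs _)).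
Qed.

End Fourier.

(** * Plancherel's formula *)

Section Plancherel.
Context {R : realType}.
Local Notation mu := (@lebesgue_measure R).
Local Notation Re := complex.Re.
Local Notation Im := complex.Im.
Local Notation I := (@period R).
Implicit Types (f g h u : R -> R[i]) (D : set R).
#[local] Hint Resolve measurable_period cL2_expi : core.

Lemma fine_energy D f : fine (energy D f) = sqnorm D f.
Proof. by rewrite unlock. Qed.

(** For a function supported in a period, sampling the transform at [x + k] gives the
    Fourier coefficients of its modulation by [- x]. *)
Lemma fourier_char_fcoef u (x : R) k :
  sqn (fourier (fun y => char_fun I y * u y) (x + k%:~R)) =
  (2 * pi) ^+ 2 * sqn (fcoef (fun y => cis (- (x * y)) * u y) k).
Proof.
rewrite -sqnC -sqnM -ip_fcoef fourierE; congr sqn.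
rewrite (_ : (fun y => _) = (fun y => char_fun I y * (u y * cis (- ((x + k%:~R) * y))))); last first.
  by apply/funext => y; rewrite mulrA.
rewrite cint_char /ip; congr cint; apply/funext => y.
rewrite conjc_expi /expi -mulrA [RHS]mulrCA -cisD; congr (_ * cis _).
by rewrite mulrNz; ring.
Qed.

(** Split the integral of the squared transform over the interval from [- n] to
    [n + 1] into unit intervals.  Under the integral over [0, 1] appears the sum of
    the squared Fourier coefficients of the modulations of [u], which converges by
    Parseval to the constant [sqnorm I u] and is bounded by it by Bessel. *)
Lemma energy_fourier_period u : cmeas u -> cL2 I u ->
  energy setT (fourier (fun y => char_fun I y * u y)) = (2 * pi * sqnorm I u)%:E.
Proof.
move=> mu_ Lu; set v := fun y => _.
have Lv : cL1 setT v by apply: cL1_char => //; exact: fin_period.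
pose G (x : R) := (sqn (fourier v x))%:E.
have mG : measurable_fun setT G by apply: measurable_sqnE; exact: cmeas_fourier.
have G0 x : (0 <= G x)%E by rewrite lee_fin sqn_ge0.
(* 2n + 1 unit intervals, one for each frequency of the symmetric sum. *)
pose A (n : nat) : set R := `[- n%:R, (- n%:R + n.*2.+1%:R)%R[%classic.
have AE n x : A n x <-> - n%:R <= x < n%:R + 1.
  rewrite /A /= in_itv /= (_ : - n%:R + n.*2.+1%:R = n%:R + 1 :> R)//.
  by rewrite -natr1 -mul2n natrM; ring.
have cA : (\int[mu]_(x in A n) G x)%E @[n --> \oo] --> energy setT (fourier v).
  have <- : \bigcup_n A n = setT.
    apply/seteqP; split => // x _; have /andP[_ nx] := archimedean.Num.Theory.truncn_itv (normr_ge0 x).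
    exists (archimedean.Num.truncn `|x|).+1 => //; apply/AE.
    move: nx (ler_norm x) (lerNnormlW (lexx `|x|)) => nx h1 h2.
    by rewrite -natr1; lra.
  apply: ge0_nondecreasing_set_cvg_integral => //.
  - apply/nondecreasing_seqP => n; rewrite subsetEset => x /AE h; apply/AE.
    by rewrite -natr1; lra.
  - by move=> n; exact: measurable_itv.
  - by move=> n; exact: (measurable_funTS mG).
pose w (x : R) y := cis (- (x * y)) * u y.
have Lw x : cL2 I (w x).
  by apply: (@cL2M _ _ measurable_period _ _ 1) => //; [exact: cmeas_cisM|move=> y _; rewrite sqn_cis].
have Nw x : sqnorm I (w x) = sqnorm I u.
  rewrite unlock /energy; congr fine; apply: eq_integral => y _.
  by rewrite sqnM sqn_cis mul1r.
pose S n x := 2 * pi * (2 * pi * fsum (sym n) (w x)).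
have SE n x : (\sum_(0 <= i < n.*2.+1) G (x + (- n%:R + i%:R))%R)%E = (S n x)%:E.
  rewrite /S sumEFin; congr EFin; rewrite mulrA -expr2 /fsum symE big_map mulr_sumr.
  apply: eq_bigr => i _; rewrite -fourier_char_fcoef intrB addrC (addrC (- _)).
  by rewrite addrC.
have mS n (D : set R) : measurable_fun D (fun x : R => (S n x)%:E).
  rewrite (_ : (fun x => _) = (fun x : R => \sum_(0 <= i < n.*2.+1)
    G (x + (- n%:R + i%:R))%R)%E); last by apply/funext => x; rewrite SE.
  apply: emeasurable_sum => i.
  apply: measurable_funTS; apply: measurableT_comp mG _; exact: measurable_funD.
have c2 : (\int[mu]_(x in A n) G x)%E @[n --> \oo] --> (2 * pi * sqnorm I u)%:E.
  rewrite [X in X @ _](_ : _ = fun n => (\int[mu]_(x in `[0%R, 1%R[) (S n x)%:E)%E); last first.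
    apply/funext => n; rewrite ge0_integral_unit_split//.
    by apply: eq_integral => x _; exact: SE.
  have -> : (2 * pi * sqnorm I u)%:E = (\int[mu]_(x in `[0%R, 1%R[) (2 * pi * sqnorm I u)%:E)%E.
    by rewrite integral_cst//= lebesgue_measure_itv /= lte_fin ltr01 -EFinD subr0 mule1.
  apply: (@dominated_cvg _ _ _ mu _ _ (fun n x => (S n x)%:E) (fun=> (2 * pi * sqnorm I u)%:E)
    (fun=> (2 * pi * sqnorm I u)%:E)) => //.
  - by move=> n; exact: mS.
  - move=> x _; apply/fine_cvgP; split; first exact: nearW.
    by have := cvgM (cvg_cst (2 * pi : R)) (parseval (Lw x)); rewrite Nw; apply.
  - apply: integrable_cst_fin => //.
    by rewrite lebesgue_measure_itv /= lte_fin ltr01 -EFinD ltry.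
  - move=> n x _; rewrite gee0_abs; last by rewrite -SE; apply: sume_ge0.
    rewrite lee_fin /S ler_pM2l; last exact: twopi_gt0.
    by rewrite -(Nw x); apply: bessel => //; exact: sym_uniq.
exact: (cvg_unique _ cA c2).
Qed.

(** Rescale the interval [- M, M] to a period. *)
Lemma energy_fourier_bounded f (M : R) : 0 < M -> cL2 setT f ->
  let u := fun x => char_fun `[- M, M] x * f x in
  energy setT (fourier u) = (2 * pi * sqnorm setT u)%:E.
Proof.
move=> M0 Lf u; have [mf _] := Lf.
have mA : measurable (`[- M, M]%classic : set R) by exact: measurable_itv.
have LfA : cL2 `[- M, M]%classic f by exact: cL2_subset Lf.
have Lu : cL1 setT u.
  by apply: cL1_char => //; rewrite lebesgue_measure_itv /=; case: ifP => _; rewrite ltry.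
have L2u : cL2 setT u by apply/cL2_char.
have pi0 := pi_gt0 R.
pose a := M / pi; have a0 : 0 < a by rewrite divr_gt0.
pose v x := u (a * x + - M).
have L2v : cL2 setT v by exact: cL2_affmap.
have vE : v = (fun x => char_fun I x * v x).
  apply/funext => x; rewrite /v /u !mulrA; congr (_ * _); rewrite !char_funE.
  have -> : (x \in I) = (a * x + - M \in `[- M, M]%classic).
    rewrite !mem_setE !in_itv /=.
    have -> : (- M <= a * x - M) = (0 <= x) by rewrite lerBrDr addNr pmulr_rge0.
    congr (_ && _); rewrite lerBlDr /a mulrAC ler_pdivrMr//.
    have -> : (M + M) * pi = M * (2 * pi) by ring.
    by rewrite ler_pM2l.
  by case: ifP => _; rewrite ?mul1r// mul0r.
have := energy_fourier_period (u := v) L2v.1 (cL2_subset measurable_period measurableT _ L2v).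
rewrite -vE => /(_ (fun _ _ => Logic.I)).
rewrite -(sqnorm_char I v) -vE (sqnorm_affmap _ a0)//.
have -> : fourier v = (fun xi => (real_complex R a^-1 * cis (a^-1 * xi * - M)) * fourier u (a^-1 * xi + 0)).
  by apply/funext => xi; rewrite (fourier_affine (- M) _ a0 Lu) mulrA addr0.
have -> : energy setT (fun xi => (real_complex R a^-1 * cis (a^-1 * xi * - M)) * fourier u (a^-1 * xi + 0)) =
   ((a^-1 ^+ 2)%:E * energy setT (fun xi => fourier u (a^-1 * xi + 0)))%E.
  rewrite /energy -ge0_integralZl//.
  - by apply: eq_integral => x _; rewrite !sqnM sqnC sqn_cis mulr1 -EFinM.
  - apply: measurable_sqnE; apply: cmeas_affmap; exact: cmeas_fourier.
  - by move=> x _; rewrite lee_fin sqn_ge0.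
  - by rewrite lee_fin sqr_ge0.
rewrite energy_affmap ?invr_gt0//; last exact: cmeas_fourier.
rewrite invrK muleA -EFinM => h.
(* Two Jacobian factors come from the transform and one from the change of variable on the transform side. *)
have ea : a * (a^-1 ^+ 2 * a) = 1 by field; rewrite gt_eqF.
rewrite -[LHS]mul1e -ea EFinM -muleA h -EFinM; congr EFin.
by field; rewrite gt_eqF.
Qed.

Definition trunc f (n : nat) (x : R) : R[i] := char_fun `[- n.+1%:R, n.+1%:R] x * f x.

Lemma truncE f n x : `|x| <= n.+1%:R -> trunc f n x = f x.
Proof.
by rewrite ler_norml => h; rewrite /trunc char_funE mem_set ?mul1r//=.
Qed.

Lemma trunc_near f x : \forall n \near \oo, trunc f n x = f x.
Proof.
exists (archimedean.Num.truncn `|x|).+1 => // n /= nx; apply: truncE.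
have := archimedean.Num.Theory.truncn_itv (normr_ge0 x) => /andP[_ /ltW /le_trans]; apply.
by rewrite ler_nat ltnW.
Qed.

Lemma sqn_trunc_le f n x : sqn (trunc f n x) <= sqn (f x).
Proof.
rewrite /trunc sqnM char_funE; case: ifP => _; rewrite ?sqn1 ?mul1r//.
by rewrite sqn0 mul0r sqn_ge0.
Qed.

Lemma cmeas_trunc f n : cmeas f -> cmeas (trunc f n).
Proof. by move=> mf; apply: cmeasM => //; apply: cmeas_char; exact: measurable_itv. Qed.

Lemma cL2_trunc f n : cL2 setT f -> cL2 setT (trunc f n).
Proof.
move=> Lf; apply: (cL2_le measurableT _ (cL2_integrable Lf)).
  by apply: cmeas_trunc; case: Lf.
by move=> x _; exact: sqn_trunc_le.
Qed.

Lemma cL1_trunc f n : cL2 setT f -> cL1 setT (trunc f n).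
Proof.
move=> Lf; have [mf _] := Lf; apply: cL1_char => //; last exact: cL2_subset Lf.
by rewrite lebesgue_measure_itv /=; case: ifP => _; rewrite ltry.
Qed.

Lemma sqnorm_trunc f : cL2 setT f ->
  sqnorm setT (fun x => trunc f n x - f x) @[n --> \oo] --> (0 : R).
Proof.
move=> Lf; have [mf _] := Lf.
apply: (sqnorm_dominated (G := fun x => 4 * sqn (f x))) => //.
- by move=> n; exact: cmeas_trunc.
- by apply: integrable_scale => //; exact: cL2_integrable.
- move=> n x _; apply: le_trans (sqn_le2 _ _) _; have := sqn_trunc_le f n x; lra.
- move=> x _; apply: cvg_near_cst; apply: filterS (trunc_near f x) => n ->.
  by rewrite subrr sqn0//.
Qed.

Lemma cint_dominated (F : nat -> R -> R[i]) f (g : R -> R) :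
  (forall n, cmeas (F n)) -> mu.-integrable setT (fun x => (g x)%:E) ->
  (forall n x, `|Re (F n x)| <= g x /\ `|Im (F n x)| <= g x) ->
  (forall x, \forall n \near \oo, F n x = f x) ->
  Re (cint setT (F n)) @[n --> \oo] --> Re (cint setT f) /\
  Im (cint setT (F n)) @[n --> \oo] --> Im (cint setT f).
Proof.
move=> mF ig Fg Ff.
have aux (P : R[i] -> R) : (forall n, measurable_fun setT (fun x => P (F n x))) ->
    (forall n x, `|P (F n x)| <= g x) ->
    \int[mu]_x P (F n x) @[n --> \oo] --> \int[mu]_x P (f x).
  move=> mP Pg.
  have cP x : (P (F n x))%:E @[n --> \oo] --> (P (f x))%:E.
    by apply: cvg_near_cst; apply: filterS (Ff x) => n ->.
  have mPF n : measurable_fun [set: R] (fun x => (P (F n x))%:E) by apply/measurable_EFinP.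
  have mPf : measurable_fun [set: R] (fun x => (P (f x))%:E).
    exact: (emeasurable_fun_cvg _ _ mPF (fun x _ => cP x)).
  have [iPf _ ] := @dominated_convergence _ _ _ mu setT measurableT
    (fun n x => (P (F n x))%:E) (fun x => (P (f x))%:E) (fun x => (g x)%:E) mPF mPf
    (ae_all (fun x _ => cP x)) ig (ae_all (fun x n _ => Pg n x)).
  have fP := integrable_fin_num measurableT iPf.
  rewrite -(fineK fP) => /fine_cvg; exact.
split; rewrite ?Re_cint ?Im_cint; (under eq_cvg do rewrite ?Re_cint ?Im_cint); apply: aux.
- by move=> n; case: (mF n).
- by move=> n x; case: (Fg n x).
- by move=> n; case: (mF n).
- by move=> n x; case: (Fg n x).
Qed.

Lemma fourier_trunc_cvg f xi : cL1 setT f ->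
  sqn (fourier (trunc f n) xi) @[n --> \oo] --> sqn (fourier f xi).
Proof.
move=> Lf; have [mf _ _] := Lf.
have [] := @cint_dominated (fun n x => trunc f n x * cis (- (xi * x)))
  (fun x => f x * cis (- (xi * x))) _ _ (integrable_normReIm measurableT Lf).
- by move=> n; apply: cmeasM; [exact: cmeas_trunc|exact: cmeas_cisM].
- move=> n x; rewrite /trunc char_funE; case: ifP => _; rewrite ?mul1r; first exact: normr_ReIm_cisM.
  by rewrite !mul0r normr0 addr_ge0.
- by move=> x; apply: filterS (trunc_near f x) => n ->.
move=> c1 c2; rewrite /sqn; under eq_cvg do rewrite fourierE; rewrite fourierE !expr2.
by apply: cvgD; under eq_cvg do rewrite expr2; apply: cvgM.
Qed.

Lemma fourier_trunc f n : cL2 setT f -> cL2 setT (fourier (trunc f n)) /\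
  sqnorm setT (fourier (trunc f n)) = 2 * pi * sqnorm setT (trunc f n).
Proof.
move=> Lf; have := energy_fourier_bounded (ltr0Sn R n) Lf => /= h.
split; last by rewrite -fine_energy h.
split; first exact/cmeas_fourier/cL1_trunc.
by rewrite h ltry.
Qed.

Lemma fatou_le D (F : nat -> R -> R) (f : R -> R) (B : \bar R) : measurable D ->
  (forall n, measurable_fun D (F n)) -> (forall n x, 0 <= F n x) ->
  (forall x, D x -> F n x @[n --> \oo] --> f x) ->
  (forall n, (\int[mu]_(x in D) (F n x)%:E <= B)%E) ->
  (\int[mu]_(x in D) (f x)%:E <= B)%E.
Proof.
move=> mD mF F0 Ff FB.
have -> : (\int[mu]_(x in D) (f x)%:E = \int[mu]_(x in D) limn_einf (fun n => (F n x)%:E))%E.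
  apply: eq_integral => x; rewrite inE => Dx.
  have /cvg_limn_einf_sup[-> _] // : (F n x)%:E @[n --> \oo] --> (f x)%:E.
  by apply: cvg_EFin; [exact: nearW|exact: Ff].
have mE n : measurable_fun D (fun x => (F n x)%:E).
  apply/measurable_EFinP; exact: mF.
have E0 n x : D x -> (0 <= (F n x)%:E)%E by rewrite lee_fin.
apply: le_trans (fatou mu mD mE E0) _.
rewrite limn_einf_lim; apply: lime_le; first exact: is_cvg_einfs.
apply: nearW => n; apply: le_trans (FB n); apply: ereal_inf_lbound.
by exists n => //=.
Qed.

(** The transforms of the truncations converge pointwise, so that Fatou gives this
    inequality; it is needed before [sqnorm_fourier], to know that the transform is
    square integrable. *)
Lemma energy_fourier_le f : cL1 setT f -> cL2 setT f ->
  (energy setT (fourier f) <= (2 * pi * sqnorm setT f)%:E)%E.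
Proof.
move=> L1 L2; apply: (fatou_le (F := fun n x => sqn (fourier (trunc f n) x))) => //.
- by move=> n; apply: measurable_sqn; exact/cmeas_fourier/cL1_trunc.
- by move=> n x; exact: sqn_ge0.
- by move=> x _; exact: fourier_trunc_cvg.
move=> n; have [Lt Et] := fourier_trunc n L2.
rewrite -[leLHS]/(energy setT (fourier (trunc f n))) energyE// Et lee_fin.
rewrite ler_pM2l ?twopi_gt0// -lee_fin -!energyE//; last exact: cL2_trunc.
apply: ge0_le_integral => //.
- by move=> x _; rewrite lee_fin sqn_ge0.
- by apply: measurable_sqnE; apply: cmeas_trunc; case: L2.
- by apply: measurable_sqnE; case: L2.
- by move=> x _; rewrite lee_fin; exact: sqn_trunc_le.
Qed.

Lemma cL2_fourier f : cL1 setT f -> cL2 setT f -> cL2 setT (fourier f).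
Proof.
move=> L1 L2; split; first exact: cmeas_fourier.
by rewrite (le_lt_trans (energy_fourier_le L1 L2))// ltry.
Qed.

Lemma sqnorm_fourier_le f : cL1 setT f -> cL2 setT f ->
  sqnorm setT (fourier f) <= 2 * pi * sqnorm setT f.
Proof.
move=> L1 L2; rewrite -lee_fin -energyE; first exact: energy_fourier_le.
exact: cL2_fourier.
Qed.

(** Plancherel's formula on the intersection of L^1 and L^2.  The inequality
    [sqnorm_fourier_le], applied to [trunc f n - f], shows that the transforms of the
    truncations converge in mean square. *)
Theorem sqnorm_fourier f : cL1 setT f -> cL2 setT f ->
  sqnorm setT (fourier f) = 2 * pi * sqnorm setT f.
Proof.
move=> L1 L2.
have Lt n := cL2_trunc n L2; have L1t n := cL1_trunc n L2.
have LF n := cL2_fourier (L1t n) (Lt n).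
have cT := sqnorm_trunc L2.
have c1 : sqnorm setT (fourier (trunc f n)) @[n --> \oo] --> sqnorm setT (fourier f).
  apply: sqnorm_cvg => //; first exact: cL2_fourier.
  apply: (@cvg0_le _ _ (fun n => 2 * pi * sqnorm setT (fun x => trunc f n x - f x))).
    move=> n; rewrite sqnorm_ge0 /=.
    have -> : (fun x => fourier (trunc f n) x - fourier f x) = fourier (fun x => trunc f n x - f x).
      by apply/funext => x; rewrite fourierB.
    apply: sqnorm_fourier_le; [exact: cL1B|exact: cL2B].
  by have := cvgM (cvg_cst (2 * pi : R)) cT; rewrite mulr0; apply.
have c2 : sqnorm setT (fourier (trunc f n)) @[n --> \oo] --> 2 * pi * sqnorm setT f.
  rewrite [X in X @ _](_ : _ = (fun n => 2 * pi * sqnorm setT (trunc f n))); last first.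
    by apply/funext => n; case: (fourier_trunc n L2).
  apply: (cvgM (cvg_cst (2 * pi : R))).
  exact: sqnorm_cvg.
exact: (cvg_unique _ c1 c2).
Qed.

End Plancherel.

(** * The Fourier transform on L^2 *)

Section LpNorms.
Context {R : realType}.
Local Notation mu := (@lebesgue_measure R).
Local Notation Re := complex.Re.
Local Notation Im := complex.Im.
Local Notation normc := ComplexField.Normc.normc.
Implicit Types (f g h u : R -> R[i]) (D : set R).

Lemma normc_sqn (z : R[i]) : normc z = Num.sqrt (sqn z).
Proof. by case: z. Qed.

Lemma normr_Re_le (z : R[i]) : `|Re z| <= normc z.
Proof. by rewrite normc_sqn -sqrtr_sqr ler_wsqrtr// lerDl sqr_ge0. Qed.

Lemma normr_Im_le (z : R[i]) : `|Im z| <= normc z.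
Proof. by rewrite normc_sqn -sqrtr_sqr ler_wsqrtr// lerDr sqr_ge0. Qed.

Lemma normc_le (z : R[i]) : normc z <= `|Re z| + `|Im z|.
Proof.
rewrite normc_sqn -[leRHS]ger0_norm ?addr_ge0// -sqrtr_sqr ler_wsqrtr//.
rewrite sqrrD /sqn !real_normK ?num_real//.
by rewrite -addrA lerD2l lerDr mulrn_wge0// mulr_ge0.
Qed.

Lemma cnorm2E f : cnorm 2%:E f = (energy setT f `^ 2^-1)%E.
Proof.
rewrite /cnorm unlock; congr poweR; apply: eq_integral => x _ /=.
rewrite powR_mulrn// normc_sqn real_normK ?num_real// sqr_sqrtr//.
exact: sqn_ge0.
Qed.

Lemma cnorm2_cL2 f : cL2 setT f -> cnorm 2%:E f = (Num.sqrt (sqnorm setT f))%:E.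
Proof.
by move=> Lf; rewrite cnorm2E energyE// poweR_EFin powR12_sqrt// sqnorm_ge0.
Qed.

Lemma inLp2P f : inLp 2%:E f <-> cL2 setT f.
Proof.
split=> [[m1 m2]|[[m1 m2] h]].
  by rewrite cnorm2E => /lty_poweRy h; split => //; apply: h.
by split=> //; rewrite cnorm2E poweR_lty.
Qed.

Lemma measurable_normc f : cmeas f -> measurable_fun setT (fun x => normc (f x)).
Proof.
move=> mf; rewrite (_ : (fun x => _) = (fun x => (sqn (f x)) `^ 2^-1)); last first.
  by apply/funext => x; rewrite normc_sqn powR12_sqrt ?sqn_ge0.
apply: (measurableT_comp (f := fun y : R => y `^ 2^-1)); first exact: measurable_powR.
exact: measurable_sqn.
Qed.

Lemma normc_ge0 (z : R[i]) : 0 <= normc z. Proof. by rewrite normc_sqn. Qed.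

Lemma inLp1P f : inLp 1%:E f <-> cL1 setT f.
Proof.
have E : cnorm 1%:E f = (\int[mu]_x (normc (f x))%:E)%E.
  rewrite /cnorm Lnorm1; apply: eq_integral => x _ /=.
  by rewrite ger0_norm ?normc_ge0.
split=> [[m1 m2]|Lf].
  rewrite E => h; apply: (cL1_le measurableT _ (F := fun x => normc (f x))) => //.
  - apply/integrableP; split; first by apply/measurable_EFinP; apply: measurable_normc; split.
    by under eq_integral do rewrite gee0_abs ?lee_fin ?normc_ge0//.
  - by move=> x _; split; [exact: normr_Re_le|exact: normr_Im_le].
have [[m1 m2] _ _] := Lf; split => //; rewrite E.
apply: le_lt_trans (integrable_lty measurableT (integrable_normReIm measurableT Lf)).
apply: ge0_le_integral => //.
- by move=> x _; rewrite lee_fin normc_ge0.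
- by apply/measurable_EFinP; apply: measurable_normc; split.
- by case/integrableP: (integrable_normReIm measurableT Lf).
- by move=> x _; rewrite lee_fin normc_le.
Qed.

Lemma cvg_seq_eq (a b : nat -> R) (l l' : R) : l = l' -> (forall n, a n = b n) ->
  a n @[n --> \oo] --> l -> b n @[n --> \oo] --> l'.
Proof. by move=> -> /funext ->. Qed.

Lemma cnorm2_cvg0P (w : nat -> R -> R[i]) : (forall n, cL2 setT (w n)) ->
  (cnorm 2%:E (w n) @[n --> \oo] --> 0%E) <->
  (sqnorm setT (w n) @[n --> \oo] --> (0 : R)).
Proof.
move=> Lw.
have -> : (fun n => cnorm 2%:E (w n)) = (fun n => (Num.sqrt (sqnorm setT (w n)))%:E).
  by apply/funext => n; rewrite cnorm2_cL2.
split=> [/fine_cvgP[_ h]|h].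
  apply: (cvg_seq_eq _ _ (cvgM h h)) => [|n]; first by rewrite mulr0.
  by rewrite -[LHS]/(Num.sqrt _ * Num.sqrt _) -expr2 sqr_sqrtr ?sqnorm_ge0.
apply: cvg_EFin; first exact: nearW.
rewrite -sqrtr0; exact: (continuous_cvg _ (@sqrt_continuous R 0) h).
Qed.

(** [is_fourierL2] in terms of squared norms, see [is_fourierL2P]. *)
Definition fourierL2 f g : Prop :=
  [/\ cL2 setT f, cL2 setT g & exists u : nat -> R -> R[i],
    [/\ forall n, cL1 setT (u n) /\ cL2 setT (u n),
     sqnorm setT (fun x => u n x - f x) @[n --> \oo] --> (0 : R) &
     sqnorm setT (fun x => fourier (u n) x - g x) @[n --> \oo] --> (0 : R)]].

Lemma is_fourierL2P f g : is_fourierL2 f g <-> fourierL2 f g.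
Proof.
split=> [[/inLp2P Lf /inLp2P Lg [u [Lu c1 c2]]]|[Lf Lg [u [Lu c1 c2]]]].
- have Lu' n : cL1 setT (u n) /\ cL2 setT (u n).
    by have [/inLp1P ? /inLp2P ?] := Lu n.
  split => //; exists u; split => //.
  + by apply/cnorm2_cvg0P => // n; apply: cL2B => //; case: (Lu' n).
  + apply/cnorm2_cvg0P => // n; apply: cL2B => //.
    by apply: cL2_fourier; case: (Lu' n).
- split; [exact/inLp2P|exact/inLp2P|exists u; split].
  + by move=> n; have [? ?] := Lu n; split; [exact/inLp1P|exact/inLp2P].
  + by apply/cnorm2_cvg0P => // n; apply: cL2B => //; case: (Lu n).
  + apply/cnorm2_cvg0P => // n; apply: cL2B => //.
    by apply: cL2_fourier; case: (Lu n).
Qed.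

Lemma sqnorm0 D : sqnorm D (fun _ : R => 0 : R[i]) = 0.
Proof.
rewrite unlock /energy (eq_integral (fun=> 0%E)) ?integral0// => x _.
by rewrite sqn0.
Qed.

Lemma fourierL2_sqnorm f g : fourierL2 f g ->
  sqnorm setT g = 2 * pi * sqnorm setT f.
Proof.
move=> [Lf Lg [u [Lu c1 c2]]].
have d1 := sqnorm_cvg measurableT (fun n => (Lu n).2) Lf c1.
have d2 := sqnorm_cvg measurableT (fun n => cL2_fourier (Lu n).1 (Lu n).2) Lg c2.
have d3 : sqnorm setT (fourier (u n)) @[n --> \oo] --> 2 * pi * sqnorm setT f.
  apply: (cvg_seq_eq erefl _ (cvgM (cvg_cst (2 * pi : R)) d1)) => n.
  by rewrite (sqnorm_fourier (Lu n).1 (Lu n).2).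
exact: (cvg_unique _ d2 d3).
Qed.

Lemma fourierL2D f g f' g' : fourierL2 f g -> fourierL2 f' g' ->
  fourierL2 (fun x => f x + f' x) (fun x => g x + g' x).
Proof.
move=> [Lf Lg [u [Lu c1 c2]]] [Lf' Lg' [u' [Lu' c1' c2']]].
split; [exact: cL2D|exact: cL2D|exists (fun n x => u n x + u' n x); split].
- move=> n; have [? ?] := Lu n; have [? ?] := Lu' n.
  by split; [exact: cL1D|exact: cL2D].
- apply: (@cvg0_le _ _ (fun n => 2 * sqnorm setT (fun x => u n x - f x) +
                                 2 * sqnorm setT (fun x => u' n x - f' x))).
    move=> n; rewrite sqnorm_ge0/=.
    under [X in sqnorm _ X]eq_fun do rewrite opprD addrACA.
    by apply: sqnormD_le2 => //; apply: cL2B => //; [case: (Lu n)|case: (Lu' n)].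
  have := cvgD (cvgM (cvg_cst (2 : R)) c1) (cvgM (cvg_cst (2 : R)) c1').
  by rewrite mulr0 addr0; apply.
- apply: (@cvg0_le _ _ (fun n => 2 * sqnorm setT (fun x => fourier (u n) x - g x) +
                                 2 * sqnorm setT (fun x => fourier (u' n) x - g' x))).
    move=> n; rewrite sqnorm_ge0/=; have [L1 L2] := Lu n; have [L1' L2'] := Lu' n.
    under [X in sqnorm _ X]eq_fun do rewrite fourierD// opprD addrACA.
    by apply: sqnormD_le2 => //; apply: cL2B => //; exact: cL2_fourier.
  have := cvgD (cvgM (cvg_cst (2 : R)) c2) (cvgM (cvg_cst (2 : R)) c2').
  by rewrite mulr0 addr0; apply.
Qed.

Lemma fourierL2Z z f g : fourierL2 f g ->
  fourierL2 (fun x => z * f x) (fun x => z * g x).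
Proof.
move=> [Lf Lg [u [Lu c1 c2]]].
split; [exact: cL2Z|exact: cL2Z|exists (fun n x => z * u n x); split].
- by move=> n; have [? ?] := Lu n; split; [exact: cL1Z|exact: cL2Z].
- apply: (cvg_seq_eq _ _ (cvgM (cvg_cst (sqn z)) c1)) => [|n]; first by rewrite mulr0.
  rewrite -[LHS]/(sqn z * sqnorm _ _) -sqnormZ//.
    by under [in LHS]eq_fun do rewrite mulrBr.
  by apply: cL2B => //; case: (Lu n).
- apply: (cvg_seq_eq _ _ (cvgM (cvg_cst (sqn z)) c2)) => [|n]; first by rewrite mulr0.
  have [L1 L2] := Lu n; rewrite -[LHS]/(sqn z * sqnorm _ _) -sqnormZ//.
    by congr sqnorm; apply/funext => x; rewrite fourierZ// mulrBr.
  by apply: cL2B => //; exact: cL2_fourier.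
Qed.

Lemma fourierL2B f g f' g' : fourierL2 f g -> fourierL2 f' g' ->
  fourierL2 (fun x => f x - f' x) (fun x => g x - g' x).
Proof.
move=> h h'; have := fourierL2D h (fourierL2Z (-1) h').
under eq_fun do rewrite mulN1r; under [X in fourierL2 _ X]eq_fun do rewrite mulN1r.
exact.
Qed.

Lemma fourierL2_sum (T : Type) (s : seq T) (F G : T -> R -> R[i]) :
  (forall i, fourierL2 (F i) (G i)) ->
  fourierL2 (fun x => \sum_(i <- s) F i x) (fun x => \sum_(i <- s) G i x).
Proof.
move=> FG; elim: s => [|i s IH].
  have L0 : cL2 setT (fun _ : R => 0 : R[i]) by exact: cL20.
  have L10 : cL1 setT (fun _ : R => 0 : R[i]) by exact: cL10.
  have F0 x : fourier (fun _ : R => 0 : R[i]) x = 0.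
    rewrite fourierE (_ : (fun _ => _) = fun=> 0) ?cint0//.
    by apply/funext => y; rewrite mul0r.
  have S0 : sqnorm setT (fun _ : R => 0 - 0 : R[i]) = 0 by rewrite subr0 sqnorm0.
  under eq_fun do rewrite big_nil; under [X in fourierL2 _ X]eq_fun do rewrite big_nil.
  split => //; exists (fun _ _ => 0); split => //.
  - by rewrite S0; exact: cvg_cst.
  - under eq_cvg do under eq_fun do rewrite F0.
    by rewrite S0; exact: cvg_cst.
under eq_fun do rewrite big_cons; under [X in fourierL2 _ X]eq_fun do rewrite big_cons.
exact: fourierL2D.
Qed.

Lemma sqnorm0_ae f : cL2 setT f -> sqnorm setT f = 0 -> {ae mu, forall x, f x = 0}.
Proof.
move=> Lf s0; have [mf _] := Lf.
have := energy0_ae measurableT mf; rewrite energyE// s0 => /(_ erefl).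
by apply: ae_sub => x /(_ Logic.I).
Qed.

Lemma fourierL2_unique f g g' : fourierL2 f g -> fourierL2 f g' ->
  {ae mu, forall x, g x = g' x}.
Proof.
move=> h h'; have hB := fourierL2B h h'; have [Lf LB _] := hB.
have := fourierL2_sqnorm hB.
have -> : (fun x => f x - f x) = (fun=> 0) by apply/funext => x; rewrite subrr.
rewrite sqnorm0 mulr0 => /(sqnorm0_ae LB).
by apply: ae_sub => x /eqP; rewrite subr_eq0 => /eqP.
Qed.

Lemma fourierL2_affine f g (a b : R) : 0 < a -> fourierL2 f g ->
  fourierL2 (fun x => f (a * x + b))
    (fun xi => real_complex R a^-1 * (cis (a^-1 * xi * b) * g (a^-1 * xi))).
Proof.
move=> a0 [Lf Lg [u [Lu c1 c2]]].
have a0' : 0 < a^-1 by rewrite invr_gt0.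
have mc : cmeas (fun xi => cis (a^-1 * xi * b)).
  apply: cmeas_cis; apply: (measurableT_comp (f := fun y : R => y * b)).
    exact: mulrr_measurable.
  exact: mulrl_measurable.
have L2a h : cL2 setT h ->
    cL2 setT (fun xi => real_complex R a^-1 * (cis (a^-1 * xi * b) * h (a^-1 * xi))).
  move=> Lh; apply: cL2Z => //; apply: (cL2M measurableT mc (M := 1)).
    by move=> x _; rewrite sqn_cis.
  by have := cL2_affmap 0 a0' Lh; under eq_fun do rewrite addr0.
have S2a h : cL2 setT h -> sqnorm setT (fun xi => real_complex R a^-1 *
    (cis (a^-1 * xi * b) * h (a^-1 * xi))) = a^-1 * sqnorm setT h.
  move=> Lh; have La := cL2_affmap 0 a0' Lh.
  transitivity (a^-1 ^+ 2 * sqnorm setT (fun x => h (a^-1 * x + 0))); last first.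
    by rewrite sqnorm_affmap// invrK; field; rewrite gt_eqF.
  rewrite -sqnC -sqnormZ// unlock; congr fine; apply: eq_integral => x _.
  by rewrite addr0 !sqnM sqn_cis mul1r.
split; [exact: cL2_affmap|exact: L2a|exists (fun n x => u n (a * x + b)); split].
- move=> n; have [L1 L2] := Lu n; split; last exact: cL2_affmap.
  by case: (cL1_affmap b a0 L1).
- apply: (cvg_seq_eq _ _ (cvgM (cvg_cst a^-1) c1)) => [|n]; first by rewrite mulr0.
  rewrite -[LHS]/(a^-1 * sqnorm _ _).
  by rewrite -(sqnorm_affmap b a0)//; apply: cL2B => //; case: (Lu n).
- apply: (cvg_seq_eq _ _ (cvgM (cvg_cst a^-1) c2)) => [|n]; first by rewrite mulr0.
  rewrite -[LHS]/(a^-1 * sqnorm _ _); have [L1 L2] := Lu n.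
  rewrite -S2a; last by apply: cL2B => //; exact: cL2_fourier.
  by congr sqnorm; apply/funext => xi; rewrite fourier_affine// -mulrBr -mulrBr.
Qed.

(** Polarisation of [fourierL2_sqnorm]. *)
Lemma fourierL2_ip f g f' g' : fourierL2 f g -> fourierL2 f' g' ->
  ip setT g g' = real_complex R (2 * pi) * ip setT f f'.
Proof.
move=> h h'; have [Lf Lg _] := h; have [Lf' Lg' _] := h'.
have aux p q : fourierL2 p q -> cL2 setT p -> cL2 setT q ->
    Re (ip setT g q) = 2 * pi * Re (ip setT f p).
  move=> hp Lp Lq.
  have := fourierL2_sqnorm (fourierL2D h hp); rewrite !sqnormDE//.
  rewrite (fourierL2_sqnorm h) (fourierL2_sqnorm hp); lra.
have e1 := aux _ _ h' Lf' Lg'.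
have Li := cL2Z measurableT (Complex 0 1) Lf'.
have Li' := cL2Z measurableT (Complex 0 1) Lg'.
have := aux _ _ (fourierL2Z (Complex 0 1) h') Li Li'.
have ReI : Re (Complex 0 1 : R[i]) = 0 by [].
have ImI : Im (Complex 0 1 : R[i]) = 1 by [].
rewrite !ipZr// !ReM !Re_conjc !Im_conjc ReI ImI => e2.
apply: complexP; first by rewrite ReM ReC ImC mul0r subr0.
by rewrite ImM ReC ImC mul0r addr0; lra.
Qed.

End LpNorms.

(** * Surjectivity on indicator functions *)

Section Existence.
Context {R : realType}.
Local Notation mu := (@lebesgue_measure R).
Local Notation Re := complex.Re.
Local Notation Im := complex.Im.
Implicit Types (f g h u : R -> R[i]) (D : set R).

Lemma Rintegral_swap (P : R -> R -> R) (F G : R -> R) :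
  measurable_fun [set: R * R] (fun z => P z.1 z.2) ->
  mu.-integrable setT (fun x => (F x)%:E) -> mu.-integrable setT (fun x => (G x)%:E) ->
  (forall x y, `|P x y| <= F x * G y) ->
  \int[mu]_x \int[mu]_y P x y = \int[mu]_y \int[mu]_x P x y.
Proof.
move=> mP iF iG PFG.
have mF := measurable_int _ iF; have mG := measurable_int _ iG.
have mPE : measurable_fun [set: R * R] (fun z => (P z.1 z.2)%:E).
  by apply/measurable_EFinP.
have mPx x : measurable_fun setT (fun y => (P x y)%:E).
  exact: (measurable_fun_pair2 x mPE).
have mPy y : measurable_fun setT (fun x => (P x y)%:E).
  exact: (measurable_fun_pair1 y mPE).
have ix x : mu.-integrable setT (fun y => (P x y)%:E).
  apply: (@le_integrable _ _ _ mu setT measurableT _ (fun y => (F x * G y)%:E)) => //.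
  - exact: mPx.
  - by move=> y _; rewrite /= lee_fin (le_trans (PFG x y))// ler_norm.
  - exact: integrable_scale.
have iy y : mu.-integrable setT (fun x => (P x y)%:E).
  apply: (@le_integrable _ _ _ mu setT measurableT _ (fun x => (G y * F x)%:E)) => //.
  - exact: mPy.
  - by move=> x _; rewrite /= lee_fin (le_trans (PFG x y))// mulrC ler_norm.
  - exact: integrable_scale.
have iP : (mu \x mu)%E.-integrable setT (fun z : R * R => (P z.1 z.2)%:E).
  apply/(integrable12ltyP mu mu mPE) => /=.
  have [/integrableP[_ F1] /integrableP[_ G1]] := (iF, iG).
  pose c := fine (\int[mu]_y `|(G y)%:E|)%E.
  have cE : (\int[mu]_y `|(G y)%:E|)%E = c%:E.
    by rewrite fineK// ge0_fin_numE// integral_ge0.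
  have c0 : (0 <= c%:E)%E by rewrite -cE integral_ge0.
  have mFa : measurable_fun setT (fun x => `|(F x)%:E|%E) by exact: measurableT_comp.
  have mGa : measurable_fun setT (fun x => `|(G x)%:E|%E) by exact: measurableT_comp.
  have mPa : measurable_fun setT (fun z : R * R => `|(P z.1 z.2)%:E|%E).
    exact: measurableT_comp.
  apply: (@le_lt_trans _ _ (\int[mu]_x (c%:E * `|(F x)%:E|))%E); last first.
    by rewrite ge0_integralZl// lte_mul_pinfty.
  apply: ge0_le_integral => //.
  - by move=> x _; apply: integral_ge0.
  - exact: (@measurable_fun_fubini_tonelli_F _ _ _ _ _ mu _ mPa (fun=> abse_ge0 _)).
  - by apply: measurable_funeM.
  move=> x _; rewrite -cE muleC -ge0_integralZl//.
  have mPxa : measurable_fun setT (fun y => `|(P x y)%:E|%E).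
    exact: (measurable_fun_pair2 x mPa).
  apply: ge0_le_integral => //.
  - by apply: measurable_funeM.
  - by move=> y _; rewrite -abseM lee_fin (le_trans (PFG x y))// ler_norm.
have := Fubini iP; rewrite /Rintegral /= => e.
transitivity (fine (\int[mu]_x \int[mu]_y (P x y)%:E)%E).
  congr fine; apply: eq_integral => x _; rewrite fineK//.
  exact: integrable_fin_num.
rewrite e; congr fine; apply: eq_integral => y _; rewrite fineK//.
exact: integrable_fin_num.
Qed.

Lemma fourier_mul_formula f g : cL1 setT f -> cL1 setT g ->
  cint setT (fun xi => fourier f xi * g xi) = cint setT (fun x => f x * fourier g x).
Proof.
move=> Lf Lg; have [[mf1 mf2] _ _] := Lf; have [[mg1 mg2] _ _] := Lg.
pose phi (xi x : R) : R[i] := (f x * g xi) * cis (- (xi * x)).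
have E1 xi : fourier f xi * g xi = cint setT (phi xi).
  rewrite mulrC fourierE -cintZ//; last exact: cL1_cisM.
  by congr cint; apply/funext => x; rewrite /phi mulrA [g xi * _]mulrC.
have E2 x : f x * fourier g x = cint setT (phi ^~ x).
  rewrite fourierE -cintZ//; last exact: cL1_cisM.
  by congr cint; apply/funext => xi; rewrite /phi mulrA [xi * x]mulrC.
have iF := integrable_normReIm measurableT Lf.
have iG := integrable_normReIm measurableT Lg.
have bnd xi x : `|Re (phi xi x)| <= (`|Re (g xi)| + `|Im (g xi)|) * (`|Re (f x)| + `|Im (f x)|) /\
     `|Im (phi xi x)| <= (`|Re (g xi)| + `|Im (g xi)|) * (`|Re (f x)| + `|Im (f x)|).
  have tr (a b c d : R) : `|a * c| + `|b * d| + (`|a * d| + `|b * c|) <= (`|c| + `|d|) * (`|a| + `|b|).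
    by rewrite !normrM; lra.
  have [h1 h2] := normr_ReIm_cisM (f x * g xi) (- (xi * x)).
  have h3 : `|Re (f x * g xi)| + `|Im (f x * g xi)| <=
      (`|Re (g xi)| + `|Im (g xi)|) * (`|Re (f x)| + `|Im (f x)|).
    apply: le_trans (tr _ _ _ _); rewrite ReM ImM; apply: lerD; last exact: ler_normD.
    exact: ler_normB.
  by split; [exact: le_trans h1 h3|exact: le_trans h2 h3].
have m1 (p : R -> R) : measurable_fun setT p -> measurable_fun [set: R * R] (fun z : R * R => p z.1).
  by move=> mp; exact: (measurableT_comp mp measurable_fst).
have m2 (p : R -> R) : measurable_fun setT p -> measurable_fun [set: R * R] (fun z : R * R => p z.2).
  by move=> mp; exact: (measurableT_comp mp measurable_snd).
have mt : measurable_fun [set: R * R] (fun z : R * R => - (z.1 * z.2)).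
  by apply: measurable_funN; apply: measurable_funM; [exact: measurable_fst|exact: measurable_snd].
have mc : measurable_fun [set: R * R] (fun z : R * R => cos (- (z.1 * z.2))).
  apply: measurableT_comp mt; apply: continuous_measurable_fun; exact: continuous_cos.
have ms : measurable_fun [set: R * R] (fun z : R * R => sin (- (z.1 * z.2))).
  apply: measurableT_comp mt; apply: continuous_measurable_fun; exact: continuous_sin.
have mre : measurable_fun [set: R * R] (fun z : R * R => Re (f z.2 * g z.1)).
  under eq_fun do rewrite ReM.
  exact: (measurable_funB (measurable_funM (m2 _ mf1) (m1 _ mg1))
    (measurable_funM (m2 _ mf2) (m1 _ mg2))).
have mim : measurable_fun [set: R * R] (fun z : R * R => Im (f z.2 * g z.1)).
  under eq_fun do rewrite ImM.
  exact: (measurable_funD (measurable_funM (m2 _ mf1) (m1 _ mg2))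
    (measurable_funM (m2 _ mf2) (m1 _ mg1))).
under eq_fun do rewrite E1; under [in RHS]eq_fun do rewrite E2.
apply: complexP; rewrite ?Re_cint ?Im_cint.
- under eq_Rintegral do rewrite Re_cint; under [in RHS]eq_Rintegral do rewrite Re_cint.
  apply: (Rintegral_swap _ iG iF); last by move=> xi x; case: (bnd xi x).
  under eq_fun do rewrite ReM.
  exact: (measurable_funB (measurable_funM mre mc) (measurable_funM mim ms)).
- under eq_Rintegral do rewrite Im_cint; under [in RHS]eq_Rintegral do rewrite Im_cint.
  apply: (Rintegral_swap _ iG iF); last by move=> xi x; case: (bnd xi x).
  under eq_fun do rewrite ImM.
  exact: (measurable_funD (measurable_funM mre ms) (measurable_funM mim mc)).
Qed.

Lemma cL12_char (A : set R) : measurable A -> (mu A < +oo)%E ->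
  cL1 setT (char_fun A : R -> R[i]) /\ cL2 setT (char_fun A : R -> R[i]).
Proof.
move=> mA fA.
have E : char_fun A = (fun x => char_fun A x * 1) :> (R -> R[i]).
  by apply/funext => x; rewrite mulr1.
have L1A : cL2 A (fun _ : R => 1 : R[i]).
  by apply: (cL2_bounded (M := 1)) => // x _; rewrite sqn1.
split; rewrite E; first by apply: cL1_char => //; case: L1A.
by apply/cL2_char => //; case: L1A.
Qed.

(** The candidate is the inverse transform, written with the conjugate of the
    transform of the real function [char_fun A].  By the multiplication formula the
    inner product of the transform of its truncation with [char_fun A] is [2 * pi]
    times the squared norm of the truncation, so that the squared distance between
    them is a difference of two norms, which tends to [0] by Plancherel. *)
Theorem fourierL2_exists (A : set R) : measurable A -> (mu A < +oo)%E ->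
  exists psi : R -> R[i], fourierL2 psi (char_fun A).
Proof.
move=> mA fA; have [L1 L2] := cL12_char mA fA.
set chi : R -> R[i] := char_fun A.
have LF := cL2_fourier L1 L2.
(* Conjugation turns the transform into 2 pi times its inverse, since chi is real. *)
pose psi x := real_complex R (2 * pi)^-1 * conjc (fourier chi x).
have Lp : cL2 setT psi by apply: cL2Z => //; exact: cL2_conjc.
have pi2 := @twopi_gt0 R.
have Np : sqnorm setT chi = 2 * pi * sqnorm setT psi.
  rewrite sqnormZ//; last exact: cL2_conjc.
  have -> : sqnorm setT (fun x => conjc (fourier chi x)) = sqnorm setT (fourier chi).
    by rewrite unlock; congr fine; apply: eq_integral => x _; rewrite sqn_conjc.
  have aux (p s : R) : p != 0 -> s = p * (p^-1 ^+ 2 * (p * s)) by move=> p0; field.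
  by rewrite sqnorm_fourier// sqnC; apply: aux; rewrite gt_eqF.
exists psi; split => //; exists (trunc psi); split.
- by move=> n; split; [exact: cL1_trunc|exact: cL2_trunc].
- exact: sqnorm_trunc.
have cT := sqnorm_cvg measurableT (fun n => cL2_trunc n Lp) Lp (sqnorm_trunc Lp).
apply: (cvg_seq_eq _ _ (cvgB (cvg_cst (sqnorm setT chi)) (cvgM (cvg_cst (2 * pi : R)) cT))).
  by rewrite Np subrr.
move=> n; rewrite -[LHS]/(sqnorm setT chi - 2 * pi * sqnorm setT (trunc psi n)).
have L1t := cL1_trunc n Lp; have L2t := cL2_trunc n Lp.
have LFt := cL2_fourier L1t L2t.
rewrite sqnormBE// sqnorm_fourier//.
suff -> : ip setT (fourier (trunc psi n)) chi =
    real_complex R (2 * pi) * real_complex R (sqnorm setT (trunc psi n)).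
  by rewrite ReM !ReC !ImC mul0r subr0; lra.
transitivity (cint setT (fun xi => fourier (trunc psi n) xi * chi xi)).
  rewrite /ip; congr cint; apply/funext => x; congr (_ * _).
  by rewrite /chi char_funE; apply: complexP; rewrite ?Re_conjc ?Im_conjc; case: ifP; rewrite ?oppr0.
rewrite fourier_mul_formula// -ip_sqnorm// -ipZl//.
rewrite /ip; congr cint; apply/funext => x.
have -> : fourier chi x = real_complex R (2 * pi) * conjc (psi x).
  rewrite /psi conjcM conjcK mulrA.
  have -> : conjc (real_complex R (2 * pi)^-1) = real_complex R (2 * pi)^-1.
    by apply: complexP; rewrite ?Re_conjc ?Im_conjc ?ImC ?oppr0.
  by rewrite c2piV mul1r.
rewrite mulrCA -mulrA; congr (_ * _).
rewrite /trunc char_funE; case: ifP => _; rewrite ?mul1r// !mul0r//.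
Qed.

End Existence.

(** * The two tilings by the wavelet set *)

Section Tiling.
Context {R : realType}.
Variables (r : nat) (eps : R).
Hypothesis hr : (1 <= r)%N.
Hypothesis eps_gt0 : 0 < eps.
Hypothesis eps_lt : eps < (2 ^+ r - 1) / (2 ^+ r.+1 - 1) * pi.
Local Notation N := (2 ^+ r.+1 : R).
Local Notation t := (@t_ R r).

Lemma N_ge4 : 4 <= N.
Proof.
have -> : 4 = 2 ^+ 2 :> R by rewrite expr2; lra.
by rewrite ler_eXn2l ?ltr1n.
Qed.

(** The defining property of [t]: it makes the interval [J_], translated down by
    [N * pi], equal to [0, t], while divided by [N] it is [pi, t]. *)
Lemma tE : N * t = N * pi + t.
Proof. by rewrite /t_; have := N_ge4; move: N pi => n p n4; field; lra. Qed.

Lemma pi_lt_t : pi < t.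
Proof. by have := tE; have := N_ge4; have := pi_gt0 R; nra. Qed.

Lemma t_eps : t + 2 * eps < 2 * pi.
Proof.
have N4 := N_ge4; have p0 := pi_gt0 R.
have N2 : N = 2 * 2 ^+ r by rewrite exprS.
have d0 : 0 < N - 1 by lra.
have h : eps * (N - 1) < (2 ^+ r - 1) * pi.
  by rewrite -ltr_pdivlMr// mulrAC.
have e := tE; rewrite N2 in e h d0 N4 *.
move: (2 ^+ r : R) (t_ r) e h d0 N4 => M s e h d0 N4.
suff : (2 * M - 1) * (s + 2 * eps) < (2 * M - 1) * (2 * pi) by rewrite ltr_pM2l.
nra.
Qed.

Lemma t_lt_2pi : t < 2 * pi.
Proof. have := t_eps; have := eps_gt0; lra. Qed.

Lemma affineP (c a : R) (S : set R) x : c != 0 -> affine c a S x <-> S ((x - a) / c).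
Proof.
move=> c0; split=> [[s Ss <-]|Ss].
  by rewrite addrK mulrC mulKf.
by exists ((x - a) / c) => //; rewrite mulrC divfK// subrK.
Qed.

(** [E_ n] translated to the bottom: [S1], [F_ 0], [F_ 1], and so on. *)
Definition G_ n : set R := if n is m.+1 then F_ r eps m else S1 r eps.

Lemma E_P n x : E_ r eps n x <-> G_ n (x - N * pi).
Proof.
have -> : E_ r eps n = affine 1 (N * pi) (G_ n) by case: n.
by rewrite affineP ?oner_neq0// divr1.
Qed.

Lemma F_P n x : F_ r eps n x <-> G_ n (N * (2 ^+ n.+1 * x) - N * pi).
Proof.
rewrite /F_ affineP; last by rewrite invr_eq0 expf_eq0 pnatr_eq0 andbF.
rewrite subr0 invrK E_P.
suff -> : x * 2 ^+ (n + r + 2) = N * (2 ^+ n.+1 * x) by [].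
by rewrite mulrA -exprD mulrC; congr (2 ^+ _ * _); lia.
Qed.

Lemma S1_bounds x : S1 r eps x -> t / 2 < x <= t.
Proof.
rewrite /S1 /= in_itv /= => /andP[h1 h2].
have e0 : 0 < eps / 2 ^+ r.+1 by rewrite divr_gt0// exprn_gt0.
have h3 := pi_lt_t; have h4 := t_eps; apply/andP; split; lra.
Qed.

Lemma G_bounds n x : G_ n x -> 0 < x <= t.
Proof.
elim: n x => [|n IH] x /=.
  by move=> /S1_bounds; have := pi_lt_t; have := pi_gt0 R; lra.
move=> /F_P /IH; have N4 := N_ge4; have p2 : 1 <= 2 ^+ n.+1 :> R.
  by rewrite exprn_ege1// ler1n.
have e := tE; have p0 := pi_gt0 R; have pt := pi_lt_t.
move: (2 ^+ n.+1 : R) p2 => M M1 /andP[h1 h2].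
have h3 : pi < M * x by rewrite -(ltr_pM2l (_ : 0 < N)); lra.
have h4 : M * x <= t by rewrite -(ler_pM2l (_ : 0 < N)); lra.
by apply/andP; split; nra.
Qed.

(** [F_ n] lies in the [n.+1]-st dyadic shell below [pi, 2 * pi]; this separates the
    sets [F_ n] from each other and makes them shrink to the origin. *)
Lemma F_bounds n x : F_ r eps n x -> pi < 2 ^+ n.+1 * x <= t.
Proof.
move=> /F_P /G_bounds; have N4 := N_ge4; have e := tE; move=> /andP[h1 h2].
apply/andP; split.
- by rewrite -(ltr_pM2l (_ : 0 < N)); lra.
- by rewrite -(ler_pM2l (_ : 0 < N)); lra.
Qed.

Lemma G_disjoint n m x : G_ n x -> G_ m x -> n = m.
Proof.
have tp := t_lt_2pi; have pt := pi_lt_t; have p0 := pi_gt0 R.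
have aux a b y : (a < b)%N -> G_ a y -> G_ b y -> False.
  case: b => // b; case: a => [_ /S1_bounds|a] /=.
    move=> /andP[h1 _] /F_bounds /andP[h2 h3].
    have : 1 <= 2 ^+ b :> R by rewrite exprn_ege1// ler1n.
    move: h2 h3; rewrite exprS; nra.
  rewrite ltnS => ab /F_bounds /andP[h1 h2] /F_bounds /andP[h3 h4].
  have E : 2 ^+ b.+1 = 2 ^+ a.+1 * 2 ^+ (b - a) :> R.
    by rewrite -exprD; congr (_ ^+ _); lia.
  have : 2 <= 2 ^+ (b - a) :> R.
    by rewrite -[leLHS]expr1 ler_eXn2l ?ltr1n// subn_gt0.
  move: h3 h4; rewrite E; nra.
move=> Gn Gm; have [nm|mn|//] := ltngtP n m.
- by case: (aux _ _ _ nm Gn Gm).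
- by case: (aux _ _ _ mn Gm Gn).
Qed.

(** The part of [K_] made of [S1] and of all sets [F_ n]; its translate by [N * pi] is
    the part removed from [J_]. *)
Definition P_ : set R := \bigcup_n G_ n.

Lemma P_bounds x : P_ x -> 0 < x <= t.
Proof. by move=> [n _]; exact: G_bounds. Qed.

Lemma K_P x : K_ r eps x <->
  [\/ (N * pi <= x <= N * t) /\ ~ P_ (x - N * pi), P_ x, t + 2 * eps <= x <= 2 * pi |
      N * t <= x <= N * t + 2 * eps].
Proof.
have UE : (\bigcup_n E_ r eps n) x <-> P_ (x - N * pi).
  by split=> -[n _ /E_P h]; exists n => //; apply/E_P.
split.
- case=> [[[Jx nE]|[n _ Fx]]|[[S1x|S2x]|S3x]].
  + by apply: Or41; split; [move: Jx; rewrite /J_ /= in_itv|move/UE].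
  + by apply: Or42; exists n.+1.
  + by apply: Or42; exists 0%N.
  + by apply: Or43; move: S2x; rewrite /S2 /= in_itv.
  + by apply: Or44; move: S3x; rewrite /S3 /= in_itv.
- case=> [[Jx nP]|[[_ S1x|n _ Fx]]|S2x|S3x].
  + by left; left; split; [rewrite /J_ /= in_itv|move/UE].
  + by right; left; left.
  + by left; right; exists n.
  + by right; left; right; rewrite /S2 /= in_itv.
  + by right; right; rewrite /S3 /= in_itv.
Qed.

Lemma K_low x : 0 <= x <= 2 * pi -> K_ r eps x <-> P_ x \/ t + 2 * eps <= x.
Proof.
have N4 := N_ge4; have p0 := pi_gt0 R; have pt := pi_lt_t.
have Npi : 4 * pi <= N * pi by rewrite ler_pM2r.
have Nt : N * pi <= N * t by rewrite ler_pM2l ?ltW//; lra.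
move=> /andP[x0 x2]; rewrite K_P; split.
- case=> [[/andP[h1 h2] _]|Px|/andP[h1 _]|/andP[h1 h2]]; [lra|by left|by right|lra].
- by case=> [Px|h]; [apply: Or42|apply: Or43; rewrite h].
Qed.

Lemma K_high x : 0 <= x <= 2 * pi ->
  K_ r eps (x + N * pi) <-> (x <= t /\ ~ P_ x) \/ t <= x <= t + 2 * eps.
Proof.
have N4 := N_ge4; have p0 := pi_gt0 R; have pt := pi_lt_t; have tp := t_lt_2pi.
have Npi : 4 * pi <= N * pi by rewrite ler_pM2r.
have e := tE.
move=> /andP[x0 x2]; rewrite K_P addrK; split.
- case=> [[/andP[h1 h2] nP]|/P_bounds Px|h|h]; [left|lra|lra|right; lra].
  by split=> //; lra.
- case=> [[h nP]|h]; [apply: Or41; split=> //; lra|apply: Or44; lra].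
Qed.

Lemma K_range x : K_ r eps x -> (0 < x <= 2 * pi) \/ (0 <= x - N * pi <= 2 * pi).
Proof.
have N4 := N_ge4; have p0 := pi_gt0 R; have pt := pi_lt_t; have tp := t_lt_2pi.
have te := t_eps; have e := tE; have e0 := eps_gt0.
rewrite K_P; case=> [[h _]|/P_bounds h|h|h]; [right|left|left|right]; lra.
Qed.

Lemma K_gt0 x : K_ r eps x -> 0 < x.
Proof.
have N4 := N_ge4; have p0 := pi_gt0 R.
have Npi : 4 * pi <= N * pi by rewrite ler_pM2r.
by move=> /K_range[]; lra.
Qed.

(** Below [t], a point belongs to [K_] through [P_], and its translate belongs to [K_]
    unless it was removed from [J_], that is unless the point is in [P_].  Above [t],
    the sets [S2] and [S3] share the interval at the point [t + 2 * eps]. *)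
Lemma K_translation x : 0 <= x <= 2 * pi -> x != t -> x != t + 2 * eps ->
  K_ r eps (x + N * pi) <-> ~ K_ r eps x.
Proof.
move=> x02 xt xe; rewrite K_high// K_low//.
have e0 := eps_gt0.
have [xlt|xgt|xe'] := ltgtP x t; last by rewrite xe' eqxx in xt.
- split=> [[[_ nP] [//|]|/andP[h _]]|nK]; [lra|lra|left].
  by split=> // Px; apply: nK; left.
- have nP : ~ P_ x by move=> /P_bounds; lra.
  split=> [[[h _]|h] [//|h']|nK]; [lra| |].
    by case/eqP: xe; lra.
  by right; rewrite /= leNgt; apply/negP => h; apply: nK; right; exact: ltW.
Qed.

Lemma dyadic_unique (i : int) (z : R) : pi <= z < 2 * pi -> pi <= 2 ^ i * z < 2 * pi -> i = 0.
Proof.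
have p0 := pi_gt0 R; move=> /andP[h1 h2].
case: i => [[//|n]|n] => /andP[h3 h4].
- exfalso; have h5 : 2 <= 2 ^ n.+1%:Z :> R.
    by rewrite -exprnP -[leLHS]expr1 ler_eXn2l ?ltr1n.
  by move: h3 h4 h5; move: (2 ^ n.+1%:Z : R) => q; nra.
- exfalso; have h5 : 2 ^ (Negz n) <= 2^-1 :> R.
    by rewrite NegzE -exprnN lef_pV2 ?posrE ?exprn_gt0// -[leLHS]expr1 ler_eXn2l ?ltr1n.
  by move: h3 h4 h5; move: (2 ^ Negz n : R) => q; nra.
Qed.

Lemma dyadic_exists (x : R) : 0 < x -> exists i : int, pi <= 2 ^ i * x < 2 * pi.
Proof.
have p0 := pi_gt0 R; move=> x0.
have big (c : R) : exists n : nat, c < 2 ^+ n.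
  have h := archimedean.Num.Theory.truncnS_gt c.
  exists (archimedean.Num.truncn c).+1; apply: lt_le_trans h _.
  by rewrite -natrX ler_nat ltnW// ltn_expl.
have [m hm] := big (x / pi).
pose y := x / 2 ^+ m; have m0 : 0 < 2 ^+ m :> R by rewrite exprn_gt0.
have y0 : 0 < y by rewrite divr_gt0.
have ypi : y < pi by rewrite ltr_pdivrMr// -ltr_pdivrMl// mulrC.
have ex : exists n : nat, pi <= 2 ^+ n * y.
  by have [n hn] := big (pi / y); exists n; rewrite -ler_pdivrMr// ltW.
have [n hn nmin] := ex_minnP ex.
case: n hn nmin => [|n] hn nmin; first by move: hn; rewrite expr0 mul1r; lra.
have hlt : 2 ^+ n * y < pi.
  by rewrite ltNge; apply/negP => /nmin; rewrite ltnn.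
exists (n.+1%:Z - m%:Z).
have -> : 2 ^ (n.+1%:Z - m%:Z) * x = 2 ^+ n.+1 * y.
  by rewrite expfzDr ?pnatr_eq0// -exprnP -exprnN /y mulrA mulrAC.
by rewrite hn /= exprS -mulrA; lra.
Qed.

Lemma exprz_succn (j : int) (n : nat) (z : R) :
  2 ^+ n * (2 ^ j * z) = 2 ^ (j + n%:Z) * z.
Proof. by rewrite mulrA exprnP -expfzDr ?pnatr_eq0// addrC. Qed.

Lemma exprz_predn (j : int) (n : nat) (z : R) :
  2 ^ j * z = 2 ^+ n * (2 ^ (j - n%:Z) * z).
Proof. by rewrite exprz_succn subrK. Qed.

(** For [z] in the fundamental interval ]pi, 2 * pi[, the alternatives say which dilate
    of [z] lands in which piece of [K_]: the dilation [j = r.+1] reaches [J_] and [S3],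
    [j = Negz n] reaches [F_ n], [j = 0] reaches [S2] and [j = -1] reaches [S1].  The
    conditions on [z] are mutually exclusive except at finitely many points. *)
Lemma K_dyadicP (j : int) (z : R) : pi < z < 2 * pi -> K_ r eps (2 ^ j * z) <->
  [\/ j = r.+1%:Z /\ (z <= t /\ ~ P_ (N * z - N * pi) \/ t <= z <= t + 2 * eps / N),
      exists n, j = Negz n /\ G_ n (N * z - N * pi),
      j = 0 /\ t + 2 * eps <= z | j = -1 /\ t + 2 * eps / N <= z <= t + 2 * eps].
Proof.
have N4 := N_ge4; have p0 := pi_gt0 R; have pt := pi_lt_t; have tp := t_lt_2pi.
have te := t_eps; have e := tE; have e0 := eps_gt0.
have N0 : 0 < N by lra.
have eN : 2 * eps / N < 2 * eps by rewrite ltr_pdivrMr//; nra.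
have eN0 : 0 < 2 * eps / N by rewrite divr_gt0//; lra.
have NeN : N * (2 * eps / N) = 2 * eps by rewrite mulrC divfK// gt_eqF.
move=> zpi; have zpi' : pi <= z < 2 * pi by lra.
have S1E x : S1 r eps x <-> t + 2 * eps / N <= 2 ^+ 1 * x <= t + 2 * eps.
  rewrite /S1 /= in_itv /= expr1.
  (* S1 is half of the interval from t + 2 eps / N to t + 2 eps. *)
  have -> : 2 * eps / N = 2 * (eps / N) by rewrite mulrA.
  split; lra.
rewrite K_P; split.
- case=> [[h nP]|[[|n] _ Gx]|h|h].
  + rewrite (exprz_predn j r.+1) !ler_pM2l// in h.
    have j0 : j - r.+1%:Z = 0 by apply: dyadic_unique zpi' _; lra.
    have jr : j = r.+1%:Z by apply/eqP; rewrite -subr_eq0 j0.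
    rewrite j0 expr0z mul1r in h; apply: Or41; split => //; left.
    by rewrite jr -exprnP in nP; split=> //; lra.
  + move/S1E : Gx; rewrite exprz_succn => h.
    have j0 : j + 1%:Z = 0 by apply: dyadic_unique zpi' _; lra.
    rewrite j0 expr0z mul1r in h; apply: Or44; split; last exact: h.
    by clear -j0; lia.
  + have := F_bounds Gx; move/F_P : Gx; rewrite exprz_succn => Gx h.
    have j0 : j + n.+1%:Z = 0 by apply: dyadic_unique zpi' _; lra.
    rewrite j0 expr0z mul1r in Gx; apply: Or42; exists n; split; last exact: Gx.
    by clear -j0; lia.
  + have [xlt|xge] := ltP (2 ^ j * z) (2 * pi).
      have j0 : j = 0 by apply: dyadic_unique zpi' _; lra.
      by rewrite j0 expr0z mul1r in h; apply: Or43; split=> //; lra.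
    rewrite (exprz_predn j 1) expr1 in h xge.
    have j0 : j - 1%:Z = 0 by apply: dyadic_unique zpi' _; lra.
    by rewrite j0 expr0z mul1r in h xge; lra.
  + rewrite (exprz_predn j r.+1) -NeN -mulrDr !ler_pM2l// in h.
    have j0 : j - r.+1%:Z = 0 by apply: dyadic_unique zpi' _; lra.
    have jr : j = r.+1%:Z by apply/eqP; rewrite -subr_eq0 j0.
    by rewrite j0 expr0z mul1r in h; apply: Or41; split => //; right.
- case=> [[-> [[zt nP]|h]]|[n [-> Gn]]|[-> h]|[-> h]].
  + apply: Or41; rewrite -exprnP; split=> //; rewrite !ler_pM2l//; lra.
  + by apply: Or44; rewrite -exprnP -NeN -mulrDr !ler_pM2l.
  + apply: Or42; exists n.+1 => //=; apply/F_P; rewrite exprz_succn.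
    have -> : Negz n + n.+1%:Z = 0 by clear; lia.
    by rewrite expr0z mul1r.
  + by apply: Or43; rewrite expr0z mul1r; lra.
  + by apply: Or42; exists 0%N => //=; apply/S1E; rewrite exprz_succn addNr expr0z mul1r.
Qed.

Lemma K_dyadic_base (z : R) : pi < z < 2 * pi ->
  z != t -> z != t + 2 * eps / N -> z != t + 2 * eps ->
  exists j : int, forall i, K_ r eps (2 ^ i * z) <-> i = j.
Proof.
have N4 := N_ge4; have p0 := pi_gt0 R; have pt := pi_lt_t; have tp := t_lt_2pi.
have te := t_eps; have e := tE; have e0 := eps_gt0.
have N0 : 0 < N by lra.
have eN : 2 * eps / N < 2 * eps by rewrite ltr_pdivrMr//; nra.
have eN0 : 0 < 2 * eps / N by rewrite divr_gt0//; lra.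
have GN n : G_ n (N * z - N * pi) -> z <= t.
  move=> /G_bounds => h; rewrite -(ler_pM2l N0); lra.
move=> zpi zt ze1 ze2.
have [z1|z1|ze] := ltgtP z t; last by rewrite ze eqxx in zt.
  have [[n _ Gn]|nP] := pselect (P_ (N * z - N * pi)).
    exists (Negz n) => i; rewrite K_dyadicP//; split => [|->].
      case=> [[_ [[_ nP]|h]]|[m [-> Gm]]|[_ h]|[_ h]]; try by exfalso; lra.
        by case: nP; exists n.
      by rewrite (G_disjoint Gn Gm).
    by apply: Or42; exists n.
  exists r.+1%:Z => i; rewrite K_dyadicP//; split => [|->].
    case=> [[//]|[m [-> Gm]]|[_ h]|[_ h]]; try by exfalso; lra.
    by case: nP; exists m.
  by apply: Or41; split => //; left; split => //; exact: ltW.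
have nG n : ~ G_ n (N * z - N * pi) by move=> /GN; lra.
have [z2|z2|ze] := ltgtP z (t + 2 * eps / N); last by rewrite ze eqxx in ze1.
  exists r.+1%:Z => i; rewrite K_dyadicP//; split => [|->].
    case=> [[//]|[m [-> Gm]]|[_ h]|[_ h]]; try by exfalso; lra.
    by case: (nG m).
  by apply: Or41; split => //; right; lra.
have [z3|z3|ze] := ltgtP z (t + 2 * eps); last by rewrite ze eqxx in ze2.
  exists (-1) => i; rewrite K_dyadicP//; split => [|->].
    case=> [[_ [[h _]|h]]|[m [-> Gm]]|[_ h]|[//]]; try by exfalso; lra.
    by case: (nG m).
  by apply: Or44; split => //; lra.
exists 0 => i; rewrite K_dyadicP//; split => [|->].
  case=> [[_ [[h _]|h]]|[m [-> Gm]]|[//]|[_ h]]; try by exfalso; lra.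
  by case: (nG m).
by apply: Or43; split => //; lra.
Qed.

(** The dyadic orbits of the endpoints at which two pieces of the tiling meet. *)
Definition dyadic_bad : set R :=
  \bigcup_(i in [set: int]) [set 2 ^ i * c | c in [set pi; t; t + 2 * eps / N; t + 2 * eps]].

Lemma countable_dyadic_bad : countable dyadic_bad.
Proof.
apply: bigcup_countable => // i _; apply: finite_set_countable.
apply: finite_image; rewrite !finite_setU; do !split; exact: finite_set1.
Qed.

Lemma K_dyadic (x : R) : 0 < x -> ~ dyadic_bad x ->
  exists j : int, forall i, K_ r eps (2 ^ i * x) <-> i = j.
Proof.
move=> x0 nb; have [k hk] := dyadic_exists x0.
have nc c : [set pi; t; t + 2 * eps / N; t + 2 * eps] c -> 2 ^ k * x != c.
  move=> hc; apply/eqP => e; apply: nb; exists (- k) => //; exists c => //.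
  by rewrite -e mulrA -expfzDr ?pnatr_eq0// addNr expr0z mul1r.
have zpi : pi < 2 ^ k * x < 2 * pi.
  have /eqP := nc pi (or_introl (or_introl (or_introl erefl))); lra.
have [|||j hj] := K_dyadic_base zpi.
- by apply: nc; left; left; right.
- by apply: nc; left; right.
- by apply: nc; right.
exists (j + k) => i; rewrite -[i in 2 ^ i](subrK k) expfzDr ?pnatr_eq0// -mulrA hj.
by split=> [<-|->]; rewrite ?subrK ?addrK.
Qed.

Lemma measurable_affine (c a : R) (S : set R) : c != 0 -> measurable S ->
  measurable (affine c a S).
Proof.
move=> c0 mS; have -> : affine c a S = affmap c^-1 (- (a / c)) @^-1` S.
  apply/seteqP; split=> x; rewrite affineP//= /affmap mulrBl mulrC;
    by rewrite [_ / c]mulrC.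
by rewrite -[X in measurable X]setTI; apply: measurable_affmap.
Qed.

Lemma measurable_E n : measurable (E_ r eps n).
Proof.
elim: n => [|n IH] /=; apply: measurable_affine; rewrite ?oner_neq0//.
  exact: measurable_itv.
by apply: measurable_affine => //; rewrite invr_eq0 expf_eq0 pnatr_eq0 andbF.
Qed.

Lemma measurable_K : measurable (K_ r eps).
Proof.
apply: measurableU; last by apply: measurableU; first apply: measurableU; exact: measurable_itv.
apply: measurableU.
  apply: measurableD; first exact: measurable_itv.
  apply: bigcup_measurable => n _; exact: measurable_E.
apply: bigcup_measurable => n _; apply: measurable_affine; last exact: measurable_E.
by rewrite invr_eq0 expf_eq0 pnatr_eq0 andbF.
Qed.

Lemma K_fin : (@lebesgue_measure R (K_ r eps) < +oo)%E.
Proof.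
apply: (@le_lt_trans _ _ (@lebesgue_measure R `[0, N * pi + 2 * pi])).
  apply: le_measure; rewrite ?inE; [exact: measurable_K|exact: measurable_itv|].
  have Npi : 0 <= N * pi by rewrite mulr_ge0 ?pi_ge0// exprn_ge0.
  have p0 := pi_gt0 R.
  by move=> x /K_range; rewrite /= in_itv /=; lra.
by rewrite lebesgue_measure_itv /=; case: ifP => _; rewrite ltry.
Qed.

Lemma F_itv n : exists a b : R, a < b /\ forall x, a <= x <= b -> F_ r eps n x.
Proof.
have N4 := N_ge4; have N0 : 0 < N by lra.
have aux k : exists a b : R, a < b /\ forall x, a <= x <= b -> G_ k x.
  elim: k => [|k [a [b [ab h]]]].
    exists (t / 2 + eps / N), (t / 2 + eps); split.
      rewrite ltrD2l ltr_pdivrMr//; have := eps_gt0; nra.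
    by move=> x hx; rewrite /= /S1 /= in_itv.
  have M0 : 0 < N * 2 ^+ k.+1 by rewrite mulr_gt0// exprn_gt0.
  exists ((a + N * pi) / (N * 2 ^+ k.+1)), ((b + N * pi) / (N * 2 ^+ k.+1)).
  split; first by rewrite ltr_pM2r ?invr_gt0// ltrD2r.
  move=> x; rewrite ler_pdivrMr// ler_pdivlMr// => hx /=.
  apply/F_P/h; move: hx; rewrite mulrA (mulrC x); lra.
by have [a [b [ab h]]] := aux n.+1; exists a, b.
Qed.

End Tiling.

(** * Exponentials on a set that tiles by translations *)

Section Polarisation.
Context {R : realType}.
Local Notation Re := complex.Re.
Local Notation Im := complex.Im.

(** Polarisation: inner products over two domains agree if the norms of all linear
    combinations do. *)
Lemma ip_polar (D D' : set R) (f g : R -> R[i]) :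
  measurable D -> measurable D' ->
  cL2 D f -> cL2 D g -> cL2 D' f -> cL2 D' g ->
  (forall z w, sqnorm D (fun x => z * f x + w * g x) =
               sqnorm D' (fun x => z * f x + w * g x)) ->
  ip D f g = ip D' f g.
Proof.
move=> mD mD' Lf Lg Lf' Lg' h.
have h10 : sqnorm D f = sqnorm D' f.
  have := h 1 0; have -> : (fun x => 1 * f x + 0 * g x) = f => [|//].
  by apply/funext => x; rewrite mul0r mul1r addr0.
have aux (w : R[i]) : Re (ip D f (fun x => w * g x)) = Re (ip D' f (fun x => w * g x)).
  have Lw := cL2Z mD w Lg; have Lw' := cL2Z mD' w Lg'.
  have e1 : sqnorm D (fun x => w * g x) = sqnorm D' (fun x => w * g x).
    have := h 0 w; have -> : (fun x => 0 * f x + w * g x) = (fun x => w * g x) => [|//].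
    by apply/funext => x; rewrite mul0r add0r.
  have := h 1 w; have -> : (fun x => 1 * f x + w * g x) = (fun x => f x + w * g x).
    by apply/funext => x; rewrite mul1r.
  rewrite !sqnormDE// h10 e1; lra.
have := aux (Complex 0 1); have := aux 1.
rewrite !ipZr// !ReM !Re_conjc !Im_conjc.
have -> : Re (Complex 0 1 : R[i]) = 0 by [].
have -> : Im (Complex 0 1 : R[i]) = 1 by [].
have -> : Re (1 : R[i]) = 1 by [].
have -> : Im (1 : R[i]) = 0 by [].
by move=> e1 e2; apply: complexP; lra.
Qed.

End Polarisation.

Section TranslationTile.
Context {R : realType}.
Local Notation mu := (@lebesgue_measure R).
Local Notation I := (@period R).
Variables (K : set R) (m : nat).
Local Notation s := (m%:R * (2 * pi) : R).
Hypothesis m_gt1 : (1 < m)%N.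
Hypothesis mK : measurable K.
Hypothesis fK : (mu K < +oo)%E.
Hypothesis K_cover : forall x, K x -> 0 <= x <= 2 * pi \/ 0 <= x - s <= 2 * pi.
Variable Z : set R.
Hypothesis cZ : countable Z.
Hypothesis K_tile : forall x, 0 <= x <= 2 * pi -> ~ Z x -> K (x + s) <-> ~ K x.
Implicit Types (f g h : R -> R[i]).
#[local] Hint Resolve measurable_period cL2_expi : core.

(** The value at [x] of the function that agrees with [h] on [K] and is transported to
    the period: exactly one of [x] and [x + s] lies in [K], for almost every [x]. *)
Definition fold h (x : R) : R[i] := char_fun K x * h x + char_fun K (x + s) * h (x + s).

Lemma cmeas_shift h : cmeas h -> cmeas (fun x => h (x + s)).
Proof. by move=> mh; have := cmeas_affmap 1 s mh; under eq_fun do rewrite mul1r. Qed.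

Lemma cmeas_fold h : cmeas h -> cmeas (fold h).
Proof.
move=> mh; have mc := cmeas_char mK.
by apply: cmeasD; apply: cmeasM => //; exact: cmeas_shift.
Qed.

Lemma energy_fold h : cmeas h -> energy I (fold h) = energy K h.
Proof.
move=> mh; pose F x : \bar R := (sqn (char_fun K x * h x))%:E.
have mc := cmeas_char mK.
have mF : measurable_fun setT F by apply: measurable_sqnE; apply: cmeasM.
have F0 x : (0 <= F x)%E by rewrite lee_fin sqn_ge0.
have mFs : measurable_fun setT (fun x : R => F (x + s)).
  by apply: measurable_sqnE; apply: (@cmeas_shift (fun x => char_fun K x * h x)); apply: cmeasM.
have p0 := pi_gt0 R.
(* As m is at least 2, the period and its translate by s are disjoint. *)
have s4 : 4 * pi <= s.
  rewrite mulrA ler_pM2r// -natrM -[4]/(4%:R) ler_nat.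
  by rewrite -[4%N]/(2 * 2)%N leq_mul2r m_gt1.
pose I' : set R := `[0 + s, 2 * pi + s]%classic.
have mI' : measurable I' by exact: measurable_itv.
have IP x : I x <-> 0 <= x <= 2 * pi by rewrite /period /= in_itv.
have I'P x : I' x <-> 0 <= x - s <= 2 * pi by rewrite /I' /= in_itv /=; split; lra.
have e1 : energy K h = (\int[mu]_x F x)%E by rewrite -energy_char.
have e2 : (\int[mu]_x F x = \int[mu]_(x in I) F x + \int[mu]_(x in I') F x)%E.
  rewrite -ge0_integral_setU//; last 2 first.
  - exact: measurable_funTS.
  - by apply/disj_setPS => x [/IP h1 /I'P h2]; lra.
  rewrite [RHS]integral_mkcond; apply: eq_integral => x _; rewrite patchE.
  case: ifPn => // /negP nx; rewrite /F char_funE ifF ?mul0r ?sqn0//.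
  apply/negP; rewrite inE => /K_cover hx; apply: nx; rewrite inE.
  by case: hx => hx; [left; apply/IP|right; apply/I'P].
  exact: measurable_period.
have e3 : (\int[mu]_(x in I') F x = \int[mu]_(x in I) F (x + s)%R)%E.
  rewrite integral_mkcond [RHS]integral_mkcond.
  have := @ge0_integral_affmap _ 1 s ltr01 (F \_ I').
  rewrite invr1 mul1e => <-.
  - apply: eq_integral => x _; rewrite /affmap mul1r !patchE.
    have -> // : (x + s \in I') = (x \in I).
    apply/idP/idP; rewrite !inE.
    + by move=> /I'P; rewrite addrK => hx; apply/IP.
    + by move=> /IP hx; apply/I'P; rewrite addrK.
  - apply/measurable_restrict => //=; exact: measurable_funTS.
  - by move=> x; rewrite patchE; case: ifP.
have e4 : (\int[mu]_(x in I) (F x + F (x + s)%R) =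
    \int[mu]_(x in I) F x + \int[mu]_(x in I') F x)%E.
  rewrite e3 ge0_integralD//; try exact: measurable_period; exact: measurable_funTS.
apply/esym; apply: (etrans (etrans e1 e2) (etrans (esym e4) _)).
apply/esym; rewrite /energy; apply: ae_eq_integral; try exact: measurable_period.
- by apply: measurable_sqnE; exact: cmeas_fold.
- by apply: emeasurable_funD; exact: measurable_funTS.
apply: (ae_countable cZ) => x nZ /IP Ix; have KT := K_tile Ix nZ.
rewrite /fold /F -EFinD; congr EFin; rewrite !char_funE.
have [Kx|nKx] := pselect (K x).
- have nKs : ~ K (x + s) by move/KT.
  by rewrite (memNset nKs) (mem_set Kx) !mul0r sqn0 !addr0.
- have Ks : K (x + s) by apply/KT.
  by rewrite (memNset nKx) (mem_set Ks) !mul0r sqn0 !add0r.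
Qed.

Definition periodic_s f := forall x, f (x + s) = f x.

Lemma periodic_expi k : periodic_s (expi k).
Proof.
move=> x; rewrite /expi mulrDr cisD [k%:~R * (m%:R * _)]mulrA.
have -> : k%:~R * m%:R = (k * m%:Z)%:~R :> R by rewrite intrM.
by rewrite cis_int2pi mulr1.
Qed.

Lemma sqnorm_periodic f : cmeas f -> periodic_s f -> sqnorm K f = sqnorm I f.
Proof.
move=> mf pf; rewrite -!fine_energy -energy_fold//; congr fine.
apply: ae_eq_energy => //; first exact: cmeas_fold.
apply: (ae_countable cZ) => x nZ; rewrite {1}/period /= in_itv /= => Ix.
have KT := K_tile Ix nZ; rewrite /fold pf !char_funE.
have [Kx|nKx] := pselect (K x).
- have nKs : ~ K (x + s) by move/KT.
  by rewrite (memNset nKs) (mem_set Kx) mul0r mul1r addr0.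
- have Ks : K (x + s) by apply/KT.
  by rewrite (memNset nKx) (mem_set Ks) mul0r mul1r add0r.
Qed.

Lemma cL2_K_expi k : cL2 K (expi k).
Proof.
apply: (cL2_bounded (M := 1)) => //; first exact: cmeas_expi.
by move=> x _; rewrite sqn_expi.
Qed.

Lemma ip_K_expi k l : ip K (expi k) (expi l) =
  if k == l then real_complex R (2 * pi) else 0.
Proof.
rewrite -ip_expi; apply: ip_polar => //; try exact: cL2_K_expi.
move=> z w; apply: sqnorm_periodic; last by move=> x; rewrite !periodic_expi.
by apply: cmeasD; apply: cmeasZ; exact: cmeas_expi.
Qed.

(** The exponentials are invariant under translation by [s], so folding commutes with
    subtracting a trigonometric polynomial, and [h] is approximated on [K] as well as
    its folding is on the period. *)
Lemma fproj_K_dense h : cL2 K h -> forall e, 0 < e ->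
  exists n, sqnorm K (fun x => h x - fproj (sym n) (fold h) x) < e.
Proof.
move=> [mh Lh] e e0.
have LF : cL2 I (fold h) by split; [exact: cmeas_fold|rewrite energy_fold].
have [_ /cvgr0_norm_lt/(_ _ e0) [n _ /(_ n (leqnn n))]] := fser_cL2 LF.
rewrite /= ger0_norm ?ferr_ge0// => hn; exists n; apply: le_lt_trans hn.
have [mp _] := cL2_fproj (sym n) (fold h).
have pp : periodic_s (fproj (sym n) (fold h)).
  by move=> x; apply: eq_bigr => k _; rewrite periodic_expi.
have mB : cmeas (fun x => h x - fproj (sym n) (fold h) x) by apply: cmeasB.
rewrite /ferr -!fine_energy -(energy_fold mB) le_eqVlt; apply/orP; left; apply/eqP; congr fine.
apply: ae_eq_energy => //; first exact: cmeas_fold.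
  by apply: cmeasB => //; exact: cmeas_fold.
apply: (ae_countable cZ) => x nZ; rewrite {1}/period /= in_itv /= => Ix.
have KT := K_tile Ix nZ.
rewrite {1}/fold pp; move: (fproj _ _ x) => p; rewrite /fold !char_funE.
have [Kx|nKx] := pselect (K x).
- have nKs : ~ K (x + s) by move/KT.
  by rewrite (memNset nKs) (mem_set Kx) !mul0r !mul1r !addr0.
- have Ks : K (x + s) by apply/KT.
  by rewrite (memNset nKx) (mem_set Ks) !mul0r !mul1r !add0r.
Qed.

End TranslationTile.

(** * Wavelets from sets with both tiling properties *)

Section DyadicTile.
Context {R : realType}.
Local Notation mu := (@lebesgue_measure R).
Local Notation Re := complex.Re.
Local Notation Im := complex.Im.
Local Notation c2pi := (real_complex R (2 * pi)).
Variable K : set R.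
Hypothesis mK : measurable K.
Hypothesis K_gt0 : forall x, K x -> 0 < x.
Hypothesis K_expi : forall k, cL2 K (expi k).
Hypothesis K_on : forall k l, ip K (expi k) (expi l) = if k == l then c2pi else 0.
Hypothesis K_dense : forall h, cL2 K h -> forall e, 0 < e ->
  exists (s : seq int) (c : int -> R[i]),
    sqnorm K (fun x => h x - \sum_(k <- s) c k * expi k x) < e.
Variable B : set R.
Hypothesis cB : countable B.
Hypothesis K_dil : forall x, 0 < x -> ~ B x ->
  exists j : int, forall i, K (2 ^ i * x) <-> i = j.
Variable psi : R -> R[i].
Hypothesis hpsi : fourierL2 psi (char_fun K).
Implicit Types (f g h : R -> R[i]) (j k : int).

Lemma pow2_gt0 j : 0 < (2 : R) ^ j.
Proof. exact: exprz_gt0. Qed.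

(** The modulus of the transform of the wavelet: the normalisation of the wavelet times
    the Jacobian of the dilation. *)
Definition amp j : R := 2 `^ (j%:~R / 2) * (2 ^ j)^-1.

Lemma amp_gt0 j : 0 < amp j.
Proof. by rewrite mulr_gt0 ?powR_gt0 ?invr_gt0 ?pow2_gt0. Qed.

Lemma amp_sq j : amp j ^+ 2 * 2 ^ j = 1.
Proof.
have e : (2 `^ (j%:~R / 2) : R) ^+ 2 = 2 ^ j.
  by rewrite -powR_mulrn ?powR_ge0// -powRrM divfK// powR_intmul.
by rewrite /amp exprMn e expr2 mulrA divff ?mul1r ?mulVf ?gt_eqF ?pow2_gt0.
Qed.

Definition char_expi (k : int) (x : R) : R[i] := char_fun K x * expi (- k) x.

Definition wavelet_hat (jk : int * int) (xi : R) : R[i] :=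
  real_complex R (amp jk.1) * char_expi jk.2 ((2 ^ jk.1)^-1 * xi).

Lemma cL2_char_expi k : cL2 setT (char_expi k).
Proof. by apply/cL2_char; [exact: mK|exact: cmeas_expi|exact: K_expi]. Qed.

Lemma cL2_scale (a : R) f : 0 < a -> cL2 setT f -> cL2 setT (fun x => f (a * x)).
Proof.
move=> a0 Lf; have := cL2_affmap 0 a0 Lf.
by under eq_fun do rewrite addr0.
Qed.

Lemma sqnorm_scale (a : R) f : 0 < a -> cL2 setT f ->
  sqnorm setT (fun x => f (a * x)) = a^-1 * sqnorm setT f.
Proof.
move=> a0 Lf; rewrite -(sqnorm_affmap 0 a0 Lf); apply: eq_sqnorm => x _.
by rewrite addr0.
Qed.

Lemma fourier_wavelet jk : fourierL2 (wavelet_system psi jk) (wavelet_hat jk).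
Proof.
case: jk => j k; rewrite /wavelet_system /wavelet_hat /=.
have h := fourierL2Z (2 `^ (j%:~R / 2))%:C%C (fourierL2_affine (- k%:~R) (pow2_gt0 j) hpsi).
suff -> : (fun xi => real_complex R (amp j) * char_expi k ((2 ^ j)^-1 * xi)) =
  (fun x => (2 `^ (j%:~R / 2))%:C%C * (real_complex R (2 ^ j)^-1 *
     (cis ((2 ^ j)^-1 * x * - k%:~R) * char_fun K ((2 ^ j)^-1 * x)))) by [].
apply/funext => x; rewrite /char_expi /expi /amp rmorphM /= -!mulrA; congr (_ * (_ * _)).
by rewrite [RHS]mulrC; congr (_ * cis _); rewrite mulrNz; ring.
Qed.

Lemma cL2_wavelet_hat jk : cL2 setT (wavelet_hat jk).
Proof. by have [] := fourier_wavelet jk. Qed.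

(** Different dilations have disjoint supports up to the countable set [B]; equal
    dilations reduce by scaling to the orthogonality of exponentials on [K]. *)
Lemma ip_wavelet_hat jk jk' : ip setT (wavelet_hat jk) (wavelet_hat jk') = c2pi * (jk == jk')%:R.
Proof.
case: jk jk' => [j k] [j' k']; rewrite xpair_eqE.
have [<-{j'}|jj'] /= := eqVneq j j'; last first.
  rewrite mulr0 /ip -[RHS](cint0 measurableT).
  have [m1 _] := cL2_wavelet_hat (j, k); have [m2 _] := cL2_wavelet_hat (j', k').
  apply: ae_eq_cint => //; first by apply: cmeasM => //; exact: cmeas_conjc.
  apply: (ae_countable cB) => x nB _.
  have c0 : conjc 0 = 0 :> R[i] by apply: complexP; rewrite ?Re_conjc ?Im_conjc /= ?oppr0.
  rewrite /wavelet_hat /char_expi !char_funE.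
  have [Kj|nKj] := pselect (K ((2 ^ j)^-1 * x)); last first.
    by rewrite (memNset nKj) !(mul0r, mulr0).
  have [Kj'|nKj'] := pselect (K ((2 ^ j')^-1 * x)); last first.
    by rewrite (memNset nKj') !(mul0r, mulr0) c0 mulr0.
  exfalso.
  have x0 : 0 < x by have := K_gt0 Kj; rewrite pmulr_rgt0// invr_gt0 pow2_gt0.
  have [i hi] := K_dil x0 nB.
  rewrite invr_expz in Kj; rewrite invr_expz in Kj'.
  move/eqP: jj'; apply; move/hi: Kj; move/hi: Kj'; clear; lia.
have d0 : 0 < ((2 : R) ^ j)^-1 by rewrite invr_gt0 pow2_gt0.
have L1 : cL1 setT (fun x => char_expi k x * conjc (char_expi k' x)).
  by apply: cL1M => //; [exact: cL2_char_expi|exact/cL2_conjc/cL2_char_expi].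
have [L1' e1] := cL1_affmap 0 d0 L1.
have e2 : cint setT (fun x => char_expi k x * conjc (char_expi k' x)) =
    if k == k' then c2pi else 0.
  rewrite -[k == k']eqr_opp -K_on /ip -(cint_char K); apply: eq_cint => x _.
  rewrite /char_expi conjcM !char_funE; case: (x \in K); rewrite ?mul0r ?mul1r//.
  have -> : conjc 1 = 1 :> R[i] by apply: complexP; rewrite ?Re_conjc ?Im_conjc /= ?oppr0.
  by rewrite mul1r.
have -> : ip setT (wavelet_hat (j, k)) (wavelet_hat (j, k')) =
   cint setT (fun x => real_complex R (amp j ^+ 2) *
      (char_expi k ((2 ^ j)^-1 * x + 0) * conjc (char_expi k' ((2 ^ j)^-1 * x + 0)))).
  apply: eq_cint => x _; rewrite addr0.
  have hatE l : wavelet_hat (j, l) x = real_complex R (amp j) * char_expi l ((2 ^ j)^-1 * x) by [].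
  rewrite !hatE; move: (char_expi k _) (char_expi k' _) => u v; rewrite conjcM.
  by apply: complexP; rewrite !ReImE /=; ring.
rewrite cintZ// e1 e2 mulrA -rmorphM /= invrK amp_sq mul1r.
by case: eqP => _; rewrite ?mulr1 ?mulr0.
Qed.

Lemma ip_wavelet jk jk' :
  ip setT (wavelet_system psi jk) (wavelet_system psi jk') = (jk == jk')%:R.
Proof.
have := fourierL2_ip (fourier_wavelet jk) (fourier_wavelet jk').
rewrite ip_wavelet_hat => /(congr1 ( *%R (real_complex R (2 * pi)^-1))).
by rewrite !mulrA [_ * c2pi]mulrC c2piV !mul1r => ->.
Qed.

Lemma wavelet_hat_le0 jk xi : xi <= 0 -> wavelet_hat jk xi = 0.
Proof.
move=> x0; rewrite /wavelet_hat /char_expi char_funE ifF ?mul0r ?mulr0//.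
apply/negP; rewrite inE => /K_gt0.
by rewrite pmulr_rgt0 ?invr_gt0 ?pow2_gt0// ltNge x0.
Qed.

Definition combo (l : seq (R[i] * (int * int))) (e : int * int -> R -> R[i])
  (x : R) : R[i] := \sum_(q <- l) q.1 * e q.2 x.

(** [g] is a mean square limit of finite linear combinations of the wavelet transforms.
    Lists of coefficients and indices, possibly with repetitions, make sums of
    combinations a concatenation; [combo_undup] removes the repetitions. *)
Definition approx g := forall d, 0 < d -> exists l,
  sqnorm setT (fun x => g x - combo l wavelet_hat x) < d.

Lemma cL2_combo l : cL2 setT (combo l wavelet_hat).
Proof. by apply: cL2_sum => // q; apply: cL2Z => //; exact: cL2_wavelet_hat. Qed.

Lemma approx_lim g : cL2 setT g -> (forall d, 0 < d -> exists2 h, cL2 setT h /\ approx h &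
  sqnorm setT (fun x => g x - h x) < d) -> approx g.
Proof.
move=> Lg H d d0; have d4 : 0 < d / 4 by lra.
have [h [Lh Ah] hd] := H _ d4; have [l hl] := Ah _ d4; exists l.
have -> : (fun x => g x - combo l wavelet_hat x) =
   (fun x => (g x - h x) + (h x - combo l wavelet_hat x)).
  by apply/funext => x; rewrite addrA subrK.
apply: le_lt_trans (sqnormD_le2 measurableT _ _) _; try exact: cL2B.
  by apply: cL2B => //; exact: cL2_combo.
lra.
Qed.

Lemma approxD g h : cL2 setT g -> cL2 setT h -> approx g -> approx h ->
  approx (fun x => g x + h x).
Proof.
move=> Lg Lh Ag Ah d d0; have d4 : 0 < d / 4 by lra.
have [l hl] := Ag _ d4; have [l' hl'] := Ah _ d4; exists (l ++ l').
have -> : (fun x => g x + h x - combo (l ++ l') wavelet_hat x) =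
   (fun x => (g x - combo l wavelet_hat x) + (h x - combo l' wavelet_hat x)).
  by apply/funext => x; rewrite /combo big_cat opprD addrACA.
apply: le_lt_trans (sqnormD_le2 measurableT _ _) _;
  try by apply: cL2B => //; exact: cL2_combo.
lra.
Qed.

Lemma approx0 : approx (fun=> 0).
Proof.
move=> d d0; exists [::].
have -> : (fun x : R => 0 - combo [::] wavelet_hat x) = (fun=> 0 : R[i]).
  by apply/funext => x; rewrite /combo big_nil subr0.
by rewrite sqnorm0.
Qed.

Lemma cmeas_char_scale j : cmeas (fun x => char_fun K ((2 ^ j)^-1 * x) : R[i]).
Proof.
by have := cmeas_affmap (2 ^ j)^-1 0 (cmeas_char mK); under eq_fun do rewrite addr0.
Qed.

Lemma sqn_char_le (A : set R) x : sqn (char_fun A x : R[i]) <= 1.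
Proof. by rewrite char_funE; case: ifP; rewrite ?sqn1 ?sqn0. Qed.

Lemma cL2_piece j g : cL2 setT g ->
  cL2 setT (fun x => char_fun K ((2 ^ j)^-1 * x) * g x).
Proof.
move=> Lg; apply: (@cL2M _ _ measurableT _ _ 1) => // [|x _].
  exact: cmeas_char_scale.
exact: sqn_char_le.
Qed.

(** Rescaled by [2 ^ j], the piece of [g] on [2 ^ j K] is a function on [K], which is
    approximated by exponentials. *)
Lemma approx_piece j g : cL2 setT g ->
  approx (fun x => char_fun K ((2 ^ j)^-1 * x) * g x).
Proof.
move=> Lg d d0; have j0 := pow2_gt0 j; have i0 : 0 < ((2 : R) ^ j)^-1 by rewrite invr_gt0.
pose h x := g (2 ^ j * x).
have Lh : cL2 K h by apply: (@cL2_subset _ K setT) => //; exact: cL2_scale.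
have [s [c hs]] := K_dense Lh (mulr_gt0 d0 i0).
exists [seq (real_complex R (amp j)^-1 * c k, (j, - k)) | k <- s].
pose q x : R[i] := h x - \sum_(k <- s) c k * expi k x.
have Lq : cL2 K q.
  by apply: cL2B => //; apply: cL2_sum => // k; apply: cL2Z => //; exact: K_expi.
pose p x : R[i] := char_fun K x * q x.
have Lp : cL2 setT p by apply/cL2_char; [exact: mK|exact: Lq.1|exact: Lq].
have -> : (fun x => char_fun K ((2 ^ j)^-1 * x) * g x - combo
    [seq (real_complex R (amp j)^-1 * c k, (j, - k)) | k <- s] wavelet_hat x) =
  (fun x => p ((2 ^ j)^-1 * x)).
  apply/funext => x; rewrite /p /q /h mulrA divff ?gt_eqF// mul1r mulrBr /combo big_map.
  congr (_ - _); rewrite mulr_sumr; apply: eq_bigr => k _.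
  rewrite /wavelet_hat /char_expi /= opprK.
  transitivity ((real_complex R (amp j)^-1 * real_complex R (amp j)) * (c k *
     (char_fun K ((2 ^ j)^-1 * x) * expi k ((2 ^ j)^-1 * x)))).
    by apply: complexP; rewrite !ReImE; ring.
  rewrite -rmorphM /= mulVf ?gt_eqF ?amp_gt0// mul1r.
  by apply: complexP; rewrite !ReImE; ring.
rewrite sqnorm_scale// invrK sqnorm_char -ltr_pdivlMl// mulrC.
exact: hs.
Qed.


Lemma sum_indicator_sym (n : nat) (j : int) :
  \sum_(i <- sym n) (if i == j then 1 else 0) = (j \in sym n)%:R :> R[i].
Proof.
have [jn|jn] := boolP (j \in sym n).
  rewrite (bigD1_seq j) ?sym_uniq//= eqxx big1 ?addr0// => i /negPf ->//.
by rewrite big1_seq// => i /andP[_ iin]; case: eqP => // ij; rewrite -ij iin in jn.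
Qed.

(** Almost every positive point lies in exactly one [2 ^ j K], so that the sum of the
    pieces for [j] from [- n] to [n] is [0] or [g] at each point, and is eventually
    equal to [g]. *)
Lemma approx_half_line g : cL2 setT g ->
  {ae mu, forall x, x <= 0 -> g x = 0} -> approx g.
Proof.
move=> Lg g0; pose D : set R := `]0, +oo[ `\` B.
have mD : measurable D by apply: measurableD => //; exact: countable_measurable.
(* The representative of g that vanishes wherever the dilates of K do not tile. *)
pose gD x := char_fun D x * g x.
have LgD : cL2 setT gD.
  by apply: (@cL2M _ _ measurableT _ _ 1) => // [|x _];
    [exact: cmeas_char|exact: sqn_char_le].
have gDE : sqnorm setT (fun x => g x - gD x) = 0.
  rewrite -(@sqnorm0 R setT) -!fine_energy; congr fine; apply: ae_eq_energy => //.
  - by apply: cmeasB; [exact: Lg.1|exact: LgD.1].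
  have nBae : {ae mu, forall x, ~ B x} by apply: (ae_countable cB).
  apply: (@ae_sub _ (fun x => (x <= 0 -> g x = 0) /\ ~ B x)); last exact: ae_and.
  move=> x [gx nB] _.
  rewrite /gD char_funE.
  have [x0|x0] := leP x 0; first by rewrite gx// mulr0 subrr.
  by rewrite mem_set ?mul1r ?subrr//; split => //; rewrite /= in_itv /= x0.
apply: approx_lim => // d d0; exists gD; last by rewrite gDE.
split=> //; apply: approx_lim => // {}d {}d0.
pose u n x : R[i] := \sum_(j <- sym n) char_fun K ((2 ^ j)^-1 * x) * gD x.
have uE x : exists j, forall n, u n x = (j \in sym n)%:R * gD x.
  have [xD|nxD] := pselect (D x); last first.
    exists 0 => n; have gx : gD x = 0 by rewrite /gD char_funE memNset ?mul0r.
    by rewrite gx mulr0 /u big1// => j _; rewrite gx mulr0.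
  have [] := xD; rewrite /= in_itv /= andbT => x0 nB.
  have [i hi] := K_dil x0 nB; exists (- i) => n.
  rewrite /u -mulr_suml -sum_indicator_sym; congr (_ * _); apply: eq_bigr => j _.
  rewrite char_funE invr_expz; congr (if _ then _ else _).
  apply/idP/eqP; rewrite inE.
  - by move/hi => <-; rewrite opprK.
  - by move=> ->; apply/hi; rewrite opprK.
have mu_ n : cL2 setT (u n) by apply: cL2_sum => // j; exact: cL2_piece.
have Au n : approx (u n).
  rewrite /u; elim: (sym n) => [|j s IH].
    by under eq_fun do rewrite big_nil; exact: approx0.
  under eq_fun do rewrite big_cons; apply: approxD => //; first exact: cL2_piece.
    by apply: cL2_sum => // i; exact: cL2_piece.
  exact: approx_piece.
have cv : sqnorm setT (fun x => u n x - gD x) @[n --> \oo] --> (0 : R).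
  apply: (@sqnorm_dominated _ _ _ _ (fun x => sqn (gD x))) => //.
  - by move=> n; exact: (mu_ n).1.
  - exact: LgD.1.
  - exact: cL2_integrable.
  - move=> n x _; have [j ->] := uE x; case: (j \in sym n).
      by rewrite mul1r subrr sqn0 sqn_ge0.
    by rewrite mul0r sub0r sqnN.
  - move=> x _; have [j uj] := uE x.
    apply: cvg_near_cst; exists `|j|%N => // n /= jn; rewrite uj.
    have -> : j \in sym n by rewrite mem_sym -abszE lez_nat.
    by rewrite mul1r subrr sqn0.
have /cvgr0_norm_lt/(_ _ d0)[n _ /(_ n (leqnn n))] := cv.
rewrite /= ger0_norm ?sqnorm_ge0// => hn; exists (u n) => //.
rewrite -sqnormN//; last by apply: cL2B.
by under eq_sqnorm do rewrite opprB.
Qed.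

Lemma combo_undup l (e : int * int -> R -> R[i]) x : combo l e x =
  \sum_(i <- undup [seq q.2 | q <- l]) (\sum_(q <- l | q.2 == i) q.1) * e i x.
Proof.
under eq_bigr do rewrite big_distrl /= big_mkcond /=.
rewrite exchange_big /=; apply: eq_big_seq => q ql.
have qu : q.2 \in undup [seq q.2 | q <- l] by rewrite mem_undup map_f.
rewrite (bigD1_seq q.2) ?undup_uniq//= eqxx big1 ?addr0// => i.
by rewrite eq_sym => /negPf ->.
Qed.

Lemma fourier_combo l :
  fourierL2 (combo l (wavelet_system psi)) (combo l wavelet_hat).
Proof.
apply: fourierL2_sum => q; apply: fourierL2Z; exact: fourier_wavelet.
Qed.

Lemma char_le0 xi : xi <= 0 -> char_fun K xi = 0 :> R[i].
Proof.
by move=> x0; rewrite char_funE memNset// => /K_gt0; rewrite ltNge x0.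
Qed.

(** Orthonormality and density are transferred from the transform side by
    [fourierL2_ip] and [fourierL2_sqnorm]. *)
Theorem H2_wavelet_tiles : H2_wavelet psi.
Proof.
split.
  by exists (char_fun K); [exact/is_fourierL2P|apply: ae_all => x; exact: char_le0].
split.
- move=> jk; exists (wavelet_hat jk); first by apply/is_fourierL2P; exact: fourier_wavelet.
  by apply: ae_all => x; exact: wavelet_hat_le0.
- by move=> jk jk'; rewrite /inner -cintT; exact: ip_wavelet.
move=> f [g /is_fourierL2P fg g0] d d0; have [Lf Lg _] := fg.
have p0 : 0 < 2 * pi :> R by exact: twopi_gt0.
have d2 : 0 < 2 * pi * d ^+ 2 by rewrite mulr_gt0// exprn_gt0.
have [l hl] := approx_half_line Lg g0 d2.
exists (undup [seq q.2 | q <- l]), (fun i => \sum_(q <- l | q.2 == i) q.1).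
under eq_fun do rewrite -combo_undup.
have hB := fourierL2B fg (fourier_combo l).
have [LB _ _] := hB.
rewrite cnorm2_cL2// lte_fin.
have : sqnorm setT (fun x => f x - combo l (wavelet_system psi) x) < d ^+ 2.
  by move: hl; rewrite (fourierL2_sqnorm hB) ltr_pM2l.
rewrite -ltr_sqrt ?exprn_gt0// sqrtr_sqr gtr0_norm//.
Qed.

End DyadicTile.

(** * Behaviour of the transform near the origin *)

Section NearZero.
Context {R : realType}.
Local Notation mu := (@lebesgue_measure R).
Variables (r : nat) (eps : R).
Hypothesis hr : (1 <= r)%N.
Hypothesis eps_gt0 : 0 < eps.
Hypothesis eps_lt : eps < (2 ^+ r - 1) / (2 ^+ r.+1 - 1) * pi.
Local Notation K := (K_ r eps).
Local Notation t := (@t_ R r).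

Lemma ae_pick (P : R -> Prop) (a b : R) : a < b -> {ae mu, forall x, P x} ->
  exists2 x, a <= x <= b & P x.
Proof.
move=> ab [A [mA A0 hA]]; apply: contrapT => nex.
suff : (mu `[a, b] <= mu A)%E.
  rewrite A0 lebesgue_measure_itv /= lte_fin ab -EFinB lee_fin; lra.
apply: le_measure; rewrite ?inE; [exact: measurable_itv|exact: mA|].
move=> x; rewrite /= in_itv /= => xab; apply: hA => Px; apply: nex; by exists x.
Qed.

Lemma F_near0 (e : R) : 0 < e -> exists n, forall x, F_ r eps n x -> 0 < x < e.
Proof.
move=> e0; have p0 := pi_gt0 R.
have [n hn] : exists n, t < n%:R * e.
  exists (Num.bound (t / e)); rewrite -ltr_pdivrMr//.
  by apply: archi_boundP; rewrite divr_ge0 ?(ltW e0)// ltW// (lt_trans p0)// pi_lt_t.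
exists n => x /(F_bounds hr eps_gt0 eps_lt) /andP[h1 h2].
have M0 : 0 < 2 ^+ n.+1 :> R by rewrite exprn_gt0.
have x0 : 0 < x by rewrite -(pmulr_rgt0 _ M0); apply: lt_trans h1.
rewrite x0 /= -(ltr_pM2l M0); apply: le_lt_trans h2 _; apply: lt_le_trans hn _.
rewrite ler_pM2r// -natrX ler_nat; apply: ltnW; apply: leq_trans (ltn_expl _ (ltnSn 1)) _.
by rewrite leq_exp2l.
Qed.

Lemma F_sub_K n : F_ r eps n `<=` K.
Proof. by move=> x Fx; left; right; exists n. Qed.

Lemma ae_pick_K (psihat : R -> R[i]) :
  {ae mu, forall x, char_fun K x = psihat x} ->
  forall (e : R) (P : R -> Prop), 0 < e -> {ae mu, forall x, P x} ->
  exists2 x, 0 < x < e & psihat x = 1 /\ P x.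
Proof.
move=> hK e P e0 hP; have [n hn] := F_near0 e0.
have [a [b [ab hab]]] := F_itv hr eps_gt0 eps_lt n.
have [x xab [x1 x2]] := ae_pick ab (ae_and hK hP).
have Fx := hab x xab; exists x; first exact: hn.
by split => //; rewrite -x1 char_funE mem_set//; exact: F_sub_K Fx.
Qed.

Lemma nonvanishing (psihat : R -> R[i]) :
  {ae mu, forall x, char_fun K x = psihat x} ->
  forall U, nbhs (0 : R) U -> ~ {ae mu, forall x, U x -> psihat x = 0}.
Proof.
move=> hK U /nbhs_ballP[e /= e0 eU] h.
have [x /andP[x0 xe] [p1 p2]] := ae_pick_K hK e0 h.
have : psihat x = 0.
  by apply: p2; apply: eU; rewrite /ball /= sub0r normrN gtr0_norm.
by rewrite p1 => /eqP; rewrite oner_eq0.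
Qed.

(** Arbitrarily close to the origin the transform takes the value [1], on some [F_ n],
    and the value [0], at negative points; both cannot be within [1 / 2] of its value
    at the origin. *)
Lemma discontinuous0 (psihat : R -> R[i]) :
  {ae mu, forall x, char_fun K x = psihat x} ->
  ~ {for (0 : R), continuous (psihat : R -> R[i]^o)}.
Proof.
move=> hK /cvgrPdist_lt /(_ (2^-1)); rewrite invr_gt0 ltr0n => /(_ isT).
move=> /nbhs_ballP[e /= e0 eU].
have [x /andP[x0 xe] [p1 _]] := ae_pick_K hK e0 (ae_all (fun _ => I)).
have ab : - (e / 2) < - (e / 4) by lra.
have [y /andP[y1 y2] hy] := ae_pick ab hK.
have p0 : psihat y = 0.
  rewrite -hy char_funE memNset// => /(K_gt0 hr eps_gt0 eps_lt); lra.
have hx : `|psihat 0 - psihat x| < 2^-1.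
  by apply: eU; rewrite /ball /= sub0r normrN gtr0_norm.
have hy' : `|psihat 0 - psihat y| < 2^-1.
  by apply: eU; rewrite /ball /= sub0r normrN ltr0_norm; lra.
have := ltrD hy' hx; rewrite p1 p0 -mulr2n -[_ *+ 2]mulr_natr mulVf ?pnatr_eq0//.
move=> /(le_lt_trans (ler_normB _ _)).
by rewrite opprB addrC addrA subrK subr0 normr1 ltxx.
Qed.

End NearZero.

Section Wavelet.
Context {R : realType}.
Variables (r : nat) (eps : R).
Hypothesis hr : (1 <= r)%N.
Hypothesis eps_gt0 : 0 < eps.
Hypothesis eps_lt : eps < (2 ^+ r - 1) / (2 ^+ r.+1 - 1) * pi.
Local Notation K := (K_ r eps).
Local Notation t := (@t_ R r).

(** The translation by [N * pi] is by a multiple of [2 * pi]. *)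
Lemma translation_vector : (2 ^ r)%:R * (2 * pi) = 2 ^+ r.+1 * pi :> R.
Proof. by rewrite natrX mulrA -exprSr. Qed.

Lemma H2_wavelet_K (psi : R -> R[i]) : fourierL2 psi (char_fun K) -> H2_wavelet psi.
Proof.
have mK := measurable_K r eps; have fK := K_fin hr eps_gt0 eps_lt.
have m1 : (1 < 2 ^ r)%N by rewrite -{1}(expn0 2) ltn_exp2l.
have Kc x : K x -> 0 <= x <= 2 * pi \/ 0 <= x - (2 ^ r)%:R * (2 * pi) <= 2 * pi.
  rewrite translation_vector => /(K_range hr eps_gt0 eps_lt)[/andP[h1 h2]|]; last by right.
  by left; rewrite ltW.
have cZ : countable [set t; t + 2 * eps] by exact: finite_set_countable.
have Kt x : 0 <= x <= 2 * pi -> ~ [set t; t + 2 * eps] x ->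
    K (x + (2 ^ r)%:R * (2 * pi)) <-> ~ K x.
  rewrite translation_vector => hx nx; apply: K_translation => //; apply/eqP => h; apply: nx; [left|right] => //.
apply: (@H2_wavelet_tiles _ K mK _ _ _ _ (dyadic_bad r eps)).
- exact: K_gt0.
- by move=> k; exact: cL2_K_expi.
- exact: (ip_K_expi m1 mK fK Kc cZ Kt).
- move=> h Lh e e0; have [n hn] := fproj_K_dense m1 mK Kc cZ Kt Lh e0.
  by exists (sym n), (fcoef (fold K (2 ^ r) h)).
- exact: countable_dyadic_bad.
- exact: K_dyadic.
Qed.

End Wavelet.

Theorem mainTheorem4 (R : realType) (r : nat) (eps : R)
  (hr : (1 <= r)%N) (eps_gt0 : 0 < eps)
  (eps_lt : eps < (2 ^+ r - 1) / (2 ^+ r.+1 - 1) * pi) :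
  (exists psi : R -> R[i], is_fourierL2 psi (char_fun (K_ r eps))) /\
  (forall psi : R -> R[i], is_fourierL2 psi (char_fun (K_ r eps)) ->
    [/\ H2_wavelet psi,
        forall psihat : R -> R[i], is_fourierL2 psi psihat ->
          forall U : set R, nbhs (0 : R) U ->
            ~ {ae @lebesgue_measure R, forall xi, U xi -> psihat xi = 0} &
        forall psihat : R -> R[i], is_fourierL2 psi psihat ->
          ~ {for (0 : R), continuous (psihat : R -> R[i]^o)}]).
Proof.
split.
  have [psi hpsi] := fourierL2_exists (measurable_K r eps) (K_fin hr eps_gt0 eps_lt).
  by exists psi; apply/is_fourierL2P.
move=> psi /is_fourierL2P hpsi; split.
- exact: H2_wavelet_K hpsi.
- move=> psihat /is_fourierL2P h.
  exact: (nonvanishing hr eps_gt0 eps_lt (fourierL2_unique hpsi h)).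
- move=> psihat /is_fourierL2P h.
  exact: (discontinuous0 hr eps_gt0 eps_lt (fourierL2_unique hpsi h)).
Qed.
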